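(* Let $T>0$ and $s>5/2$. Let $u_1,u_2$ be real-valued solutions of the Benjamin-Ono equation $$\partial_t u-\mathcal H\partial_x^2u+u\,\partial_xu=0,\qquad (x,t)\in\mathbb R\times[0,T],$$ (each with its own initial datum $u_j(\cdot,0)$) such that $$u_1,u_2\in C([0,T]:H^s(\mathbb R))\cap C^1((0,T):H^{s-2}(\mathbb R)).$$ If there exists a nonempty open set $\Omega\subset\mathbb R\times[0,T]$ such that $u_1(x,t)=u_2(x,t)$ for all $(x,t)\in\Omega$, then $u_1(x,t)=u_2(x,t)$ for all $(x,t)\in\mathbb R\times[0,T]$. In particular, if $u_1$ vanishes in $\Omega$, then $u_1\equiv0$.
   Context: $H^s(\mathbb R)$ is the usual $L^2$-based Sobolev space. $\mathcal H$ is the Hilbert transform on $\mathbb R$, $$\mathcal Hf(x)=\frac1\pi\lim_{\epsilon\downarrow0}\int_{|y|>\epsilon}\frac{f(x-y)}{y}\,dy,\qquad \widehat{\mathcal Hf}(\xi)=-i\,\mathrm{sgn}(\xi)\widehat f(\xi).$$ $C([0,T]:X)$ and $C^1((0,T):X)$ denote continuous, respectively continuously differentiable, functions of $t$ with values in the Banach space $X$. Under the stated regularity the equation holds pointwise (for the continuous representatives). *)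

(* Defs.v *)
From HB Require Import structures.
From mathcomp Require Import all_boot all_order all_algebra.
From mathcomp Require Import all_classical all_reals all_analysis.
From mathcomp Require Import complex.

Set Implicit Arguments.
Unset Strict Implicit.
Unset Printing Implicit Defensive.
Import Order.TTheory GRing.Theory Num.Theory.
Import numFieldNormedType.Exports.
Local Open Scope classical_set_scope.
Local Open Scope ring_scope.
Local Open Scope complex_scope.

(* The Fourier transform of f * 1_[-n, n], i.e., the integral of
   f(x) e^{-i x xi} over [-n, n]. *)
Definition fourier_trunc (R : realType) (f : R -> R) (n : nat) (xi : R) : R[i] :=
  (\int[lebesgue_measure]_(x in `[- n%:R, n%:R]) (f x * cos (x * xi))) +i*
  (- \int[lebesgue_measure]_(x in `[- n%:R, n%:R]) (f x * sin (x * xi))).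

(* g is the Fourier-Plancherel transform of f in L^2: it is the limit in
   L^2(R; C) of the Fourier transforms of the truncations of f. *)
Definition is_fourier (R : realType) (f : R -> R) (g : R -> R[i]) : Prop :=
  [/\ f \in Lfun lebesgue_measure 2%:E,
      (fun xi => complex.Re (g xi)) \in Lfun lebesgue_measure 2%:E,
      (fun xi => complex.Im (g xi)) \in Lfun lebesgue_measure 2%:E &
      (fun n => 'N[@lebesgue_measure R]_2%:E
         [EFin \o (fun xi => ComplexField.Normc.normc
                     (fourier_trunc f n xi - g xi))%R])%E
        @ \oo --> 0%E].

(* A representative of the Fourier transform; it is unique up to a null set,
   so that sobolev_norm does not depend on the choice. *)
Definition fourier (R : realType) (f : R -> R) : R -> R[i] :=
  xget (fun=> 0) [set g | is_fourier f g].

Definition sobolev_norm (R : realType) (r : R) (f : R -> R) : \bar R :=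
  'N[@lebesgue_measure R]_2%:E
    [EFin \o (fun xi => (1 + xi ^+ 2) `^ (r / 2)
                * ComplexField.Normc.normc (fourier f xi))%R]%E.

(* Membership of f in H^r(R), for r >= 0 only: for negative r the space H^r
   contains distributions that are not functions. *)
Definition in_sobolev (R : realType) (r : R) (f : R -> R) : Prop :=
  is_fourier f (fourier f) /\ (sobolev_norm r f < +oo)%E.

(* In what follows u t x stands for u(x, t): a curve t |-> u(., t). *)

Definition sobolev_continuous (R : realType) (I : set R) (r : R)
    (u : R -> R -> R) : Prop :=
  (forall t, I t -> in_sobolev r (u t)) /\
  (forall t, I t ->
    (fun t' => sobolev_norm r (fun x => u t' x - u t x))
      @ within I (nbhs t) --> 0%E).

(* I is meant to be open, as the increments t + h are not restricted to I. *)
Definition sobolev_C1 (R : realType) (I : set R) (r : R)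
    (u : R -> R -> R) : Prop :=
  sobolev_continuous I r u /\
  exists2 v : R -> R -> R, sobolev_continuous I r v &
    forall t, I t ->
      (fun h => sobolev_norm r (fun x => h^-1 * (u (t + h) x - u t x) - v t x))
        @ 0^' --> 0%E.

Definition hilbert (R : realType) (f : R -> R) (x : R) : R :=
  pi^-1 * lim ((fun e : R =>
    \int[lebesgue_measure]_(y in [set y | e < `|y|]) (f (x - y) / y)) @ 0^'+).

(* u(., t) is required to be continuous in order to select, in its class in
   H^s, the representative for which the equation is meant pointwise. For
   s > 5/2 all the classical derivatives and the principal value below exist. *)
Definition BO_solution (R : realType) (T s : R) (u : R -> R -> R) : Prop :=
  [/\ forall t, t \in `[0, T] -> continuous (u t),
      sobolev_continuous `[0, T] s u,
      sobolev_C1 `]0, T[ (s - 2) u &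
      forall t x, t \in `]0, T[ ->
        derive1 (fun t' => u t' x) t - hilbert (derive1n 2 (u t)) x
          + u t x * derive1 (u t) x = 0].

Definition strip (R : realType) (T : R) : set (R * R) := setT `*` `[0, T].

(* Main.v *)
(* At a time t0 for which Omega contains a rectangle around (x0, t0), w = u1 - u2
   vanishes near x0 with its derivatives in x and t, hence so does H w'' by the
   equation.  Near x0 this is the regular integral of w''(y) / (x - y) over the
   support of w''; its expansion at x0 shows that all moments of w''(x0 + z) / z
   against powers of 1 / z vanish, so w'' = 0 since polynomials in the bounded
   variable 1 / z separate points, and then w(t0) = 0.  As H d_x^2 is skew-adjoint,
   it drops out of the time derivative of ||w||^2, which is bounded by K ||w||^2
   with K depending on sup |d_x u_j|; Gronwall's inequality in both directions of
   time gives w = 0 on [0, T].  The regularity s > 5/2 makes (1 + xi^2) u^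
   integrable, so that d_x^2 u is an absolutely convergent Fourier integral. *)

Require Import Defs.
From HB Require Import structures.
From mathcomp Require Import all_boot all_order all_algebra.
From mathcomp Require Import all_classical all_reals all_analysis.
From mathcomp Require Import measurable_realfun complex ring lra.
Set Implicit Arguments.
Unset Strict Implicit.
Unset Printing Implicit Defensive.
Import Order.TTheory GRing.Theory Num.Theory.
Import numFieldNormedType.Exports.
Local Open Scope classical_set_scope.
Local Open Scope ring_scope.

(** * Integration on the real line *)

(** The Fourier transform is given only as an $L^2$ limit of truncated integrals, so the bridge
    between a function and its transform is one pairing formula, [FT_pairing]: Fubini on a window,
    then a limit. Paired with the symbol of a Poisson kernel it gives the inversion formula; with a
    squared difference quotient, an $L^2$ bound on $f''$; with the equation, the energy estimate. In
    the last case $\partial_t w$ and the Hilbert term are at hand only as bounded functions, so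
    their products with $w$ are integrated over windows and never over the line. The hypothesis on
    $\partial_t u$ is a statement about $H^{s-2}$ norms, that is, about weighted transforms; hence
    the energy is defined and differentiated on the Fourier side. The inequality $s-2>1/2$ is used
    twice: for two derivatives in $x$, and to turn the $H^{s-2}$ derivative in time into a pointwise
    one. Time has two boundary effects. The equation holds on the open interval only, so the
    endpoints are reached by continuity in $H^s$; and $\Omega$ is open relative to the strip and may
    touch $t=0$ or $t=T$, so an interior time has to be selected. *)

Section integrable_functions.
Context {R : realType}.
Notation mu := (@lebesgue_measure R).
Implicit Types f g h : R -> R.

Definition L1 f : Prop := mu.-integrable setT (EFin \o f).
Definition intR f : R := \int[mu]_x f x.

Lemma ae_imply (P Q : R -> Prop) : (forall x, P x -> Q x) ->
  {ae mu, forall x, P x} -> {ae mu, forall x, Q x}.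
Proof. by move=> PQ; exact: (@filterS _ _ (ae_filter_ringOfSetsType mu)). Qed.

Lemma ae_and (P Q : R -> Prop) : {ae mu, forall x, P x} ->
  {ae mu, forall x, Q x} -> {ae mu, forall x, P x /\ Q x}.
Proof. exact: (@filterI _ _ (ae_filter_ringOfSetsType mu)). Qed.

Lemma L1_meas f : L1 f -> measurable_fun setT f.
Proof. by move=> /measurable_int /measurable_EFinP. Qed.

Lemma EFin_intR f : L1 f -> (\int[mu]_x (f x)%:E)%E = (intR f)%:E.
Proof. by move=> if_; rewrite fineK//; exact: integrable_fin_num. Qed.

Lemma L1_le f g : measurable_fun setT f -> L1 g ->
  (forall x, `|f x| <= g x) -> L1 f.
Proof.
move=> mf ig fg; apply: le_integrable ig => //.
  exact/measurable_EFinP.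
move=> x _ /=; rewrite lee_fin; apply: (le_trans (fg x)).
exact: ler_norm.
Qed.

Lemma L1D f g : L1 f -> L1 g -> L1 (fun x => f x + g x).
Proof. by move=> if_ ig; have := integrableD measurableT if_ ig. Qed.

Lemma L1B f g : L1 f -> L1 g -> L1 (fun x => f x - g x).
Proof. by move=> if_ ig; have := integrableB measurableT if_ ig. Qed.

Lemma L1Z f (k : R) : L1 f -> L1 (fun x => k * f x).
Proof. by move=> if_; have := integrableZl measurableT k if_. Qed.

Lemma L1N f : L1 f -> L1 (fun x => - f x).
Proof. by move=> /(L1Z (-1)); congr L1; apply/funext => x; rewrite mulN1r. Qed.

Lemma L1_abs f : L1 f -> L1 (fun x => `|f x|).
Proof. by move=> if_; have := integrable_norm if_. Qed.

Lemma L1_0 : L1 (fun=> 0).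
Proof. exact: integrable0. Qed.

Lemma L1_bounded f (k : R -> R) (M : R) : L1 f -> measurable_fun setT k ->
  (forall x, `|k x| <= M) -> L1 (fun x => f x * k x).
Proof.
move=> if_ mk kM; apply: (@L1_le _ (fun x => M * `|f x|)).
- exact: measurable_funM (L1_meas if_) mk.
- exact: L1Z (L1_abs if_).
- by move=> x; rewrite normrM mulrC ler_wpM2r.
Qed.

Lemma intRD f g : L1 f -> L1 g ->
  intR (fun x => f x + g x) = intR f + intR g.
Proof. by move=> if_ ig; exact: RintegralD. Qed.

Lemma intRB f g : L1 f -> L1 g ->
  intR (fun x => f x - g x) = intR f - intR g.
Proof. by move=> if_ ig; exact: RintegralB. Qed.

Lemma intRZ f (k : R) : L1 f -> intR (fun x => k * f x) = k * intR f.
Proof. by move=> if_; exact: RintegralZl. Qed.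

Lemma intRN f : L1 f -> intR (fun x => - f x) = - intR f.
Proof.
move=> if_; rewrite -mulN1r -intRZ//.
by congr intR; apply/funext => x; rewrite mulN1r.
Qed.

Lemma le_intR f g : L1 f -> L1 g -> (forall x, f x <= g x) ->
  intR f <= intR g.
Proof. by move=> if_ ig fg; apply: le_Rintegral. Qed.

Lemma intR_ge0 f : (forall x, 0 <= f x) -> 0 <= intR f.
Proof. by move=> f0; apply: Rintegral_ge0. Qed.

Lemma le_abs_intR f : L1 f -> `|intR f| <= intR (fun x => `|f x|).
Proof. by move=> if_; exact: le_normr_Rintegral. Qed.

Lemma abs_intR_le f g : measurable_fun setT f -> L1 g ->
  (forall x, `|f x| <= g x) -> `|intR f| <= intR g.
Proof.
move=> mf ig fg; have if_ := L1_le mf ig fg.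
apply: (le_trans (le_abs_intR if_)); apply: le_intR => //.
exact: L1_abs.
Qed.

Lemma eq_intR f g : (forall x, f x = g x) -> intR f = intR g.
Proof. by move=> fg; congr intR; apply/funext. Qed.

Lemma intR_ae f g : measurable_fun setT f -> measurable_fun setT g ->
  {ae mu, forall x, f x = g x} -> intR f = intR g.
Proof.
move=> mf mg fg; rewrite /intR /Rintegral; congr fine.
apply: ae_eq_integral => //; [exact/measurable_EFinP|exact/measurable_EFinP|].
by apply: ae_imply fg => x /= -> _.
Qed.

Lemma intR0 : intR (fun=> 0) = 0.
Proof. by rewrite /intR /Rintegral integral0. Qed.

Lemma intR_eq0 f : L1 f -> (forall x, 0 <= f x) -> intR f = 0 ->
  {ae mu, forall x, f x = 0}.
Proof.
move=> if_ f0 h.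
have fn := integrable_fin_num measurableT if_.
have e : (\int[mu]_(x in setT) `|(EFin \o f) x|)%E = 0%E.
  under eq_integral do rewrite gee0_abs ?lee_fin//.
  by rewrite -[LHS]fineK//; congr EFin.
move/(ae_eq_integral_abs mu measurableT): e => /(_ (measurable_int _ if_)).
by apply: ae_imply => x /(_ I) [].
Qed.

Lemma dct (f_ : nat -> R -> R) f g :
  (forall n, measurable_fun setT (f_ n)) -> L1 g ->
  (forall x, f_ ^~ x @ \oo --> f x) -> (forall n x, `|f_ n x| <= g x) ->
  L1 f /\ (fun n => intR (f_ n)) @ \oo --> intR f.
Proof.
move=> mf ig ff fg.
have mF : measurable_fun setT f.
  by apply: (@measurable_fun_cvg _ _ _ _ f_) => // x _; exact: ff.
have [] := @dominated_convergence _ _ _ mu setT measurableT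
  (fun n => EFin \o f_ n) (EFin \o f) (EFin \o g).
- by move=> n; apply/measurable_EFinP; exact: mf.
- by apply/measurable_EFinP; exact: mF.
- by apply: aeW => x _; apply/cvg_EFin; [exact: nearW|exact: ff].
- exact: ig.
- by apply: aeW => x n _; rewrite /= lee_fin.
- move=> if_ _ c; split => //.
  apply/fine_cvg; rewrite fineK//; exact: integrable_fin_num.
Qed.


Lemma intR_indic (D : set R) f :
  \int[mu]_(x in D) f x = intR (fun x => f x * \1_D x).
Proof. by rewrite Rintegral_mkcond patch_indic. Qed.

Lemma indic_le1 (D : set R) x : `|\1_D x : R| <= 1.
Proof. by rewrite indicE; case: (_ \in _); rewrite ?normr1 ?normr0. Qed.

(** These are the truncation sets of [fourier_trunc], so that exhausting the line and defining the
    Fourier transform use the same sequence. *)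
Definition window (n : nat) : set R := `[- n%:R, n%:R].

Lemma measurable_window n : measurable (window n).
Proof. exact: measurable_itv. Qed.

Lemma measurable_indicR (D : set R) : measurable D ->
  measurable_fun setT (\1_D : R -> R).
Proof. by move=> mD; exact: measurable_indic. Qed.

Lemma L1_indic f (D : set R) : measurable D -> L1 f ->
  L1 (fun x => f x * \1_D x).
Proof.
move=> mD if_; apply: (L1_bounded (M := 1)) => //; last exact: indic_le1.
Qed.

Lemma window_cvg (x : R) : (fun n => \1_(window n) x : R) @ \oo --> (1 : R).
Proof.
apply: cvg_near_cst; exists (Num.truncn `|x|).+1 => // n /= xn.
rewrite indicE mem_set// /window /= in_itv /= -ler_norml.
apply: ltW; apply: (lt_le_trans (truncnS_gt _)).
by rewrite ler_nat.
Qed.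

Lemma intR_window f : L1 f ->
  (fun n => \int[mu]_(x in window n) f x) @ \oo --> intR f.
Proof.
move=> if_.
under eq_fun do rewrite intR_indic.
apply: (@dct _ _ (fun x => `|f x|) _ _ _ _).2.
- by move=> n; exact: L1_meas (L1_indic (measurable_window n) if_).
- exact: L1_abs.
- move=> x; rewrite -[X in _ --> X]mulr1.
  by apply: cvgM; [exact: cvg_cst|exact: window_cvg].
- by move=> n x; rewrite normrM ler_piMr// indic_le1.
Qed.

(** Monotone convergence along the windows. It yields integrability wherever window integrals are
    under control: from an antiderivative, or as limits of bounded quantities. *)
Lemma L1_exhaust f (C : R) : measurable_fun setT f -> (forall x, 0 <= f x) ->
  (forall n, (\int[mu]_(x in window n) (f x)%:E <= C%:E)%E) -> L1 f.
Proof.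
move=> mf f0 fC; apply/integrableP; split; first exact/measurable_EFinP.
under eq_integral do rewrite /= ger0_norm//.
have -> : setT = \bigcup_n window n.
  apply/seteqP; split=> // x _.
  exists (Num.truncn `|x|).+1 => //; rewrite /window /= in_itv /= -ler_norml.
  exact/ltW/truncnS_gt.
have h := @ge0_nondecreasing_set_cvg_integral _ (measurableTypeR R) R window (EFin \o f) mu.
apply: (@le_lt_trans _ _ C%:E); last exact: ltry.
apply: (cvge_le _ (h _ _ _ _)).
- by apply: nearW => n; exact: fC.
- move=> m n mn; apply/subsetPset => x; rewrite /window /= !in_itv /= -!ler_norml.
  by move=> /le_trans; apply; rewrite ler_nat.
- by move=> n; exact: measurable_window.
- by move=> n; apply: measurable_funTS; exact/measurable_EFinP.
- by move=> n x _; rewrite /= lee_fin.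
Qed.

(** Tonelli: the inner integral is at most [|f x|] times [M] times the $L^1$ norm of [q]. The
    kernels in view are cosines and sines of products, which are bounded, so the two factors carry
    all the integrability. *)
Lemma L1_prod f q (k : R * R -> R) (M : R) : L1 f -> L1 q ->
  measurable_fun setT k -> (forall z, `|k z| <= M) ->
  (mu \x mu)%E.-integrable setT (fun z => (f z.1 * q z.2 * k z)%:E).
Proof.
move=> if_ iq mk kM.
have mf := L1_meas if_; have mq := L1_meas iq.
have mF : measurable_fun setT (fun z : R * R => f z.1 * q z.2).
  by apply: measurable_funM; apply: measurableT_comp => //.
apply/integrable12ltyP.
  by apply/measurable_EFinP; apply: measurable_funM.
have M0 : 0 <= M by apply: (le_trans _ (kM (0, 0))).
have -> : (+oo = +oo :> \bar R)%E by [].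
apply: (@le_lt_trans _ _ (\int[mu]_x ((`|f x| * (M * intR (fun y => `|q y|)))%:E))%E); last first.
  have := L1Z (M * intR (fun y => `|q y|)) (L1_abs if_).
  move=> /integrableP[_]; apply: le_lt_trans.
  apply: ge0_le_integral => //=.
  - by move=> x _; rewrite lee_fin !mulr_ge0// intR_ge0.
  - apply/measurable_EFinP; apply: measurable_funM => //.
    exact: measurableT_comp.
  - apply/measurable_EFinP; apply: measurableT_comp => //.
    apply: measurable_funM => //; exact: measurableT_comp.
  - by move=> x _; rewrite lee_fin mulrC ler_norm.
apply: ge0_le_integral => //=.
- by move=> x _; apply: integral_ge0.
- apply: (@measurable_fun_fubini_tonelli_F _ _ _ _ _ mu
    (fun z : R * R => `|f z.1 * q z.2 * k z|%:E)) => //=.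
  by apply/measurable_EFinP; apply: measurableT_comp => //; apply: measurable_funM.
- apply/measurable_EFinP; apply: measurable_funM => //; exact: measurableT_comp.
move=> x _.
have ib : L1 (fun y => `|f x| * M * `|q y|) by apply: L1Z; apply: L1_abs.
apply: (@le_trans _ _ (\int[mu]_y (`|f x| * M * `|q y|)%:E)%E).
  apply: ge0_le_integral => //=.
  - apply/measurable_EFinP; apply: measurableT_comp => //.
    apply: measurable_funM => //.
      by apply: measurable_funM => //.
    by apply: measurableT_comp => //.
  - by apply/measurable_EFinP; exact: L1_meas.
  - move=> y _; rewrite lee_fin !normrM mulrAC ler_wpM2r// ler_wpM2l//.
by rewrite (EFin_intR ib) lee_fin (intRZ _ (L1_abs iq)) mulrA.
Qed.

Lemma fubini_bounded f q (k : R * R -> R) (M : R) : L1 f -> L1 q ->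
  measurable_fun setT k -> (forall z, `|k z| <= M) ->
  intR (fun x => f x * intR (fun y => q y * k (x, y))) =
  intR (fun y => q y * intR (fun x => f x * k (x, y))).
Proof.
move=> if_ iq mk kM.
have ih := L1_prod if_ iq mk kM.
have mkx x : measurable_fun setT (fun y => k (x, y)) by apply: measurableT_comp.
have mky y : measurable_fun setT (fun x => k (x, y)) by apply: measurableT_comp.
rewrite /intR /Rintegral; congr fine.
transitivity (\int[mu]_x \int[mu]_y (f x * q y * k (x, y))%:E)%E.
  apply: eq_integral => x _.
  have iqk : L1 (fun y => q y * k (x, y)) by apply: (L1_bounded (M := M)).
  rewrite -[X in X%:E]/(f x * intR _) -intRZ// -EFin_intR; last exact: L1Z.
  by apply: eq_integral => y _; rewrite mulrA.
rewrite (Fubini ih); apply: eq_integral => y _.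
have ifk : L1 (fun x => f x * k (x, y)) by apply: (L1_bounded (M := M)).
rewrite -[X in _ = X%:E]/(q y * intR _) -intRZ// -EFin_intR; last exact: L1Z.
by apply: eq_integral => x _; rewrite mulrCA mulrA.
Qed.


Lemma continuous_intR (F : R -> R -> R) g :
  (forall y, measurable_fun setT (F y)) -> L1 g ->
  (forall y x, `|F y x| <= g x) -> (forall x, continuous (F ^~ x)) ->
  continuous (fun y => intR (F y)).
Proof.
move=> mF ig Fg cF y.
apply: (@continuity_under_integral R _ _ mu F setT measurableT (y - 1) (y + 1)
  _ _ g ig _ y).
- by move=> z _; exact: L1_le (mF z) ig (Fg z).
- by apply: aeW => x _ z _; exact: cF.
- by move=> z _; apply: aeW => x _; exact: Fg.
- by rewrite inE /= in_itv /=; lra.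
Qed.

Lemma is_derive_intR (F dF : R -> R -> R) g :
  (forall y, L1 (F y)) -> L1 g -> (forall y x, `|dF y x| <= g x) ->
  (forall x y : R, is_derive y 1 (F ^~ x) (dF y x)) ->
  forall y : R, is_derive y 1 (fun y => intR (F y)) (intR (dF y)).
Proof.
move=> iF ig dFg der y.
have g0 x : 0 <= g x by apply: le_trans (dFg 0 x).
have yy : `]y - 1, y + 1[%classic y by rewrite /= in_itv /=; lra.
have d1 x z : partial1of2 F z x = dF z x.
  by rewrite partial1of2E; exact: (@derive_val _ _ _ _ _ _ _ (der x z)).
have e x : 'D_1 (F ^~ x) y = dF y x by rewrite -d1 partial1of2E.
have dd := @derivable_under_integral R _ _ mu F setT measurableT y (y - 1)
  (y + 1) yy (fun z _ => iF z) _ g g0 ig _.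
have de := @differentiation_under_integral R _ _ mu F setT measurableT y (y - 1)
  (y + 1) yy (fun z _ => iF z) _ g g0 ig _.
apply: DeriveDef.
  by apply: dd => z x *; [exact: ex_derive|rewrite d1; exact: dFg].
rewrite -derive1E de.
- by apply: eq_intR => x; exact: d1.
- by move=> z x *; exact: ex_derive.
- by move=> z x *; rewrite d1; exact: dFg.
Qed.

End integrable_functions.

Lemma cvg_ext {R : realType} (I : Type) (F : set_system I) (u v : I -> R) (l : R) :
  (forall i, u i = v i) -> u @ F --> l -> v @ F --> l.
Proof. by move=> uv; rewrite (funext uv). Qed.

Lemma cvg0_le {R : realType} (I : Type) (F : set_system I) {FF : Filter F} (u v : I -> R) :
  (\forall i \near F, 0 <= u i <= v i) -> v @ F --> (0 : R) -> u @ F --> (0 : R).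
Proof. by move=> uv vl; apply: (squeeze_cvgr uv _ vl); exact: cvg_cst. Qed.

Lemma eq_lerW {R : numDomainType} (x y : R) : x = y -> x <= y.
Proof. by move->. Qed.

(** * Derivatives and mean value inequalities in one variable *)

Section derivative_rules.
Context {R : realType}.
Implicit Types (f g : R -> R) (x : R).

Lemma derM f g x df dg : is_derive x 1 f df -> is_derive x 1 g dg ->
  is_derive x 1 (fun y => f y * g y) (df * g x + f x * dg).
Proof.
by move=> hf hg; apply: is_derive_eq; rewrite /GRing.scale /= addrC (mulrC df).
Qed.

Lemma derD f g x df dg : is_derive x 1 f df -> is_derive x 1 g dg ->
  is_derive x 1 (fun y => f y + g y) (df + dg).
Proof. by move=> hf hg; apply: is_deriveD. Qed.

Lemma derB f g x df dg : is_derive x 1 f df -> is_derive x 1 g dg ->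
  is_derive x 1 (fun y => f y - g y) (df - dg).
Proof. by move=> hf hg; apply: is_deriveB. Qed.

Lemma derZ f (k x df : R) : is_derive x 1 f df ->
  is_derive x 1 (fun y => k * f y) (k * df).
Proof. by move=> hf; apply: is_deriveZ. Qed.

Lemma derC (k x : R) : is_derive x 1 (fun _ : R => k) 0.
Proof. exact: is_derive_cst. Qed.

Lemma derI x : is_derive x 1 (fun y : R => y) 1.
Proof. exact: is_derive_id. Qed.

Lemma der_comp f g x df dg : is_derive (g x) 1 f df -> is_derive x 1 g dg ->
  is_derive x 1 (fun y => f (g y)) (df * dg).
Proof. by move=> hf hg; apply: is_derive1_comp. Qed.

Lemma der_eq f x df df' : is_derive x 1 f df -> df = df' -> is_derive x 1 f df'.
Proof. by move=> h <-. Qed.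

Lemma der_continuous f x df : is_derive x 1 f df -> {for x, continuous f}.
Proof.
by move=> h; apply/differentiable_continuous/derivable1_diffP/ex_derive.
Qed.

Lemma der_derive1 f x df : is_derive x 1 f df -> derive1 f x = df.
Proof. by move=> h; rewrite derive1E; exact: derive_val. Qed.

Lemma derMl (c x : R) : is_derive x 1 (fun y => c * y) c.
Proof. by apply: der_eq (derZ c (derI x)) _; rewrite mulr1. Qed.

Lemma der_cosM (c x : R) : is_derive x 1 (fun y => cos (c * y)) (- sin (c * x) * c).
Proof. exact: der_comp (is_derive_cos _) (derMl c x). Qed.

Lemma der_sinM (c x : R) : is_derive x 1 (fun y => sin (c * y)) (cos (c * x) * c).
Proof. exact: der_comp (is_derive_sin _) (derMl c x). Qed.

Lemma der_expM (c x : R) : is_derive x 1 (fun y => expR (c * y)) (expR (c * x) * c).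
Proof. exact: der_comp (is_derive_expR _) (derMl c x). Qed.

Lemma mvt_le f df (a b : R) : a <= b ->
  (forall x, a <= x <= b -> is_derive x 1 f (df x)) ->
  (forall x, a <= x <= b -> 0 <= df x) -> f a <= f b.
Proof.
move=> ab hf h0.
apply: (@ger0_derive1_ndecr _ f a b) => //.
- move=> x; rewrite in_itv /= => /andP[/ltW ax /ltW xb].
  by apply: (@ex_derive _ _ _ _ _ _ (df x)); apply: hf; rewrite ax.
- move=> x; rewrite in_itv /= => /andP[/ltW ax /ltW xb].
  by rewrite (der_derive1 (hf _ _)) ?h0// ax.
- apply: derivable_within_continuous => x; rewrite in_itv /= => h.
  by apply: (@ex_derive _ _ _ _ _ _ (df x)); apply: hf.
Qed.

(** Both [f x + M * x] and [M * x - f x] are nondecreasing, which gives the two halves of the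
    bound. *)
Lemma mvt_abs f df (M : R) :
  (forall x, is_derive x 1 f (df x)) -> (forall x, `|df x| <= M) ->
  forall x y, `|f x - f y| <= M * `|x - y|.
Proof.
move=> hf hM.
have key a b : a <= b -> `|f b - f a| <= M * (b - a).
  move=> ab; rewrite ler_norml; apply/andP; split.
  - have := @mvt_le (fun x => f x + M * x) (fun x => df x + M) a b ab.
    move=> /(_ (fun x _ => derD (hf x) (derMl M x))) h.
    suff : f a + M * a <= f b + M * b by lra.
    by apply: h => x _; have := hM x; rewrite ler_norml => /andP[]; lra.
  - have := @mvt_le (fun x => M * x - f x) (fun x => M - df x) a b ab.
    move=> /(_ (fun x _ => derB (derMl M x) (hf x))) h.
    suff : M * a - f a <= M * b - f b by lra.
    by apply: h => x _; have := hM x; rewrite ler_norml => /andP[]; lra.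
move=> x y; case: (leP x y) => [xy|/ltW yx].
  by rewrite distrC (distrC x) (ger0_norm (x := y - x)) ?subr_ge0// key.
by rewrite (ger0_norm (x := x - y)) ?subr_ge0// key.
Qed.

End derivative_rules.

(** * Square integrable functions and the Cauchy-Schwarz inequality *)

Section square_integrable.
Context {R : realType}.
Notation mu := (@lebesgue_measure R).
Implicit Types f g h : R -> R.

Definition L2 f : Prop := measurable_fun setT f /\ L1 (fun x => f x ^+ 2).

Lemma L2_0 : L2 (fun=> 0).
Proof. by split => //; under eq_fun do rewrite expr0n /=; exact: L1_0. Qed.

Lemma L2_mul f g : L2 f -> L2 g -> L1 (fun x => f x * g x).
Proof.
move=> [mf f2] [mg g2]; apply: L1_le (L1D f2 g2) _ => [|x].
  exact: measurable_funM.
have := sqr_ge0 (`|f x| - `|g x|); rewrite -(real_normK (num_real (f x))).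
rewrite -(real_normK (num_real (g x))) normrM.
have := normr_ge0 (f x); have := normr_ge0 (g x); nra.
Qed.

Lemma L2D f g : L2 f -> L2 g -> L2 (fun x => f x + g x).
Proof.
move=> hf hg; split; first by apply: measurable_funD; [case: hf|case: hg].
have := L1D (L1D hf.2 hg.2) (L1Z 2 (L2_mul hf hg)).
by congr L1; apply/funext => x; ring.
Qed.

Lemma L2Z f (k : R) : L2 f -> L2 (fun x => k * f x).
Proof.
move=> hf; split; first by apply: measurable_funM => //; case: hf.
by have := L1Z (k ^+ 2) hf.2; congr L1; apply/funext => x; ring.
Qed.

Lemma L2B f g : L2 f -> L2 g -> L2 (fun x => f x - g x).
Proof.
move=> hf hg; have := L2D hf (L2Z (-1) hg).
by congr L2; apply/funext => x; rewrite mulN1r.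
Qed.

Lemma L2_bounded f (k : R -> R) (M : R) : L2 f -> measurable_fun setT k ->
  (forall x, `|k x| <= M) -> L2 (fun x => f x * k x).
Proof.
move=> hf mk kM; split; first by apply: measurable_funM => //; case: hf.
have := @L1_bounded _ (fun x => f x ^+ 2) (fun x => k x ^+ 2) (M ^+ 2) hf.2.
rewrite (_ : (fun x => f x ^+ 2 * k x ^+ 2) = fun x => (f x * k x) ^+ 2).
  apply; first exact: measurable_funX.
  move=> x; rewrite normrX; apply: lerXn2r; rewrite ?nnegrE//.
  by apply: le_trans (kM x).
by apply/funext => x; rewrite exprMn.
Qed.

Lemma L2_abs f : L2 f -> L2 (fun x => `|f x|).
Proof.
move=> [mf f2]; split; first exact: measurableT_comp.
by move: f2; congr L1; apply/funext => x; rewrite real_normK// num_real.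
Qed.

Lemma L2_window f (n : nat) : L2 f -> L1 (fun x => f x * \1_(window n) x).
Proof.
move=> hf; apply: L2_mul => //; split.
  exact: (measurable_indicR (measurable_window n)).
rewrite (_ : (fun x => _) = \1_(window n)).
  exact: integrable_indic_itv.
by apply/funext => x; rewrite indicE; case: (_ \in _); rewrite ?expr1n ?expr0n.
Qed.

Lemma cauchy_schwarz f g : L2 f -> L2 g ->
  intR (fun x => f x * g x) ^+ 2 <=
  intR (fun x => f x ^+ 2) * intR (fun x => g x ^+ 2).
Proof.
move=> hf hg.
set a := intR (fun x => f x ^+ 2); set b := intR (fun x => g x ^+ 2).
set c := intR _.
have a0 : 0 <= a by apply: intR_ge0 => x; exact: sqr_ge0.
have b0 : 0 <= b by apply: intR_ge0 => x; exact: sqr_ge0.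
have q (l m : R) : 0 <= l ^+ 2 * a + 2 * l * m * c + m ^+ 2 * b.
  rewrite -!intRZ; [|exact: hg.2|exact: L2_mul|exact: hf.2].
  have iff := L1Z (l ^+ 2) hf.2; have igg := L1Z (m ^+ 2) hg.2.
  have ifg := L1Z (2 * l * m) (L2_mul hf hg).
  rewrite -(intRD iff ifg) -(intRD (L1D iff ifg) igg).
  apply: intR_ge0 => x; rewrite (_ : _ + _ = (l * f x + m * g x) ^+ 2); first exact: sqr_ge0.
  by ring.
(* The quadratic form [q] equals $a(ab-c^2)$ at $(-c,a)$ and $b(ab-c^2)$ at $(b,-c)$. If $a=b=0$,
   its value at $(-c,1)$ is $-2c^2$, which forces $c=0$. *)
have [a_gt0|a_le0] := ltP 0 a.
  have := q (- c) a; rewrite (_ : _ + _ = a * (a * b - c ^+ 2)); last by ring.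
  by rewrite pmulr_rge0// subr_ge0.
have a00 : a = 0 by apply/eqP; rewrite eq_le a_le0.
have [b_gt0|b_le0] := ltP 0 b.
  have := q b (- c); rewrite (_ : _ + _ = b * (a * b - c ^+ 2)); last by ring.
  by rewrite pmulr_rge0// subr_ge0.
have b00 : b = 0 by apply/eqP; rewrite eq_le b_le0.
have := q (- c) 1; rewrite a00 b00; nra.
Qed.

Lemma Lfun_L2 f : f \in Lfun mu 2%:E -> L2 f.
Proof.
move=> hf; split; last exact: Lfun2_integrable_sqr.
by move: hf; rewrite inE => /andP[/[!inE]].
Qed.

Lemma intR_sqr_ge0 f : 0 <= intR (fun x => f x ^+ 2).
Proof. by apply: intR_ge0 => x; exact: sqr_ge0. Qed.

(** Cauchy-Schwarz. The filter is arbitrary because the lemma serves both sequences of truncations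
    and time increments tending to 0. The [b + 1] in the proof keeps the threshold positive and
    finite when [g] is null. *)
Lemma L2_ip_cvg0 (I : Type) (F : set_system I) {FF : Filter F}
  (f_ : I -> R -> R) g : L2 g -> (\forall i \near F, L2 (f_ i)) ->
  (fun i => intR (fun x => f_ i x ^+ 2)) @ F --> (0 : R) ->
  (fun i => intR (fun x => f_ i x * g x)) @ F --> (0 : R).
Proof.
move=> hg hf f0; apply/cvgr0Pnorm_lt => e e0.
set b := intR (fun x => g x ^+ 2).
have b0 : 0 <= b by exact: intR_sqr_ge0.
have d0 : 0 < e ^+ 2 / (b + 1) by rewrite divr_gt0 ?exprn_gt0//; lra.
move/cvgr0Pnorm_lt : f0 => /(_ _ d0) f0.
near=> i.
have hi : L2 (f_ i) by near: i.
have : `|intR (fun x => f_ i x ^+ 2)| < e ^+ 2 / (b + 1) by near: i.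
rewrite ger0_norm ?intR_sqr_ge0// ltr_pdivlMr; last lra.
have := cauchy_schwarz hi hg; rewrite -/b => cs ac.
rewrite -ltr_sqr ?nnegrE//; last exact: ltW.
rewrite real_normK ?num_real//.
by have := intR_sqr_ge0 (f_ i); nra.
Unshelve. all: by end_near. Qed.

End square_integrable.

(** * Fourier transform on L2 *)

Section poisson_kernel.
Context {R : realType}.
Notation mu := (@lebesgue_measure R).
Implicit Types f F : R -> R.

Lemma ftc F f (a b : R) : a <= b ->
  (forall x, a <= x <= b -> is_derive x 1 F (f x)) ->
  (forall x, a <= x <= b -> {for x, continuous f}) ->
  (\int[mu]_(x in `[a, b]) (f x)%:E = (F b - F a)%:E)%E.
Proof.
rewrite le_eqVlt => /predU1P[-> _ _|ab dF cf].
  by rewrite set_itv1 integral_set1 subrr.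
rewrite EFinB; apply: continuous_FTC2 => //.
- apply: continuous_in_subspaceT => x /[!inE] /=; rewrite in_itv /=.
  exact: cf.
- split.
  + move=> x; rewrite in_itv /= => /andP[/ltW ax /ltW xb].
    by apply: (@ex_derive _ _ _ _ _ _ (f x)); apply: dF; rewrite ax.
  + apply: cvg_at_right_filter; apply: (@der_continuous _ _ _ (f a)); apply: dF.
    by rewrite lexx ltW.
  + apply: cvg_at_left_filter; apply: (@der_continuous _ _ _ (f b)); apply: dF.
    by rewrite lexx ltW.
- move=> x; rewrite in_itv /= => /andP[/ltW ax /ltW xb].
  by apply: der_derive1; apply: dF; rewrite ax.
Qed.

Lemma Rftc F f (a b : R) : a <= b ->
  (forall x, a <= x <= b -> is_derive x 1 F (f x)) ->
  (forall x, a <= x <= b -> {for x, continuous f}) ->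
  \int[mu]_(x in `[a, b]) f x = F b - F a.
Proof. by move=> ab dF cf; rewrite /Rintegral (ftc ab dF cf). Qed.

(* An integral over a window, computed from antiderivatives on either side of 0:
   the integrand may have a kink there. *)
Lemma ftc_window (F G f g h : R -> R) (n : nat) :
  measurable_fun setT h ->
  (forall x : R, 0 <= x -> h x = f x) -> (forall x : R, x <= 0 -> h x = g x) ->
  (forall x : R, 0 <= x -> is_derive x 1 F (f x)) ->
  (forall x : R, 0 <= x -> {for x, continuous f}) ->
  (forall x : R, x <= 0 -> is_derive x 1 G (g x)) ->
  (forall x : R, x <= 0 -> {for x, continuous g}) ->
  (\int[mu]_(x in window n) (h x)%:E =
     (F n%:R - F 0 + (G 0 - G (- n%:R)))%:E)%E.
Proof.
move=> mh hf hg dF cf dG cg.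
have n0 : 0 <= n%:R :> R by exact: ler0n.
have eF : (\int[mu]_(x in `[0%R, n%:R%R]) (h x)%:E = (F n%:R - F 0)%:E)%E.
  rewrite -(ftc n0 (fun x xn => dF x (proj1 (andP xn)))
    (fun x xn => cf x (proj1 (andP xn)))).
  apply: eq_integral => x /[!inE] /=; rewrite in_itv /= => /andP[x0 _].
  by rewrite hf.
have eG : (\int[mu]_(x in `[(- n%:R)%R, 0%R]) (h x)%:E = (G 0 - G (- n%:R))%:E)%E.
  have n0' : - n%:R <= 0 :> R by rewrite oppr_le0.
  rewrite -(ftc n0' (fun x xn => dG x (proj2 (andP xn)))
    (fun x xn => cg x (proj2 (andP xn)))).
  apply: eq_integral => x /[!inE] /=; rewrite in_itv /= => /andP[_ x0].
  by rewrite hg.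
have -> : window n = (`[- n%:R, 0[ `|` `[0, n%:R] : set R).
  apply/seteqP; split => x; rewrite /window /= !in_itv /=.
    by case: (ltP x 0) => x0 /andP[-> ->]; [left|right].
  by case=> /andP[a b]; apply/andP; split=> //; lra.
rewrite integral_setU//=.
- rewrite eF.
  rewrite (_ : (\int[mu]_(x in `[(- n%:R)%R, 0%R[) _)%E = (G 0 - G (- n%:R))%:E).
    by rewrite -EFinD addrC.
  rewrite -eG integral_itv_bndo_bndc//.
  by apply/measurable_EFinP; apply: measurable_funTS.
- by apply/measurable_EFinP; apply: measurable_funTS.
- apply/disj_set2P; rewrite -subset0 => x [] /=; rewrite !in_itv /= => /andP[_ a] /andP[b _].
  by lra.
Qed.

Lemma intR_lim f (l : R) (v : nat -> R) : L1 f ->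
  (forall n, (\int[mu]_(x in window n) (f x)%:E = (v n)%:E)%E) ->
  v @ \oo --> l -> intR f = l.
Proof.
move=> if_ fv vl; apply: (cvg_unique _ (intR_window if_)) => //.
by rewrite (_ : (fun n => _) = v)//; apply/funext => n; rewrite /Rintegral fv.
Qed.

Implicit Types e a x y z : R.

(** An Abel summation factor: integrable and bounded, hence a legitimate symbol in the pairing; it
    tends to 1 with [e] tending to 0, and its cosine transform is the Poisson kernel. *)
Definition poisson_weight e x : R := expR (- e * `|x|).

Lemma poisson_weight_cont e : continuous (poisson_weight e).
Proof.
move=> x; apply: (@continuous_comp _ _ _ (fun x => - e * `|x|) expR).
  apply: cvgM; [exact: cvg_cst|exact: norm_continuous].
exact: continuous_expR.
Qed.

Lemma poisson_weight_meas e : measurable_fun setT (poisson_weight e).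
Proof. by apply: continuous_measurable_fun; exact: poisson_weight_cont. Qed.

Lemma poisson_weight_ge0 e x : 0 <= poisson_weight e x.
Proof. exact: expR_ge0. Qed.

Lemma poisson_weight_le1 e x : 0 <= e -> poisson_weight e x <= 1.
Proof.
by move=> e0; rewrite /poisson_weight -[leRHS]expR0 ler_expR mulNr oppr_le0 mulr_ge0.
Qed.

Lemma L1_poisson_weight e : 0 < e -> L1 (poisson_weight e).
Proof.
move=> e0; apply: (@L1_exhaust _ _ (2 / e)).
- exact: poisson_weight_meas.
- exact: poisson_weight_ge0.
move=> n.
have -> : (\int[mu]_(x in window n) (poisson_weight e x)%:E =
    (- e^-1 * expR (- e * n%:R) - - e^-1 * expR (- e * 0) +
     (e^-1 * expR (e * 0) - e^-1 * expR (e * (- n%:R))))%:E)%E.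
  apply: (@ftc_window (fun x => - e^-1 * expR (- e * x))
    (fun x => e^-1 * expR (e * x))
    (fun x => expR (- e * x)) (fun x => expR (e * x))).
  - exact: poisson_weight_meas.
  - by move=> x x0; rewrite /poisson_weight ger0_norm.
  - by move=> x x0; rewrite /poisson_weight ler0_norm// mulrNN.
  - move=> x _; apply: der_eq (derZ _ (der_expM _ _)) _.
    by field; rewrite gt_eqF.
  - by move=> x _; exact: der_continuous (der_expM _ _).
  - move=> x _; apply: der_eq (derZ _ (der_expM _ _)) _.
    by field; rewrite gt_eqF.
  - by move=> x _; exact: der_continuous (der_expM _ _).
rewrite lee_fin !mulr0 expR0 !mulr1 mulrN mulNr.
have : 0 <= e^-1 * expR (- (e * n%:R)).
  by rewrite mulr_ge0 ?expR_ge0// invr_ge0 ltW.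
by rewrite mulNr opprK (_ : 2 / e = e^-1 + e^-1); [lra|rewrite mulr_natl mulr2n].
Qed.

Lemma expR_geom_cvg0 e : 0 < e -> (fun n : nat => expR (- e * n%:R)) @ \oo --> (0 : R).
Proof.
move=> e0.
rewrite (_ : (fun n : nat => _) = fun n => expR (- e) ^+ n).
  apply: cvg_expr; rewrite ger0_norm ?expR_ge0// expR_lt1; lra.
by apply/funext => n; rewrite -expRM_natr.
Qed.

Lemma intR_poisson_weight_cos e a : 0 < e ->
  intR (fun x => poisson_weight e x * cos (a * x)) = 2 * e / (e ^+ 2 + a ^+ 2).
Proof.
move=> e0; have D0 : 0 < e ^+ 2 + a ^+ 2 by nra.
set D := e ^+ 2 + a ^+ 2 in D0 *.
have Dn0 : D != 0 by rewrite gt_eqF.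
(* Antiderivatives of $e^{-ex}\cos ax$ and $e^{ex}\cos ax$, found by integrating by parts twice.
   Their values at the ends of the window carry the factor $e^{-en}$; the values at 0 add up to
   $2e/D$. *)
pose F x := D^-1 * (expR (- e * x) * (a * sin (a * x) - e * cos (a * x))).
pose G x := D^-1 * (expR (e * x) * (a * sin (a * x) + e * cos (a * x))).
have ccos (c x : R) : {for x, continuous (fun x => cos (c * x))}.
  exact: der_continuous (der_cosM c x).
have cexp (c x : R) : {for x, continuous (fun x => expR (c * x))}.
  exact: der_continuous (der_expM c x).
apply: (@intR_lim _ _ (fun n => F n%:R - F 0 + (G 0 - G (- n%:R)))).
- apply: (L1_bounded (M := 1)); first exact: L1_poisson_weight.
    by apply: continuous_measurable_fun => x; exact: ccos.
  by move=> x; exact: cos_max.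
- move=> n; apply: (@ftc_window F G (fun x => expR (- e * x) * cos (a * x))
    (fun x => expR (e * x) * cos (a * x))).
  + apply: measurable_funM; first exact: poisson_weight_meas.
    by apply: continuous_measurable_fun => x; exact: ccos.
  + by move=> x x0; rewrite /poisson_weight ger0_norm.
  + by move=> x x0; rewrite /poisson_weight ler0_norm// mulrNN.
  + move=> x _; apply: der_eq (derZ _ (derM (der_expM _ _)
      (derB (derZ _ (der_sinM _ _)) (derZ _ (der_cosM _ _))))) _.
    by rewrite /D; field.
  + by move=> x _; apply: cvgM; [exact: cexp|exact: ccos].
  + move=> x _; apply: der_eq (derZ _ (derM (der_expM _ _)
      (derD (derZ _ (der_sinM _ _)) (derZ _ (der_cosM _ _))))) _.
    by rewrite /D; field.
  + by move=> x _; apply: cvgM; [exact: cexp|exact: ccos].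
rewrite (_ : (fun n => _) = fun n : nat => expR (- e * n%:R) *
    (2 * D^-1 * (a * sin (a * n%:R) - e * cos (a * n%:R))) + 2 * e / D); last first.
  apply/funext => n; rewrite /F /G !mulr0 sin0 cos0 expR0 !mulrN !mulNr sinN cosN.
  by field.
rewrite -[X in _ --> X]add0r; apply: cvgD; last exact: cvg_cst.
apply: (@squeeze_cvgr _ _ _ _
  (fun n : nat => - (2 * D^-1 * (`|a| + e)) * expR (- e * n%:R))
  (fun n : nat => (2 * D^-1 * (`|a| + e)) * expR (- e * n%:R))).
- apply: nearW => n; rewrite mulNr -ler_norml mulrC normrM.
  rewrite (ger0_norm (expR_ge0 _)) ler_wpM2r ?expR_ge0//.
  rewrite normrM ger0_norm ?ler_wpM2l//; try by rewrite mulr_ge0// invr_ge0 ltW.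
  apply: (le_trans (ler_normB _ _)); rewrite !normrM (ger0_norm (ltW e0)).
  by apply: lerD; apply: ler_piMr; rewrite ?sin_max ?cos_max ?normr_ge0// ltW.
- rewrite -[X in _ --> X](mulr0 (- (2 * D^-1 * (`|a| + e)))).
  by apply: cvgM; [exact: cvg_cst|exact: expR_geom_cvg0].
- rewrite -[X in _ --> X](mulr0 (2 * D^-1 * (`|a| + e))).
  by apply: cvgM; [exact: cvg_cst|exact: expR_geom_cvg0].
Qed.

(** The Poisson kernel of the half-plane at height [e], centred at [z], times $2\pi$; this mass is
    the normalisation that [ift] leaves out. *)
Definition poisson_kernel e z y : R := 2 * e / (e ^+ 2 + (y - z) ^+ 2).

Lemma poisson_kernel_ge0 e z y : 0 < e -> 0 <= poisson_kernel e z y.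
Proof.
move=> e0; rewrite divr_ge0//; first by rewrite mulr_ge0// ltW.
by rewrite addr_ge0// sqr_ge0.
Qed.

Lemma poisson_kernel_primitive e z y : 0 < e ->
  is_derive y 1 (fun y => 2 * atan (e^-1 * (y - z))) (poisson_kernel e z y).
Proof.
move=> e0; have h : is_derive y 1 (fun y => e^-1 * (y - z)) (e^-1 * (1 - 0)).
  exact: derZ (derB (derI _) (derC _ _)).
apply: der_eq (derZ 2 (@der_comp _ atan _ y _ _ (is_derive1_atan _) h)) _.
rewrite /poisson_kernel subr0 mulr1; field.
by apply/andP; split; rewrite gt_eqF// ltr_wpDr ?sqr_ge0 ?exprn_gt0.
Qed.

Lemma poisson_kernel_cont e z : 0 < e -> continuous (poisson_kernel e z).
Proof.
move=> e0 y; apply: cvgM; first exact: cvg_cst.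
apply: cvgV; first by rewrite gt_eqF// ltr_wpDr ?sqr_ge0 ?exprn_gt0.
apply: cvgD; first exact: cvg_cst.
by apply: (@der_continuous _ (fun y => (y - z) ^+ 2)); apply: (derM (derB (derI _) (derC _ _)) (derB (derI _) (derC _ _))).
Qed.

Lemma intR_poisson_kernel e z : 0 < e ->
  L1 (poisson_kernel e z) /\ intR (poisson_kernel e z) = 2 * pi.
Proof.
move=> e0; pose F y := 2 * atan (e^-1 * (y - z)).
have v n : (\int[mu]_(x in window n) (poisson_kernel e z x)%:E =
    (F n%:R - F (- n%:R))%:E)%E.
  apply: ftc.
  - by rewrite lerNl (le_trans _ (ler0n _ _))// oppr_le0.
  - by move=> x _; exact: poisson_kernel_primitive.
  - by move=> x _; exact: poisson_kernel_cont.
have iP : L1 (poisson_kernel e z).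
  apply: (@L1_exhaust _ _ (2 * pi)).
  - by apply: continuous_measurable_fun; exact: poisson_kernel_cont.
  - by move=> x; exact: poisson_kernel_ge0.
  move=> n; rewrite v lee_fin /F.
  have := atan_ltpi2 (e^-1 * (n%:R - z)).
  have := atan_gtNpi2 (e^-1 * (- n%:R - z)).
  by lra.
split => //; apply: (intR_lim iP v).
have ninf (c : R) : (fun n : nat => e^-1 * (n%:R + c)) @ \oo --> +oo.
  apply/cvgryPge => A; near=> n.
  rewrite mulrC ler_pdivlMr//.
  have : A * e - c <= n%:R by near: n; exact: nbhs_infty_ger.
  by lra.
have at_ (c : R) : (fun n : nat => atan (e^-1 * (n%:R + c))) @ \oo --> (pi / 2 : R).
  by apply: (cvg_comp _ _ (ninf c)); exact: cvgy_atan.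
rewrite (_ : (fun n => _) = fun n : nat =>
    2 * atan (e^-1 * (n%:R + - z)) + 2 * atan (e^-1 * (n%:R + z))); last first.
  by apply/funext => n; rewrite /F -opprD mulrN atanN; ring.
rewrite (_ : 2 * pi = 2 * (pi / 2) + 2 * (pi / 2)); last by field.
by apply: cvgD; apply: cvgM; by [exact: cvg_cst|exact: at_].
Unshelve. all: by end_near. Qed.

End poisson_kernel.

(** * Pairing with the Fourier-Plancherel transform and inversion *)

Section fourier_plancherel.
Context {R : realType}.
Notation mu := (@lebesgue_measure R).
Implicit Types (f g a b qa qb : R -> R) (x y z xi e d : R).

Lemma measurable_cosM x : measurable_fun setT (fun xi => cos (x * xi)).
Proof. by apply: continuous_measurable_fun => xi; exact: der_continuous (der_cosM x xi). Qed.

Lemma measurable_sinM x : measurable_fun setT (fun xi => sin (x * xi)).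
Proof. by apply: continuous_measurable_fun => xi; exact: der_continuous (der_sinM x xi). Qed.

Lemma measurable_cosM2 : measurable_fun setT (fun z : R * R => cos (z.1 * z.2)).
Proof.
apply: (measurableT_comp (f := cos)).
  by apply: continuous_measurable_fun; exact: continuous_cos.
by apply: measurable_funM.
Qed.

Lemma measurable_sinM2 : measurable_fun setT (fun z : R * R => sin (z.1 * z.2)).
Proof.
apply: (measurableT_comp (f := sin)).
  by apply: continuous_measurable_fun; exact: continuous_sin.
by apply: measurable_funM.
Qed.

Lemma L1_cos f x : L1 f -> L1 (fun xi => f xi * cos (x * xi)).
Proof.
move=> if_; apply: (L1_bounded (M := 1)) => //; first exact: measurable_cosM.
by move=> xi; exact: cos_max.
Qed.

Lemma L1_sin f x : L1 f -> L1 (fun xi => f xi * sin (x * xi)).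
Proof.
move=> if_; apply: (L1_bounded (M := 1)) => //; first exact: measurable_sinM.
by move=> xi; exact: sin_max.
Qed.

(* Up to the factor 2 pi, the real part of the inverse Fourier transform of
   qa + i qb. *)
Definition ift qa qb x : R :=
  intR (fun xi => qa xi * cos (x * xi) - qb xi * sin (x * xi)).

Lemma ift_split qa qb x : L1 qa -> L1 qb ->
  ift qa qb x = intR (fun xi => qa xi * cos (x * xi)) -
                intR (fun xi => qb xi * sin (x * xi)).
Proof. by move=> ia ib; rewrite -intRB//; [exact: L1_cos|exact: L1_sin]. Qed.

Lemma L1_ift qa qb x : L1 qa -> L1 qb ->
  L1 (fun xi => qa xi * cos (x * xi) - qb xi * sin (x * xi)).
Proof. by move=> ia ib; apply: L1B; [exact: L1_cos|exact: L1_sin]. Qed.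

Lemma ift_integrand_le qa qb x xi :
  `|qa xi * cos (x * xi) - qb xi * sin (x * xi)| <= `|qa xi| + `|qb xi|.
Proof.
apply: (le_trans (ler_normB _ _)); rewrite !normrM.
by apply: lerD; apply: ler_piMr; rewrite ?cos_max ?sin_max.
Qed.

Lemma ift_le qa qb x : L1 qa -> L1 qb ->
  `|ift qa qb x| <= intR (fun xi => `|qa xi| + `|qb xi|).
Proof.
move=> ia ib; apply: abs_intR_le.
- exact: L1_meas (L1_ift x ia ib).
- by apply: L1D; exact: L1_abs.
- by move=> xi; exact: ift_integrand_le.
Qed.

Lemma ift_cont qa qb : L1 qa -> L1 qb -> continuous (ift qa qb).
Proof.
move=> ia ib; apply: (@continuous_intR _ _ (fun xi => `|qa xi| + `|qb xi|)).
- by move=> x; exact: L1_meas (L1_ift x ia ib).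
- by apply: L1D; exact: L1_abs.
- by move=> x xi; exact: ift_integrand_le.
- move=> xi x; under eq_fun do rewrite (mulrC _ xi).
  apply: cvgB; (apply: cvgM; first exact: cvg_cst).
  + exact: der_continuous (der_cosM xi x).
  + exact: der_continuous (der_sinM xi x).
Qed.

Lemma ift_meas qa qb : L1 qa -> L1 qb -> measurable_fun setT (ift qa qb).
Proof. by move=> ia ib; apply: continuous_measurable_fun; exact: ift_cont. Qed.

Lemma ift_derive qa qb : L1 qa -> L1 qb ->
  L1 (fun xi => xi * qa xi) -> L1 (fun xi => xi * qb xi) ->
  forall x, is_derive x 1 (ift qa qb)
    (ift (fun xi => - (xi * qb xi)) (fun xi => xi * qa xi) x).
Proof.
move=> ia ib ixa ixb.
apply: (@is_derive_intR _ _ _ (fun xi => `|- (xi * qb xi)| + `|xi * qa xi|)).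
- by move=> x; exact: L1_ift.
- by apply: L1D; apply: L1_abs => //; exact: L1N.
- by move=> x xi; exact: (ift_integrand_le (fun xi => - (xi * qb xi)) (fun xi => xi * qa xi)).
- move=> xi x; apply: der_eq.
  by rewrite /GRing.scale /=; ring.
Qed.

(** The real part of [fourier_trunc] and, with [sin_trunc], the opposite of its imaginary part.
    Transforms are carried as pairs of real functions from here on. *)
Definition cos_trunc f (n : nat) xi : R :=
  \int[mu]_(x in window n) (f x * cos (x * xi)).
Definition sin_trunc f (n : nat) xi : R :=
  \int[mu]_(x in window n) (f x * sin (x * xi)).

(* a + i b is the Fourier-Plancherel transform of f. *)
Definition FT f a b : Prop :=
  [/\ L2 f, L2 a /\ L2 b,
      (forall n, measurable_fun setT (cos_trunc f n)) /\
      (forall n, measurable_fun setT (sin_trunc f n)),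
      \forall n \near \oo, L2 (fun xi => cos_trunc f n xi - a xi) /\
                           L2 (fun xi => - sin_trunc f n xi - b xi) &
      (fun n => intR (fun xi => (cos_trunc f n xi - a xi) ^+ 2)) @ \oo --> (0 : R) /\
      (fun n => intR (fun xi => (- sin_trunc f n xi - b xi) ^+ 2)) @ \oo --> (0 : R)].

Lemma cos_truncE f n xi :
  cos_trunc f n xi = intR (fun x => f x * \1_(window n) x * cos (x * xi)).
Proof. by rewrite /cos_trunc intR_indic; apply: eq_intR => x; rewrite mulrAC. Qed.

Lemma sin_truncE f n xi :
  sin_trunc f n xi = intR (fun x => f x * \1_(window n) x * sin (x * xi)).
Proof. by rewrite /sin_trunc intR_indic; apply: eq_intR => x; rewrite mulrAC. Qed.

Lemma cos_trunc_cont f n : L2 f -> continuous (cos_trunc f n).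
Proof.
move=> hf; have hn := L2_window n hf.
rewrite (_ : cos_trunc f n =
  ift (fun x => f x * \1_(window n) x) (fun=> 0)); last first.
  apply/funext => xi; rewrite cos_truncE /ift; apply: eq_intR => x.
  by rewrite mul0r subr0 (mulrC x).
by apply: ift_cont => //; exact: L1_0.
Qed.

Lemma sin_trunc_cont f n : L2 f -> continuous (sin_trunc f n).
Proof.
move=> hf; have hn := L2_window n hf.
rewrite (_ : sin_trunc f n =
  ift (fun=> 0) (fun x => - (f x * \1_(window n) x))); last first.
  apply/funext => xi; rewrite sin_truncE /ift; apply: eq_intR => x.
  by rewrite mul0r sub0r mulNr opprK (mulrC x).
by apply: ift_cont => //; [exact: L1_0|exact: L1N].
Qed.

(* Plancherel pairing against an integrable, square integrable symbol: this is
   Fubini on each window, then the definition of the transform. *)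
Lemma FT_pairing f a b qa qb : FT f a b ->
  L1 qa -> L2 qa -> L1 qb -> L2 qb ->
  (fun n => \int[mu]_(x in window n) (f x * ift qa qb x)) @ \oo -->
  intR (fun xi => qa xi * a xi + qb xi * b xi).
Proof.
move=> [hf [ha hb] _ hn [ca cb]] ia ha' ib hb'.
have e n : \int[mu]_(x in window n) (f x * ift qa qb x) =
    intR (fun xi => qa xi * cos_trunc f n xi) -
    intR (fun xi => qb xi * sin_trunc f n xi).
  have ifn := L2_window n hf.
  rewrite intR_indic.
  under [X in _ = X - _]eq_intR do rewrite cos_truncE.
  under [X in _ = _ - X]eq_intR do rewrite sin_truncE.
  rewrite -(fubini_bounded (k := fun p => cos (p.1 * p.2)) (M := 1) ifn ia);
    [|exact: measurable_cosM2|by move=> z; exact: cos_max].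
  rewrite -(fubini_bounded (k := fun p => sin (p.1 * p.2)) (M := 1) ifn ib);
    [|exact: measurable_sinM2|by move=> z; exact: sin_max].
  (* The inner integral is continuous in [x] and bounded by the $L^1$ norm of [q], so its product
     with the truncated [f] is integrable and the cosine and sine parts can be recombined. *)
  have bd q (k : R -> R -> R) : L1 q -> (forall x y, `|k x y| <= 1) ->
     (forall x, measurable_fun setT (k x)) -> (forall y, continuous (k ^~ y)) ->
      L1 (fun x => f x * \1_(window n) x * intR (fun y => q y * k x y)).
    move=> iq k1 mk ck; apply: (L1_bounded (M := intR (fun x => `|q x|))) => //.
      apply: continuous_measurable_fun.
      apply: (@continuous_intR _ _ (fun y => `|q y|)).
      - by move=> y; apply: measurable_funM => //; exact: L1_meas.
      - exact: L1_abs.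
      - by move=> x y; rewrite normrM ler_piMr.
      - by move=> x y; apply: cvgM; [exact: cvg_cst|exact: ck].
    move=> x; apply: abs_intR_le.
    - by apply: measurable_funM => //; exact: L1_meas.
    - exact: L1_abs.
    - by move=> y; rewrite normrM ler_piMr.
  rewrite -intRB.
  - by apply: eq_intR => x; rewrite mulrAC ift_split// mulrBr.
  - apply: (bd qa (fun x y => cos (x * y))) => //.
    + by move=> x y; exact: cos_max.
    + by move=> x; exact: measurable_cosM.
    + move=> y x; under eq_fun do rewrite mulrC.
      exact: der_continuous (der_cosM y x).
  - apply: (bd qb (fun x y => sin (x * y))) => //.
    + by move=> x y; exact: sin_max.
    + by move=> x; exact: measurable_sinM.
    + move=> y x; under eq_fun do rewrite mulrC.
      exact: der_continuous (der_sinM y x).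
apply/subr_cvg0.
have hn1 : \forall n \near \oo, L2 (fun xi => cos_trunc f n xi - a xi).
  by apply: filterS hn => n [].
have hn2 : \forall n \near \oo, L2 (fun xi => - sin_trunc f n xi - b xi).
  by apply: filterS hn => n [].
have l1 := L2_ip_cvg0 (FF := eventually_filter) ha' hn1 ca.
have l2 := L2_ip_cvg0 (FF := eventually_filter) hb' hn2 cb.
have l : (fun i => intR (fun x => (cos_trunc f i x - a x) * qa x) +
    intR (fun x => (- sin_trunc f i x - b x) * qb x)) @ \oo --> (0 + 0 : R).
  exact: cvgD l1 l2.
rewrite addr0 in l.
apply: cvg_trans l; apply: near_eq_cvg; near=> n.
have [h1 h2] : L2 (fun xi => cos_trunc f n xi - a xi) /\
                           L2 (fun xi => - sin_trunc f n xi - b xi) by near: n.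
rewrite e; have ic : L1 (fun xi => qa xi * cos_trunc f n xi).
  have := L2_mul ha' (L2D h1 ha); congr L1; apply/funext => xi; congr (_ * _); ring.
have is_ : L1 (fun xi => qb xi * sin_trunc f n xi).
  have := L1N (L2_mul hb' (L2D h2 hb)); congr L1; apply/funext => xi.
  by rewrite -mulrN; congr (_ * _); ring.
have iab : L1 (fun xi => qa xi * a xi + qb xi * b xi).
  by apply: L1D; exact: L2_mul.
rewrite /= -[LHS]intRD; last 2 first.
- exact: L2_mul.
- exact: L2_mul.
rewrite -(intRB ic is_) -intRB//; last exact: L1B.
by apply: eq_intR => xi; ring.
Unshelve. all: by end_near. Qed.

Lemma FT_pairing_L2 f a b qa qb : FT f a b ->
  L1 qa -> L2 qa -> L1 qb -> L2 qb -> L2 (ift qa qb) ->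
  intR (fun x => f x * ift qa qb x) =
  intR (fun xi => qa xi * a xi + qb xi * b xi).
Proof.
move=> hf ia ha ib hb hi; have := FT_pairing hf ia ha ib hb.
by apply: cvg_unique => //; apply: intR_window; apply: L2_mul => //; case: hf.
Qed.

Lemma ift_poisson e z y : 0 < e ->
  ift (fun xi => poisson_weight e xi * cos (z * xi))
      (fun xi => - (poisson_weight e xi * sin (z * xi))) y = poisson_kernel e z y.
Proof.
move=> e0; rewrite /poisson_kernel -intR_poisson_weight_cos//.
apply: eq_intR => xi; rewrite mulrBl cosB; ring.
Qed.

Lemma poisson_kernel_le e z y : 0 < e -> poisson_kernel e z y <= 2 / e.
Proof.
move=> e0; rewrite /poisson_kernel -!mulrA ler_wpM2l//.
rewrite ler_pdivrMr ?ltr_wpDr ?sqr_ge0 ?exprn_gt0//.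
rewrite mulrDr expr2 mulKf ?gt_eqF// lerDl mulr_ge0 ?invr_ge0 ?sqr_ge0//.
exact: ltW.
Qed.

Lemma L2_of_bounded f (M : R) : L1 f -> (forall x, `|f x| <= M) -> L2 f.
Proof.
move=> if_ fM; split; first exact: L1_meas.
by have := L1_bounded if_ (L1_meas if_) fM; congr L1; apply/funext => x; rewrite expr2.
Qed.

Lemma L2_poisson_kernel e z : 0 < e -> L2 (poisson_kernel e z).
Proof.
move=> e0; apply: (@L2_of_bounded _ (2 / e)).
  exact: (intR_poisson_kernel z e0).1.
by move=> y; rewrite ger0_norm ?poisson_kernel_ge0// poisson_kernel_le.
Qed.

(** With $t=(y-z)^2\ge d^2$ the ratio of the kernels at heights $e$ and 1 is $e(1+t)/(e^2+t)\le
    e(1+t)/t\le e(1+d^2)/d^2$. *)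
Lemma poisson_kernel_far e z y d : 0 < e -> 0 < d -> d <= `|y - z| ->
  poisson_kernel e z y <= e * ((1 + d ^+ 2) / d ^+ 2) * poisson_kernel 1 z y.
Proof.
move=> e0 d0 dyz.
have d2 : d ^+ 2 <= (y - z) ^+ 2.
  by rewrite -[leRHS]real_normK ?num_real// ler_sqr ?nnegrE ?normr_ge0 ?(ltW d0).
have t0 : 0 < (y - z) ^+ 2 by apply: lt_le_trans d2; rewrite exprn_gt0.
have d20 : 0 < d ^+ 2 by rewrite exprn_gt0.
rewrite /poisson_kernel expr1n mulr1.
move: d2 t0 d20; set t := (y - z) ^+ 2; set D := d ^+ 2 => Dt t0 D0.
have e2 : 0 < e ^+ 2 by rewrite exprn_gt0.
rewrite ler_pdivrMr ?addr_gt0//.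
rewrite (_ : e * _ * _ * _ = (2 * e) * (((1 + D) * (e ^+ 2 + t)) / (D * (1 + t)))); last first.
  by field; apply/andP; split; rewrite gt_eqF// addr_gt0.
rewrite ler_peMr ?mulr_ge0 ?(ltW e0)// ler_pdivlMr ?mulr_gt0 ?addr_gt0// mul1r.
nra.
Qed.

(** Near [z], continuity and the total mass $2\pi$. Far from [z] no bound on [f] is available, only
    $L^2$: there the kernel is at most a small multiple of the kernel of height 1, which is itself
    in $L^2$ and can be paired with [f]. *)
Lemma poisson_approx f z : L2 f -> {for z, continuous f} ->
  (fun n : nat => intR (fun y => f y * poisson_kernel n.+1%:R^-1 z y)) @ \oo -->
  2 * pi * f z.
Proof.
move=> hf cf.
pose e (n : nat) : R := n.+1%:R^-1.
have e0 n : 0 < e n by rewrite invr_gt0.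
have ie n := (intR_poisson_kernel z (e0 n)).1.
have ev n := (intR_poisson_kernel z (e0 n)).2.
have h1 := L2_poisson_kernel z (@ltr01 R).
have i1 := (intR_poisson_kernel z (@ltr01 R)).1.
pose g y := (`|f y| + `|f z|) * poisson_kernel 1 z y.
have ig : L1 g.
  have := L1D (L2_mul (L2_abs hf) h1) (L1Z `|f z| i1).
  by congr L1; apply/funext => y; rewrite /g mulrDl.
have C0 : 0 <= intR g.
  by apply: intR_ge0 => y; rewrite mulr_ge0 ?addr_ge0 ?poisson_kernel_ge0.
apply/cvgrPdist_le => r r0.
(* Half of the error [r], spread over the mass $2\pi$, is the oscillation allowed near [z]; the
   other half absorbs the far part through [en]. *)
have eta0 : 0 < r / 2 / (2 * pi) by rewrite !divr_gt0 ?mulr_gt0 ?pi_gt0.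
move/cvgrPdist_le : cf => /(_ _ eta0) /nbhs_ballP[d /= d0 fd].
pose K := (1 + d ^+ 2) / d ^+ 2.
have K0 : 0 < K by rewrite divr_gt0 ?addr_gt0 ?exprn_gt0.
near=> n.
have en : e n * (K * intR g + 1) <= r / 2.
  near: n.
  have : (fun n => e n * (K * intR g + 1)) @ \oo --> (0 * (K * intR g + 1) : R).
    by apply: cvgM; [exact: cvg_harmonic|exact: cvg_cst].
  rewrite mul0r => /cvgr0Pnorm_le /(_ _ (divr_gt0 r0 (@ltr0Sn R 1))).
  by apply: filterS => n; apply: le_trans; exact: ler_norm.
have ifk : L1 (fun y => f y * poisson_kernel (e n) z y).
  exact: L2_mul hf (L2_poisson_kernel z (e0 n)).
rewrite -(ev n) mulrC -(intRZ _ (ie n)) -intRB//; last exact: L1Z.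
have iG : L1 (fun y => r / 2 / (2 * pi) * poisson_kernel (e n) z y + e n * K * g y).
  by apply: L1D; exact: L1Z.
apply: (@le_trans _ _ (intR (fun y => r / 2 / (2 * pi) * poisson_kernel (e n) z y +
    e n * K * g y))); last first.
  rewrite (intRD (L1Z _ (ie n)) (L1Z _ ig)) (intRZ _ (ie n)) (intRZ _ ig) ev.
  rewrite divfK; last by rewrite gt_eqF// mulr_gt0// pi_gt0.
  by have := e0 n; nra.
apply: abs_intR_le => //.
  by apply: measurable_funB; [exact: L1_meas (L1Z _ (ie n))|exact: L1_meas ifk].
move=> y; rewrite -mulrBl normrM (ger0_norm (poisson_kernel_ge0 _ _ (e0 n))).
have P0 := poisson_kernel_ge0 z y (e0 n).
have g0 : 0 <= g y by rewrite mulr_ge0 ?addr_ge0 ?poisson_kernel_ge0.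
have [yz|yz] := ltP `|z - y| d.
  have := fd _ yz => fy.
  apply: ler_wpDr; first by rewrite mulr_ge0// mulr_ge0 ?(ltW K0) ?(ltW (e0 n)).
  exact: ler_wpM2r.
apply: ler_wpDl; first by rewrite mulr_ge0// (ltW eta0).
apply: (@le_trans _ _ ((`|f y| + `|f z|) * (e n * K * poisson_kernel 1 z y))).
  apply: ler_pM => //; first by rewrite [leRHS]addrC ler_normB.
  by apply: poisson_kernel_far => //; rewrite distrC.
by rewrite /g mulrCA.
Unshelve. all: by end_near. Qed.

(* The pairing against the symbol of the Poisson kernel centred at x. *)
Lemma fourier_inversion f a b : FT f a b -> continuous f -> L1 a -> L1 b ->
  forall x, 2 * pi * f x = ift a b x.
Proof.
move=> hf cf ia ib x.
have hf2 : L2 f by case: hf.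
have P := poisson_approx hf2 (cf x).
have e0 n : 0 < n.+1%:R^-1 :> R by rewrite invr_gt0.
pose w n := @poisson_weight R n.+1%:R^-1.
have iw n : L1 (w n) by exact: L1_poisson_weight.
have hw n : L2 (w n).
  apply: (@L2_of_bounded _ 1) => // xi.
  by rewrite ger0_norm ?poisson_weight_ge0// poisson_weight_le1 ?ltW.
have eqn n : intR (fun y => f y * poisson_kernel n.+1%:R^-1 x y) =
    intR (fun xi => w n xi * (a xi * cos (x * xi) - b xi * sin (x * xi))).
  under eq_intR do rewrite -ift_poisson//.
  have hc : L2 (fun xi => w n xi * cos (x * xi)).
    apply: (@L2_bounded _ _ _ 1) => //; first exact: measurable_cosM.
    by move=> xi; exact: cos_max.
  have hs : L2 (fun xi => - (w n xi * sin (x * xi))).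
    have : L2 (fun xi => w n xi * sin (x * xi)).
      apply: (@L2_bounded _ _ _ 1) => //; first exact: measurable_sinM.
      by move=> xi; exact: sin_max.
    move/(L2Z (-1)); congr L2.
    by apply/funext => xi; rewrite mulN1r.
  rewrite (FT_pairing_L2 hf) => //.
  - by apply: eq_intR => xi; rewrite /w; ring.
  - exact: (L1_cos _ (iw n)).
  - by apply: L1N; exact: (L1_sin _ (iw n)).
  - rewrite (_ : ift _ _ = poisson_kernel n.+1%:R^-1 x).
      exact: L2_poisson_kernel.
    by apply/funext => y; rewrite ift_poisson.
(* Abel summation of the inverse integral: the weights lie between 0 and 1 and tend to 1, so the
   integrability of [a] and [b] provides the domination. *)
have Q : (fun n => intR (fun xi => w n xi * (a xi * cos (x * xi) - b xi * sin (x * xi))))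
    @ \oo --> ift a b x.
  apply: (@dct _ _ _ (fun xi => `|a xi| + `|b xi|) _ _ _ _).2.
  - move=> n; apply: measurable_funM; first exact: poisson_weight_meas.
    exact: L1_meas (L1_ift x ia ib).
  - by apply: L1D; exact: L1_abs.
  - move=> xi; rewrite -[X in _ --> X]mul1r; apply: cvgM; last exact: cvg_cst.
    have l : (fun n : nat => - n.+1%:R^-1 * `|xi|) @ \oo --> (- 0 * `|xi|).
      by apply: cvgM; [apply: cvgN; exact: cvg_harmonic|exact: cvg_cst].
    rewrite -(@expR0 R) -(mul0r `|xi|) -oppr0.
    exact: (cvg_comp _ _ l (@continuous_expR R _)).
  - move=> n xi; rewrite normrM (ger0_norm (poisson_weight_ge0 _ _)).
    apply: (le_trans _ (ift_integrand_le a b x xi)).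
    by apply: ler_piMl => //; apply: poisson_weight_le1; exact: ltW.
move: P; under eq_fun do rewrite eqn; move=> P.
exact: (cvg_unique _ P Q).
Qed.

End fourier_plancherel.

(** * Invariance of the integral under translations and reflections *)

Section isometries.
Context {R : realType}.
Notation mu := (@lebesgue_measure R).
Implicit Types (f : R -> R).

Section measure_preserving.
Variable phi : R -> R.
Hypothesis mphi : measurable_fun setT phi.
Hypothesis iphi : forall a b : R,
  mu (phi @^-1` `]a, b]%classic) = mu `]a, b]%classic.

Let phi' : measurableTypeR R -> measurableTypeR R := phi.
Let mphi' : measurable_fun setT phi'. Proof. exact: mphi. Qed.

HB.instance Definition _ := isMeasurableFun.Build _ _ _ _ phi' mphi'.

(** Lebesgue measure is determined by its values on bounded half-open intervals, so [iphi] is all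
    that has to be checked for a map. *)
Let pushE A : measurable A -> mu A = pushforward mu phi' A.
Proof.
by apply: lebesgue_measure_unique => _ [[a b] _ <-] /=; rewrite /pushforward iphi.
Qed.

Lemma ge0_integral_comp (f : R -> \bar R) : measurable_fun setT f ->
  (forall x, (0 <= f x)%E) -> (\int[mu]_x f (phi x) = \int[mu]_x f x)%E.
Proof.
move=> mf f0.
have := @ge0_integral_pushforward _ _ _ _ R phi' mphi' mu setT f measurableT mf.
move=> /(_ (fun y _ => f0 y)); rewrite preimage_setT => <-.
by apply: eq_measure_integral => A mA _; exact: esym (pushE mA).
Qed.

Lemma L1_comp f : L1 f -> L1 (f \o phi).
Proof.
move=> if_; have mf := L1_meas if_.
apply/integrableP; split; first by apply/measurable_EFinP; exact: measurableT_comp.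
rewrite (@ge0_integral_comp (fun x => `|(f x)%:E|%E)).
- by case/integrableP : if_.
- by apply: measurableT_comp => //; exact/measurable_EFinP.
- by move=> x.
Qed.

Lemma intR_comp f : L1 f -> intR (f \o phi) = intR f.
Proof.
move=> if_; rewrite /intR /Rintegral; congr fine.
have mf := measurable_int _ if_.
have := @integral_pushforward _ _ _ _ R phi' mphi' mu setT (EFin \o f) mf.
rewrite preimage_setT => /(_ (L1_comp if_) measurableT) <-.
by apply: eq_measure_integral => A mA _; exact: esym (pushE mA).
Qed.

End measure_preserving.

Lemma shift_preserving (h a b : R) :
  mu ((fun x : R => x + h) @^-1` `]a, b]%classic) = mu `]a, b]%classic.
Proof.
rewrite (_ : _ @^-1` _ = `]a - h, b - h]%classic).
  rewrite !lebesgue_measure_itv /= !lte_fin ltrD2r; case: ifP => // _.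
  by rewrite -!EFinB; congr EFin; ring.
by apply/seteqP; split => x /=; rewrite !in_itv /= ltrBlDr lerBrDr.
Qed.

Lemma reflection_preserving (c a b : R) :
  mu ((fun x : R => c - x) @^-1` `]a, b]%classic) = mu `]a, b]%classic.
Proof.
rewrite (_ : _ @^-1` _ = `[c - b, c - a[%classic).
  rewrite !lebesgue_measure_itv /= !lte_fin ltrD2l ltrN2; case: ifP => // _.
  by rewrite -!EFinB; congr EFin; ring.
apply/seteqP; split => x /=; rewrite !in_itv /=.
  by move=> /andP[? ?]; apply/andP; split; lra.
by move=> /andP[? ?]; apply/andP; split; lra.
Qed.

Lemma measurable_shift (h : R) : measurable_fun setT (fun x : R => x + h).
Proof. exact: measurable_funD. Qed.

Lemma measurable_reflection (c : R) : measurable_fun setT (fun x : R => c - x).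
Proof. exact: measurable_funB. Qed.

Lemma L1_shift f (h : R) : L1 f -> L1 (fun x => f (x + h)).
Proof. exact: L1_comp (measurable_shift h) (shift_preserving h) _. Qed.

Lemma intR_shift f (h : R) : L1 f -> intR (fun x => f (x + h)) = intR f.
Proof. exact: intR_comp (measurable_shift h) (shift_preserving h) _. Qed.

Lemma L1_reflect f (c : R) : L1 f -> L1 (fun x => f (c - x)).
Proof. exact: L1_comp (measurable_reflection c) (reflection_preserving c) _. Qed.

Lemma intR_reflect f (c : R) : L1 f -> intR (fun x => f (c - x)) = intR f.
Proof. exact: intR_comp (measurable_reflection c) (reflection_preserving c) _. Qed.

Lemma L2_shift f (h : R) : L2 f -> L2 (fun x => f (x + h)).
Proof.
move=> [mf f2]; split; last exact: L1_shift f2.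
exact: measurableT_comp mf (measurable_shift h).
Qed.

Lemma L2_reflect f (c : R) : L2 f -> L2 (fun x => f (c - x)).
Proof.
move=> [mf f2]; split; last exact: L1_reflect f2.
exact: measurableT_comp mf (measurable_reflection c).
Qed.

End isometries.

(** * Two derivatives of a function whose transform is weighted integrable *)

Section regularity.
Context {R : realType}.
Notation mu := (@lebesgue_measure R).
Implicit Types (f g a b q : R -> R) (x y xi h : R).

Lemma ift_scale (k : R) a b x : L1 a -> L1 b ->
  ift (fun xi => k * a xi) (fun xi => k * b xi) x = k * ift a b x.
Proof.
move=> ia ib; rewrite /ift -intRZ; last exact: L1_ift.
by apply: eq_intR => xi; ring.
Qed.

(* Admissible Fourier transforms: those of functions with two continuous
   derivatives, the second one square integrable. *)
Definition reg q : Prop :=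
  [/\ L1 q, L2 q, L1 (fun xi => xi ^+ 2 * q xi) & L2 (fun xi => xi ^+ 2 * q xi)].

Lemma abs_le1Dsqr xi : `|xi| <= 1 + xi ^+ 2.
Proof.
have := sqr_ge0 (`|xi| - 1); rewrite sqrrB1 real_normK ?num_real//.
by have := normr_ge0 xi; lra.
Qed.

Lemma reg_L1X q : reg q -> L1 (fun xi => xi * q xi).
Proof.
move=> [i1 _ i2 _]; apply: L1_le (L1D (L1_abs i1) (L1_abs i2)) _.
  by apply: measurable_funM => //; exact: L1_meas.
move=> xi; rewrite !normrM -[X in _ <= X + _]mul1r -mulrDl ler_wpM2r//.
by rewrite -expr2 real_normK ?num_real// abs_le1Dsqr.
Qed.

Section second_derivative.
Variables (f a b : R -> R).
Hypotheses (hf : FT f a b) (cf : continuous f) (ra : reg a) (rb : reg b).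

Let ia : L1 a. Proof. by case: ra. Qed.
Let ib : L1 b. Proof. by case: rb. Qed.
Let ixa : L1 (fun xi => xi * a xi). Proof. exact: reg_L1X. Qed.
Let ixb : L1 (fun xi => xi * b xi). Proof. exact: reg_L1X. Qed.
Let hf2 : L2 f. Proof. by case: hf. Qed.
Let ixxa : L1 (fun xi => - (xi ^+ 2 * a xi)).
Proof. by case: ra => _ _ i _; exact: L1N. Qed.
Let ixxb : L1 (fun xi => - (xi ^+ 2 * b xi)).
Proof. by case: rb => _ _ i _; exact: L1N. Qed.

Lemma inv_twopi_ge0 : 0 <= (2 * pi)^-1 :> R.
Proof. by rewrite invr_ge0 mulr_ge0// pi_ge0. Qed.

Lemma twopi_neq0 : 2 * pi != 0 :> R.
Proof. by rewrite gt_eqF// mulr_gt0// pi_gt0. Qed.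

Lemma reg_ift x : f x = (2 * pi)^-1 * ift a b x.
Proof. by rewrite -(fourier_inversion hf cf ia ib) mulKf// twopi_neq0. Qed.

Lemma reg_derive x : is_derive x 1 f
  ((2 * pi)^-1 * ift (fun xi => - (xi * b xi)) (fun xi => xi * a xi) x).
Proof.
rewrite (_ : f = fun x => (2 * pi)^-1 * ift a b x); last first.
  by apply/funext => y; exact: reg_ift.
exact: derZ (ift_derive ia ib ixa ixb x).
Qed.

Lemma reg_derive1E :
  derive1 f = fun x => (2 * pi)^-1 *
    ift (fun xi => - (xi * b xi)) (fun xi => xi * a xi) x.
Proof. by apply/funext => x; exact: der_derive1 (reg_derive x). Qed.

Lemma reg_derive2 x : is_derive x 1 (derive1 f)
  ((2 * pi)^-1 * ift (fun xi => - (xi ^+ 2 * a xi)) (fun xi => - (xi ^+ 2 * b xi)) x).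
Proof.
rewrite reg_derive1E; apply: derZ; apply: der_eq.
  apply: ift_derive => //; first exact: L1N.
  - by move: ixxb; congr L1; apply/funext => xi; ring.
  - by move: (L1N ixxa); congr L1; apply/funext => xi; ring.
by congr (ift _ _ x); apply/funext => xi; ring.
Qed.

Lemma reg_derive2E :
  derive1n 2 f = fun x => (2 * pi)^-1 *
    ift (fun xi => - (xi ^+ 2 * a xi)) (fun xi => - (xi ^+ 2 * b xi)) x.
Proof. by apply/funext => x; exact: der_derive1 (reg_derive2 x). Qed.

(** Centred, so that it is symmetric for the $L^2$ pairing and has a real symbol. Being a
    combination of translates it stays in $L^2$ with [g], which opens the way to the square
    integrability of the second derivative. *)
Definition diff2 h g x := (g (x + h) + g (x - h) - 2 * g x) / h ^+ 2.
(** This is $(2\cos h\xi-2)/h^2$, written with the half angle so that the bound by $\xi^2$ follows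
    from $|\sin t|\le|t|$. *)
Definition diff2_symbol h xi := - (2 * sin (h * (xi / 2)) / h) ^+ 2.

Lemma abs_sin_le (t : R) : `|sin t| <= `|t|.
Proof.
have := mvt_abs (fun x => is_derive_sin x) (fun x => cos_max x) t 0.
by rewrite sin0 !subr0 mul1r.
Qed.

Lemma diff2_symbol_le h xi : `|diff2_symbol h xi| <= xi ^+ 2.
Proof.
rewrite /diff2_symbol normrN normrX -[leRHS]real_normK ?num_real//.
have [->|h0] := eqVneq h 0.
  by rewrite invr0 mulr0 normr0 expr0n sqr_ge0.
apply: lerXn2r; rewrite ?nnegrE//.
rewrite !normrM normfV ler_pdivrMr ?normr_gt0//.
have := abs_sin_le (h * (xi / 2)).
rewrite !normrM normfV (@ger0_norm _ 2)//; lra.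
Qed.

Lemma diff2_symbol_mul_le h xi (t : R) :
  `|diff2_symbol h xi * t| <= `|xi ^+ 2 * t|.
Proof.
rewrite !(normrM _ t) ler_wpM2r// (ger0_norm (sqr_ge0 xi)).
exact: diff2_symbol_le.
Qed.

Lemma measurable_diff2_symbol h : measurable_fun setT (diff2_symbol h).
Proof.
apply: measurableT_comp => //; apply: measurable_funX; apply: measurable_funM => //.
apply: measurable_funM => //; apply: continuous_measurable_fun => xi.
apply: (@der_continuous _ _ _ (cos (h * (xi / 2)) * (h * (2^-1)))).
apply: (der_comp (f := sin) (g := fun xi => h * (xi / 2)) (is_derive_sin _)).
by apply: derZ; apply: der_eq; rewrite /GRing.scale /=; ring.
Qed.

Lemma diff2_ift h qa qb x : h != 0 -> L1 qa -> L1 qb ->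
  diff2 h (ift qa qb) x =
  ift (fun xi => diff2_symbol h xi * qa xi) (fun xi => diff2_symbol h xi * qb xi) x.
Proof.
move=> h0 iqa iqb; have i y := L1_ift y iqa iqb.
rewrite /diff2 /ift mulrC -(intRZ _ (i x)).
rewrite -(intRD (i _) (i _)) -intRB; [|exact: L1D|exact: L1Z].
rewrite -intRZ; last by apply: L1B; [exact: L1D|exact: L1Z].
apply: eq_intR => xi; rewrite /diff2_symbol.
rewrite !mulrDl !mulNr cosD cosB sinD sinB.
have e : cos (h * xi) = 1 - 2 * sin (h * (xi / 2)) ^+ 2.
  rewrite (_ : h * xi = (h * (xi / 2)) + (h * (xi / 2))); last by field.
  by rewrite cosD -!expr2 cos2sin2; ring.
by rewrite e; field.
Qed.

Lemma diff2_adjoint h g1 g2 : L2 g1 -> L2 g2 ->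
  intR (fun x => diff2 h g1 x * g2 x) = intR (fun x => g1 x * diff2 h g2 x).
Proof.
move=> h1 h2.
have s k : L1 (fun x => g1 (x + k) * g2 x) by apply: L2_mul => //; exact: L2_shift.
have t k : L1 (fun x => g1 x * g2 (x + k)) by apply: L2_mul => //; exact: L2_shift.
have st k : intR (fun x => g1 (x + k) * g2 x) = intR (fun x => g1 x * g2 (x - k)).
  rewrite -(intR_shift k (t (- k))); apply: eq_intR => x.
  by rewrite addrK.
have i0 : L1 (fun x => g1 x * g2 x) by exact: L2_mul.
transitivity ((h ^+ 2)^-1 * (intR (fun x => g1 (x + h) * g2 x) +
    intR (fun x => g1 (x - h) * g2 x) - 2 * intR (fun x => g1 x * g2 x))).
  rewrite -(intRZ _ i0) -(intRD (s _) (s _)) -intRB; [|exact: L1D|exact: L1Z].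
  rewrite -intRZ; last by apply: L1B; [exact: L1D|exact: L1Z].
  by apply: eq_intR => x; rewrite /diff2; ring.
rewrite !st opprK.
rewrite -(intRZ _ i0) -(intRD (t _) (t _)) -intRB; [|exact: L1D|exact: L1Z].
rewrite -intRZ; last by apply: L1B; [exact: L1D|exact: L1Z].
by apply: eq_intR => x; rewrite /diff2; ring.
Qed.

Lemma L2_diff2 h g : L2 g -> L2 (diff2 h g).
Proof.
move=> hg; rewrite (_ : diff2 h g =
  fun x => (h ^+ 2)^-1 * (g (x + h) + g (x + - h) - 2 * g x)); last first.
  by apply/funext => x; rewrite /diff2 mulrC.
apply: L2Z; apply: L2B; last exact: L2Z.
by apply: L2D; exact: L2_shift.
Qed.

Lemma diff2_symbol_bounded h xi : h != 0 -> `|diff2_symbol h xi| <= 4 / h ^+ 2.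
Proof.
move=> h0; rewrite /diff2_symbol normrN normrX !normrM normfV exprMn.
rewrite exprVn real_normK ?num_real// ler_wpM2r ?invr_ge0 ?sqr_ge0//.
rewrite (@ger0_norm _ 2)// exprMn -natrX ler_piMr//.
by rewrite -[leRHS](expr1n _ 2) lerXn2r ?nnegrE// sin_max.
Qed.

Lemma L1_symbol h q : h != 0 -> L1 q -> L1 (fun xi => diff2_symbol h xi * q xi).
Proof.
move=> h0 iq; have := L1_bounded iq (measurable_diff2_symbol h)
  (fun xi => diff2_symbol_bounded xi h0).
by congr L1; apply/funext => xi; rewrite mulrC.
Qed.

Lemma L2_symbol h q : h != 0 -> L2 q -> L2 (fun xi => diff2_symbol h xi * q xi).
Proof.
move=> h0 iq; have := L2_bounded iq (measurable_diff2_symbol h)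
  (fun xi => diff2_symbol_bounded xi h0).
by congr L2; apply/funext => xi; rewrite mulrC.
Qed.

Lemma diff2_reg h x : h != 0 -> diff2 h f x = (2 * pi)^-1 *
  ift (fun xi => diff2_symbol h xi * a xi) (fun xi => diff2_symbol h xi * b xi) x.
Proof.
move=> h0; rewrite -diff2_ift// /diff2 !reg_ift; ring.
Qed.

(** Symmetry gives $\|\Delta_h f\|^2=\langle f,\Delta_h^2f\rangle$, and $\Delta_h^2f$ is an inverse
    transform with the symbol squared, so the pairing for [f] itself evaluates the norm. The symbol
    is at most $\xi^2$ in size, whence a bound uniform in [h]. *)
Lemma diff2_norm_le h : h != 0 -> intR (fun x => diff2 h f x ^+ 2) <=
  (2 * pi)^-1 * intR (fun xi => (xi ^+ 2 * a xi) ^+ 2 + (xi ^+ 2 * b xi) ^+ 2).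
Proof.
move=> h0; have hd := L2_diff2 h hf2.
have [_ ha _ hxa] := ra; have [_ hb _ hxb] := rb.
pose qa xi := diff2_symbol h xi * (diff2_symbol h xi * a xi).
pose qb xi := diff2_symbol h xi * (diff2_symbol h xi * b xi).
have iqa : L1 qa by exact: L1_symbol h0 (L1_symbol h0 ia).
have iqb : L1 qb by exact: L1_symbol h0 (L1_symbol h0 ib).
have hqa : L2 qa by exact: L2_symbol h0 (L2_symbol h0 ha).
have hqb : L2 qb by exact: L2_symbol h0 (L2_symbol h0 hb).
have e : diff2 h (diff2 h f) = fun x => (2 * pi)^-1 * ift qa qb x.
  apply/funext => x; rewrite {1}/diff2 !diff2_reg//.
  rewrite -(diff2_ift x h0 (L1_symbol h0 ia) (L1_symbol h0 ib)) /diff2; ring.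
have ei : ift qa qb = fun x => 2 * pi * diff2 h (diff2 h f) x.
  by apply/funext => x; rewrite e mulVKf// twopi_neq0.
have hi : L2 (ift qa qb) by rewrite ei; apply: L2Z; exact: L2_diff2.
under eq_intR do rewrite expr2.
rewrite diff2_adjoint// e.
rewrite (_ : intR _ = intR (fun x => (2 * pi)^-1 * (f x * ift qa qb x))); last first.
  by apply: eq_intR => x; ring.
rewrite intRZ; last exact: L2_mul.
rewrite (FT_pairing_L2 hf)// ler_wpM2l//.
  by rewrite invr_ge0 mulr_ge0// pi_ge0.
apply: le_intR.
- by apply: L1D; exact: L2_mul.
- by apply: L1D; [exact: hxa.2|exact: hxb.2].
move=> xi; have m0 := diff2_symbol_le h xi.
have key t : diff2_symbol h xi * (diff2_symbol h xi * t) * t <= (xi ^+ 2 * t) ^+ 2.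
  rewrite (_ : _ * t = (diff2_symbol h xi * t) ^+ 2); last by ring.
  rewrite -real_normK ?num_real// -[leRHS]real_normK ?num_real//.
  by rewrite lerXn2r ?nnegrE// diff2_symbol_mul_le.
by apply: lerD; exact: key.
Qed.

Lemma derive_seq (g : R -> R) x dg (u : nat -> R) : is_derive x 1 g dg ->
  (forall n, u n != 0) -> u @ \oo --> (0 : R) ->
  (fun n => (g (x + u n) - g x) / u n) @ \oo --> dg.
Proof.
move=> hg u0 ul; have dv := @derive_val _ _ _ _ _ _ _ hg.
have := @ex_derive _ _ _ _ _ _ _ hg; rewrite /derivable => /cvg_ex[l hl].
have -> : dg = l by rewrite -dv; apply: cvg_lim.
have := (cvgr_dnbhsP _ _ _).1 hl u (conj u0 ul).
apply: cvg_ext => n /=.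
by rewrite /GRing.scale /= mulr1 mulrC (addrC x).
Qed.

Lemma harmonic_neq0 n : n.+1%:R^-1 != 0 :> R.
Proof. by rewrite invr_neq0// pnatr_eq0. Qed.

(** Up to squaring and a factor 2, the symbol is the difference quotient at 0 of
    $h\mapsto\sin(h\xi/2)$, whose derivative there is $\xi/2$. *)
Lemma diff2_symbol_cvg xi :
  (fun n : nat => diff2_symbol n.+1%:R^-1 xi) @ \oo --> - (xi ^+ 2).
Proof.
have := derive_seq (der_sinM (xi / 2) 0) harmonic_neq0 (@cvg_harmonic R).
rewrite mulr0 cos0 mul1r sin0 => l.
rewrite (_ : - (xi ^+ 2) = - (2 * (xi / 2)) ^+ 2); last first.
  by rewrite mulrC divfK.
apply: cvgN; rewrite expr2; under eq_fun do rewrite expr2.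
have l2 : (fun n : nat => 2 * sin (n.+1%:R^-1 * (xi / 2)) / n.+1%:R^-1) @ \oo -->
    2 * (xi / 2).
  apply: (@cvg_ext _ _ _ (fun n : nat => 2 * ((sin (xi / 2 * (0 + n.+1%:R^-1)) - 0) / n.+1%:R^-1))).
    by move=> n; rewrite add0r subr0 (mulrC (xi / 2)) mulrA.
  by apply: cvgM; [exact: cvg_cst|exact: l].
by apply: cvgM; exact: l2.
Qed.

Lemma diff2_cvg x : (fun n : nat => diff2 n.+1%:R^-1 f x) @ \oo --> (2 * pi)^-1 *
  ift (fun xi => - (xi ^+ 2 * a xi)) (fun xi => - (xi ^+ 2 * b xi)) x.
Proof.
under eq_fun do rewrite diff2_reg ?harmonic_neq0//.
apply: cvgM; first exact: cvg_cst.
have [_ _ ixa2 _] := ra; have [_ _ ixb2 _] := rb.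
apply: (@dct _ _ _ (fun xi => `|xi ^+ 2 * a xi| + `|xi ^+ 2 * b xi|) _ _ _ _).2.
- by move=> n; apply: L1_meas; apply: L1_ift; apply: L1_symbol => //; exact: harmonic_neq0.
- by apply: L1D; exact: L1_abs.
- move=> xi.
  have c (t : R) : (fun n : nat => diff2_symbol n.+1%:R^-1 xi * t) @ \oo -->
      - (xi ^+ 2 * t).
    by rewrite -mulNr; apply: cvgM; [exact: diff2_symbol_cvg|exact: cvg_cst].
  by apply: cvgB; apply: cvgM; (exact: c || exact: cvg_cst).
- move=> n xi.
  apply: (le_trans (ift_integrand_le (fun xi => diff2_symbol n.+1%:R^-1 xi * a xi)
    (fun xi => diff2_symbol n.+1%:R^-1 xi * b xi) x xi)).
  by apply: lerD; exact: diff2_symbol_mul_le.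
Qed.

Lemma L1_window_indic n : L1 (\1_(window n) : R -> R).
Proof. exact: integrable_indic_itv. Qed.

(* Fatou: the second difference quotients are bounded in L2. *)
Lemma L2_derive2 : L2 (fun x => (2 * pi)^-1 *
  ift (fun xi => - (xi ^+ 2 * a xi)) (fun xi => - (xi ^+ 2 * b xi)) x).
Proof.
set g := fun x => _.
have [_ _ ixa2 _] := ra; have [_ _ ixb2 _] := rb.
have p0 := inv_twopi_ge0.
pose M := (2 * pi)^-1 * intR (fun xi => `|- (xi ^+ 2 * a xi)| + `|- (xi ^+ 2 * b xi)|).
have mg : measurable_fun setT g.
  by apply: measurable_funM => //; exact: ift_meas.
have gM x : `|g x| <= M.
  by rewrite normrM (ger0_norm p0) ler_wpM2l//; exact: ift_le.
have dM_ n x : `|diff2 n.+1%:R^-1 f x| <= M.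
  rewrite diff2_reg ?harmonic_neq0// normrM (ger0_norm p0) ler_wpM2l//.
  have is_ := L1_symbol (harmonic_neq0 n).
  apply: (le_trans (ift_le x (is_ _ ia) (is_ _ ib))).
  apply: le_intR.
  - by apply: L1D; apply: L1_abs; apply: is_.
  - by apply: L1D; exact: L1_abs.
  by move=> xi; apply: lerD; rewrite normrN; exact: diff2_symbol_mul_le.
split => //.
pose C := (2 * pi)^-1 * intR (fun xi => (xi ^+ 2 * a xi) ^+ 2 + (xi ^+ 2 * b xi) ^+ 2).
have sqM t : `|t| <= M -> `|t ^+ 2| <= M ^+ 2.
  move=> tM; rewrite normrX lerXn2r ?nnegrE//.
  by apply: le_trans tM.
apply: (@L1_exhaust _ _ C) => [|x|n]; [exact: measurable_funX|exact: sqr_ge0|].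
have iw := L1_window_indic n.
have igw : L1 (fun x => g x ^+ 2 * \1_(window n) x).
  have := L1_bounded iw (measurable_funX 2 mg) (fun x => sqM _ (gM x)).
  by congr L1; apply/funext => x; rewrite mulrC.
have -> : (\int[mu]_(x in window n) (g x ^+ 2)%:E =
    (intR (fun x => g x ^+ 2 * \1_(window n) x))%:E)%E.
  rewrite -EFin_intR// integral_mkcond epatch_indic.
  by apply: eq_integral => x _; rewrite EFinM.
rewrite lee_fin.
(* The quotients are bounded by the same constant [M] as [g], so on one window dominated convergence
   applies; the resulting bound [C] is independent of the window. *)
have [|||k x|_ l] := @dct R (fun k x => diff2 k.+1%:R^-1 f x ^+ 2 * \1_(window n) x)
    (fun x => g x ^+ 2 * \1_(window n) x) (fun x => M ^+ 2 * \1_(window n) x).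
- move=> k; apply: measurable_funM; last exact: L1_meas iw.
  by apply: measurable_funX; case: (L2_diff2 k.+1%:R^-1 hf2).
- exact: L1Z.
- move=> x; apply: cvgM; last exact: cvg_cst.
  rewrite expr2; under eq_fun do rewrite expr2.
  by apply: cvgM; exact: diff2_cvg.
- rewrite normrM (ger0_norm (_ : 0 <= \1_(window n) x)) ?ler_wpM2r//.
  exact: sqM.
apply: (cvgr_to_le l); apply: nearW => k.
apply: (le_trans _ (diff2_norm_le (harmonic_neq0 k))).
have [_ i2] := L2_diff2 k.+1%:R^-1 hf2.
apply: le_intR => //; first exact: L1_indic (measurable_window n) i2.
by move=> x; rewrite ler_piMr ?sqr_ge0.
Qed.

Lemma reg_is_derive1 x : is_derive x 1 f (derive1 f x).
Proof. by rewrite reg_derive1E; exact: reg_derive. Qed.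

Lemma reg_is_derive2 x : is_derive x 1 (derive1 f) (derive1n 2 f x).
Proof. by rewrite reg_derive2E; exact: reg_derive2. Qed.

Lemma reg_derive1_cont : continuous (derive1 f).
Proof.
rewrite reg_derive1E => x; apply: cvgM; first exact: cvg_cst.
by apply: ift_cont => //; exact: L1N.
Qed.

Lemma reg_derive2_cont : continuous (derive1n 2 f).
Proof.
rewrite reg_derive2E => x; apply: cvgM; first exact: cvg_cst.
exact: ift_cont.
Qed.

Lemma L2_derive1n2 : L2 (derive1n 2 f).
Proof. by rewrite reg_derive2E; exact: L2_derive2. Qed.

End second_derivative.
End regularity.

(** * Hilbert transform *)

Section sine_integral.
Context {R : realType}.
Notation mu := (@lebesgue_measure R).
Implicit Types (s t x y xi : R).

(** The continuous functions $x/(x^2+1/(n+1))$ converge to the inverse at every point, including 0,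
    where the inverse is 0 by convention. *)
Lemma measurable_invr : measurable_fun setT (fun x : R => x^-1).
Proof.
apply: (@measurable_fun_cvg _ _ _ _ (fun n x => x / (x ^+ 2 + n.+1%:R^-1))) => [n|x _].
  apply: continuous_measurable_fun => x; apply: cvgM; first exact: cvg_id.
  apply: cvgV.
    by rewrite gt_eqF// ltr_wpDl ?sqr_ge0// invr_gt0.
  by apply: cvgD; [exact: exprn_continuous|exact: cvg_cst].
have [->|x0] := eqVneq x 0.
  by rewrite invr0; under eq_fun do rewrite mul0r; exact: cvg_cst.
rewrite (_ : x^-1 = x / (x ^+ 2 + 0)); last by field.
apply: cvgM; first exact: cvg_cst.
apply: cvgV; first by rewrite addr0 expf_neq0.
by apply: cvgD; [exact: cvg_cst|exact: cvg_harmonic].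
Qed.

Let unit_indic : R -> R := \1_(`]0, 1]%classic).

Let L1_unit : L1 unit_indic. Proof. exact: integrable_indic_itv. Qed.

Let unit_ge0 s : 0 <= unit_indic s. Proof. by []. Qed.

(** The sine integral $\int_0^t\frac{\sin x}{x}\,dx$ after the substitution $x=ts$: the domain is
    fixed, so one differentiates under the integral and the sign of [t] needs no separate treatment.
    Likewise [sinc] is $\sin t/t$, extended through 0. *)
Definition Si t := intR (fun s => unit_indic s * (s^-1 * sin (t * s))).
Definition sinc t := intR (fun s => unit_indic s * cos (t * s)).

Let Si_integrand_le t s : `|s^-1 * sin (t * s)| <= `|t|.
Proof.
have [->|s0] := eqVneq s 0; first by rewrite invr0 mul0r normr0.
rewrite normrM normfV mulrC ler_pdivrMr ?normr_gt0// -normrM.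
exact: abs_sin_le.
Qed.

Let L1_Si t : L1 (fun s => unit_indic s * (s^-1 * sin (t * s))).
Proof.
apply: (L1_bounded (M := `|t|)) => //.
by apply: measurable_funM; [exact: measurable_invr|exact: measurable_sinM].
Qed.

Lemma Si_derive t : is_derive t 1 Si (sinc t).
Proof.
apply: (@is_derive_intR R (fun t s => unit_indic s * (s^-1 * sin (t * s)))
  (fun t s => unit_indic s * cos (t * s)) unit_indic) => //.
- move=> x s; rewrite normrM ger0_norm// ler_piMr//; exact: cos_max.
- move=> s x; have [s0|s0] := eqVneq s 0.
    rewrite (_ : unit_indic s = 0); last first.
      by rewrite /unit_indic indicE memNset// s0 /= in_itv /= ltxx.
    by rewrite mul0r; under eq_fun do rewrite mul0r; exact: derC.
  apply: derZ; apply: der_eq.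
  by rewrite /GRing.scale /=; field.
Qed.

Lemma intR_unit : intR unit_indic = 1.
Proof.
rewrite /intR /Rintegral integral_indic ?setIT//= lebesgue_measure_itv /=.
by rewrite lte_fin ltr01 -EFinB subr0.
Qed.

Lemma sinc_le1 t : `|sinc t| <= 1.
Proof.
rewrite -intR_unit; apply: abs_intR_le => //.
  by apply: measurable_funM; [exact: L1_meas L1_unit|exact: measurable_cosM].
by move=> s; rewrite normrM ger0_norm// ler_piMr//; exact: cos_max.
Qed.

Lemma sincE t : t != 0 -> sinc t = sin t / t.
Proof.
move=> t0; rewrite /sinc; under eq_intR do rewrite mulrC.
rewrite -intR_indic Rintegral_itv_obnd_cbnd; last first.
  have h : mu.-integrable `[0, 1] (EFin \o (fun x => cos (t * x))).
    apply: continuous_compact_integrable; first exact: segment_compact.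
    by apply: continuous_subspaceT => x; exact: der_continuous (der_cosM _ _).
  by apply: integrableS h => //; exact: subset_itv_oc_cc.
rewrite (_ : sin t / t = t^-1 * sin (t * 1) - t^-1 * sin (t * 0)); last first.
  by rewrite mulr1 mulr0 sin0 mulr0 subr0 mulrC.
apply: (@Rftc _ (fun s => t^-1 * sin (t * s))) => // x _.
  by apply: der_eq (derZ _ (der_sinM _ _)) _; field.
exact: der_continuous (der_cosM _ _).
Qed.

Lemma SiN t : Si (- t) = - Si t.
Proof.
rewrite /Si -intRN//; apply: eq_intR => s.
by rewrite mulNr sinN !mulrN.
Qed.

Lemma Si0 : Si 0 = 0.
Proof.
rewrite /Si (_ : (fun s => _) = fun=> 0) ?intR0//.
by apply/funext => s; rewrite mul0r sin0 !mulr0.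
Qed.

Lemma Si_le t : `|Si t| <= `|t|.
Proof.
by have := mvt_abs Si_derive sinc_le1 t 0; rewrite Si0 !subr0 mul1r.
Qed.

(* Integration by parts: Si x + cos x / x has derivative - cos x / x^2. *)
Lemma Si_tail t s : 1 <= t -> t <= s -> `|Si t - Si s| <= 3 / t.
Proof.
move=> t1 ts; have t0 : 0 < t by lra.
have s0 : 0 < s by lra.
pose B x := Si x + cos x * x^-1.
have dV x : 0 < x -> is_derive x 1 (fun x => x^-1) (- x ^- 2).
  move=> x0; have := @is_deriveV R id x 1 1; rewrite gt_eqF//= => /(_ isT _).
  by rewrite /GRing.scale /= mulr1; apply; exact: is_derive_id.
have dB_ x : 0 < x -> is_derive x 1 B (- (cos x * x ^- 2)).
  move=> x0; apply: der_eq (derD (Si_derive x) (derM (is_derive_cos x) (dV x x0))) _.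
  by rewrite sincE ?gt_eqF//; ring.
(* Adding $1/x$ to [B] makes the derivative $-(1+\cos x)/x^2\le0$, subtracting it makes it $(1-\cos
   x)/x^2\ge0$; together they bound the variation of [B] by $1/t-1/s$. *)
have h1 : B s + s^-1 <= B t + t^-1.
  rewrite -lerN2.
  apply: (@mvt_le _ (fun x => - (B x + x^-1)) (fun x => cos x * x ^- 2 + x ^- 2) t s ts).
    move=> x /andP[tx xs]; have x0 : 0 < x by lra.
    have := derB (derC 0 x) (derD (dB_ x x0) (dV x x0)).
    rewrite sub0r (_ : (fun y : R => 0 - (B y + y^-1)) = fun y => - (B y + y^-1)).
      by move=> h; apply: der_eq h _; ring.
    by apply/funext => y; rewrite sub0r.
  move=> x _; rewrite -[X in _ + X]mul1r -mulrDl mulr_ge0 ?invr_ge0 ?sqr_ge0//.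
have h2 : B t - t^-1 <= B s - s^-1.
  apply: (@mvt_le _ (fun x => B x - x^-1) (fun x => x ^- 2 - cos x * x ^- 2) t s ts).
    move=> x /andP[tx xs]; have x0 : 0 < x by lra.
    by apply: der_eq (derB (dB_ x x0) (dV x x0)) _; ring.
  move=> x _; rewrite -[X in X - _]mul1r -mulrBl mulr_ge0 ?invr_ge0 ?sqr_ge0//.
have ts' : s^-1 <= t^-1 by rewrite lef_pV2 ?posrE.
have s0' : 0 < s^-1 by rewrite invr_gt0.
have c x : 0 < x -> `|cos x * x^-1| <= x^-1.
  move=> x0; rewrite normrM normfV (gtr0_norm x0).
  by rewrite ler_piMl ?cos_max// invr_ge0 ltW.
have := c t t0; have := c s s0; rewrite !ler_norml => /andP[? ?] /andP[? ?].
have -> : 3 / t = t^-1 + t^-1 + t^-1 by ring.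
by rewrite /B in h1 h2; apply/andP; split; lra.
Qed.

(** The 4 is 1 from [Si 1] plus 3 from the tail starting at 1. *)
Lemma Si_bounded t : `|Si t| <= 4.
Proof.
wlog t0 : t / 0 <= t.
  move=> h; case: (leP 0 t) => [|/ltW t0]; first exact: h.
  by rewrite -normrN -SiN; apply: h; lra.
case: (leP t 1) => t1.
  by apply: (le_trans (Si_le t)); rewrite ger0_norm//; lra.
have := Si_tail (lexx 1) (ltW t1); have := Si_le 1; rewrite normr1 divr1.
rewrite !ler_norml => /andP[? ?] /andP[? ?]; apply/andP; split; lra.
Qed.

(** The tail estimate makes the values at the integers a Cauchy sequence, and passes to the limit in
    its second endpoint. *)
Lemma Si_lim : exists L : R, forall t, 1 <= t -> `|Si t - L| <= 3 / t.
Proof.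
pose u (n : nat) := Si n.+1%:R.
have n1 (n : nat) : 1 <= n.+1%:R :> R by rewrite ler1n.
have cu : cvgn u.
  apply: cauchy_cvg; apply: cauchy_exP => e e0.
  near \oo => N.
  exists (u N).
  suff : \forall n \near \oo, `|u N - u n| < e by [].
  near=> n.
  have Nn : N.+1%:R <= n.+1%:R :> R by rewrite ler_nat; near: n; exact: nbhs_infty_ge.
  apply: (le_lt_trans (Si_tail (n1 N) Nn)).
  near: N.
  have : (fun n : nat => 3 / n.+1%:R : R) @ \oo --> (3 * 0 : R).
    by apply: cvgM; [exact: cvg_cst|exact: cvg_harmonic].
  rewrite mulr0 => /cvgr0Pnorm_lt /(_ _ e0); apply: filterS => m.
  by apply: le_lt_trans; exact: ler_norm.
exists (lim (u @ \oo)) => t t1.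
have l : (fun n => `|Si t - u n|) @ \oo --> `|Si t - lim (u @ \oo)|.
  by apply: cvg_norm; apply: cvgB; [exact: cvg_cst|exact: cu].
apply: (cvgr_to_le l); near=> n; apply: Si_tail => //.
by near: n; apply: filterS (nbhs_infty_ger t) => n /le_trans; apply; rewrite ler_nat.
Unshelve. all: by end_near. Qed.

Lemma Si_cvg : exists L : R, forall xi, 0 < xi ->
  (fun n : nat => Si (n%:R * xi)) @ \oo --> L.
Proof.
have [L hL] := Si_lim; exists L => xi xi0.
apply/cvgrPdist_le => e e0; near=> n.
have n1 : 1 <= n%:R * xi.
  rewrite -ler_pdivrMr// div1r; near: n; exact: nbhs_infty_ger.
rewrite distrC; apply: (le_trans (hL _ n1)).
rewrite ler_pdivrMr; last by apply: lt_le_trans n1.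
rewrite mulrCA -ler_pdivrMr; last by rewrite mulr_gt0.
by near: n; exact: nbhs_infty_ger.
Unshelve. all: by end_near. Qed.

End sine_integral.

(** * Truncated kernels and the multiplier of the Hilbert transform *)

Section hilbert_transform.
Context {R : realType}.
Notation mu := (@lebesgue_measure R).
Implicit Types (f g a b qa qb : R -> R) (s t x y xi e : R).

Definition outside e : set R := [set y | e < `|y|].

Lemma measurable_outside e : measurable (outside e).
Proof.
rewrite (_ : outside e = (fun y => `|y|) @^-1` `]e, +oo[%classic); last first.
  by apply/seteqP; split => y /=; rewrite in_itv /= andbT.
rewrite -[X in measurable X]setTI.
exact: (@normr_measurable R setT).
Qed.

(** Cut at both ends, $1/y$ is integrable and Fubini applies against a Fourier integral. The outer
    cut is removed first, at fixed [e], because $1/y$ outside a neighbourhood of 0 is in $L^2$; the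
    inner one afterwards. *)
Definition kern e (n : nat) y : R := \1_(window n) y * (\1_(outside e) y * y^-1).

Lemma outside_inv_le e y : 0 < e -> `|\1_(outside e) y * y^-1| <= e^-1.
Proof.
move=> e0; rewrite indicE; have [ey|ey] := boolP (y \in _).
  rewrite mul1r normfV lef_pV2 ?posrE//.
    by move: ey; rewrite inE => /ltW.
  by move: ey; rewrite inE; apply: lt_trans.
by rewrite mul0r normr0 invr_ge0 ltW.
Qed.

Lemma measurable_outside_inv e : measurable_fun setT (fun y => \1_(outside e) y * y^-1).
Proof.
apply: measurable_funM; last exact: measurable_invr.
exact: (measurable_indicR (measurable_outside e)).
Qed.

Lemma L1_kern e n : 0 < e -> L1 (kern e n).
Proof.
move=> e0; apply: (L1_bounded (M := e^-1)); first exact: L1_window_indic.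
  exact: measurable_outside_inv.
by move=> y; exact: outside_inv_le.
Qed.

(** For $|y|>e$, $y^{-2}\le\frac{1+e^2}{e^2}\cdot\frac1{1+y^2}$, and the Poisson kernel of height 1
    is an integrable majorant of the last factor. *)
Lemma L2_outside_inv e : 0 < e -> L2 (fun y => \1_(outside e) y * y^-1).
Proof.
move=> e0; split; first exact: measurable_outside_inv.
have [i1 _] := intR_poisson_kernel (0 : R) (@ltr01 R).
apply: (L1_le _ (L1Z ((1 + e ^+ 2) / e ^+ 2) i1)).
  by apply: measurable_funX; exact: measurable_outside_inv.
move=> y; rewrite ger0_norm ?sqr_ge0// /poisson_kernel subr0 expr1n mulr1.
have e2 : 0 < e ^+ 2 by rewrite exprn_gt0.
have y2 : 0 <= y ^+ 2 by exact: sqr_ge0.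
rewrite indicE; have [ey|ey] := boolP (y \in _); last first.
  by rewrite mul0r expr0n /= !mulr_ge0// ?invr_ge0 ?addr_ge0// ltW.
rewrite mul1r exprVn.
have ey2 : e ^+ 2 < y ^+ 2.
  rewrite -[ltRHS]real_normK ?num_real// ltr_sqr ?nnegrE ?(ltW e0)//.
  by move: ey; rewrite inE.
rewrite -[leLHS]mul1r ler_pdivrMr; last by lra.
rewrite (_ : _ * y ^+ 2 = 2 * (((1 + e ^+ 2) * y ^+ 2) / (e ^+ 2 * (1 + y ^+ 2)))); last first.
  by field; apply/andP; split; rewrite gt_eqF//; lra.
suff : 1 <= ((1 + e ^+ 2) * y ^+ 2) / (e ^+ 2 * (1 + y ^+ 2)) by lra.
by rewrite ler_pdivlMr; nra.
Qed.

Let half e (n : nat) : R -> R := \1_(`]e, n%:R]%classic).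

(** Splitting into a half-line and its mirror image exposes the parity: the cosine part cancels and
    the sine part doubles. The interval of [half] is open at [e] and closed at [n], as are [outside]
    and [window]. *)
Lemma kern_half e n y : 0 < e ->
  kern e n y = half e n y * y^-1 + half e n (- y) * y^-1.
Proof.
move=> e0; rewrite /kern mulrA -mulrDl; congr (_ * _).
have ow : (y \in outside e) = (e < `|y|) by apply/idP/idP; rewrite inE.
rewrite /half !indicE ow /window !mem_setE !in_itv /= -natrM -natrD; congr (_%:R).
have n0 : 0 <= n%:R :> R by [].
case: (leP 0 y) => y0.
  rewrite (ger0_norm y0) (_ : - n%:R <= y = true) /=; last by lra.
  rewrite (_ : e < - y = false) /= ?addn0; last by apply/negbTE; rewrite -leNgt; lra.
  by rewrite andbC; case: (_ < _); case: (_ <= _).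
rewrite (ltr0_norm y0) (_ : e < y = false) /=; last by apply/negbTE; rewrite -leNgt; lra.
rewrite (_ : y <= n%:R = true) ?andbT; last by lra.
by rewrite lerNl add0n; case: (_ < _); case: (_ <= _).
Qed.

Let L1_half e n (q : R -> R) : 0 < e -> measurable_fun setT q -> (forall y, `|q y| <= 1) ->
  L1 (fun y => half e n y * (y^-1 * q y)).
Proof.
move=> e0 mq q1.
have i : L1 (half e n) by exact: integrable_indic_itv.
have : L1 (fun y => half e n y * (\1_(outside e) y * y^-1 * q y)).
  apply: (L1_bounded (M := e^-1)) => //.
    by apply: measurable_funM => //; exact: measurable_outside_inv.
  move=> y; rewrite normrM; apply: le_trans (outside_inv_le y e0).
  by rewrite ler_piMr.
congr L1; apply/funext => y; rewrite !mulrA; congr (_ * _ * _).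
rewrite /half !indicE mem_setE in_itv /=.
case: (ltP e y) => ey /=; last by rewrite !mul0r.
by rewrite [y \in outside e]mem_set ?mulr1// /outside /= gtr0_norm// (lt_trans e0).
Qed.

Let measurable_cosr xi : measurable_fun setT (fun y => cos (y * xi)).
Proof. by under eq_fun do rewrite mulrC; exact: measurable_cosM. Qed.

Let measurable_sinr xi : measurable_fun setT (fun y => sin (y * xi)).
Proof. by under eq_fun do rewrite mulrC; exact: measurable_sinM. Qed.

Lemma derMr (c : R) x : is_derive x 1 (fun y => y * c) c.
Proof. by apply: der_eq (derM (derI _) (derC _ _)) _; ring. Qed.

Lemma intR_kern_cos e n xi : 0 < e -> intR (fun y => kern e n y * cos (y * xi)) = 0.
Proof.
move=> e0; have i := L1_half n e0 (measurable_cosr xi) (fun y => cos_max _).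
rewrite (_ : (fun y => _) = fun y => half e n y * (y^-1 * cos (y * xi)) -
    half e n (0 - y) * ((0 - y)^-1 * cos ((0 - y) * xi))); last first.
  apply/funext => y; rewrite kern_half// sub0r invrN (mulNr y xi) cosN; ring.
rewrite intRB//; last exact: (L1_reflect 0 i).
by rewrite (intR_reflect 0 i) subrr.
Qed.

(** The integrand is even, and $y\mapsto\mathrm{Si}(y\xi)$ is an antiderivative of $\sin(y\xi)/y$ on
    the positive half-line. *)
Lemma intR_kern_sin e n xi : 0 < e -> e <= n%:R ->
  intR (fun y => kern e n y * sin (y * xi)) = 2 * (Si (n%:R * xi) - Si (e * xi)).
Proof.
move=> e0 en; have i := L1_half n e0 (measurable_sinr xi) (fun y => sin_max _).
rewrite (_ : (fun y => _) = fun y => half e n y * (y^-1 * sin (y * xi)) +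
    half e n (0 - y) * ((0 - y)^-1 * sin ((0 - y) * xi))); last first.
  apply/funext => y; rewrite kern_half// sub0r invrN (mulNr y xi) sinN; ring.
rewrite intRD//; last exact: (L1_reflect 0 i).
rewrite (intR_reflect 0 i) mulr_natl mulr2n.
suff -> : intR (fun y => half e n y * (y^-1 * sin (y * xi))) =
  Si (n%:R * xi) - Si (e * xi) by [].
have cont x : e <= x <= n%:R -> {for x, continuous (fun y => y^-1 * sin (y * xi))}.
  move=> /andP[ex _]; apply: cvgM.
    by apply: cvgV; [rewrite gt_eqF//; lra|exact: cvg_id].
  apply: (@der_continuous _ (fun y => sin (y * xi)) x (cos (x * xi) * xi)).
  exact: (@der_comp _ sin _ x _ _ (is_derive_sin _) (derMr xi x)).
under eq_intR do rewrite mulrC.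
rewrite -intR_indic Rintegral_itv_obnd_cbnd; last first.
  have h : mu.-integrable `[e, n%:R] (EFin \o (fun y => y^-1 * sin (y * xi))).
    apply: continuous_compact_integrable; first exact: segment_compact.
    apply: continuous_in_subspaceT => x /[!inE] /=; rewrite in_itv /=; exact: cont.
  by apply: integrableS h => //; exact: subset_itv_oc_cc.
apply: (@Rftc _ (fun y => Si (y * xi))) => // x /andP[ex xn].
have x0 : x != 0 by rewrite gt_eqF//; lra.
apply: der_eq (@der_comp _ Si _ x _ _ (Si_derive _) (derMr xi x)) _.
have [->|xi0] := eqVneq xi 0; first by rewrite !mulr0 sin0 mulr0.
by rewrite sincE ?mulf_neq0//; field; apply/andP.
Qed.

Lemma Si_meas c : measurable_fun setT (fun xi => Si (c * xi)).
Proof.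
apply: continuous_measurable_fun => xi; apply: (@der_continuous _ _ _ (sinc (c * xi) * c)).
exact: (@der_comp _ Si _ xi _ _ (Si_derive _) (derMl c xi)).
Qed.

Lemma kern_symbol_meas e n :
  measurable_fun setT (fun xi => 2 * (Si (n%:R * xi) - Si (e * xi))).
Proof. by apply: measurable_funM => //; apply: measurable_funB; exact: Si_meas. Qed.

Lemma kern_symbol_le e n xi : `|2 * (Si (n%:R * xi) - Si (e * xi))| <= 16.
Proof.
have := Si_bounded (n%:R * xi); have := Si_bounded (e * xi).
by rewrite !ler_norml => /andP[? ?] /andP[? ?]; apply/andP; split; lra.
Qed.

(** With $\sigma=2(\mathrm{Si}(n\xi)-\mathrm{Si}(e\xi))$, the new pair is $(q_a+iq_b)(-i\sigma)$:
    expanding cosine and sine of $(x-y)\xi$, only the terms odd in $y$ survive against the odd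
    kernel. *)
Lemma kern_pairing e n qa qb x : 0 < e -> e <= n%:R -> L1 qa -> L1 qb ->
  intR (fun y => kern e n y * ift qa qb (x - y)) =
  ift (fun xi => qb xi * (2 * (Si (n%:R * xi) - Si (e * xi))))
      (fun xi => - (qa xi * (2 * (Si (n%:R * xi) - Si (e * xi))))) x.
Proof.
move=> e0 en ia ib; have ik := L1_kern n e0.
have mk (h : R -> R) : continuous h ->
    measurable_fun setT (fun p : R * R => h ((x - p.1) * p.2)).
  move=> ch; apply: (measurableT_comp (f := h)).
    exact: continuous_measurable_fun.
  by apply: measurable_funM => //; exact: measurable_funB.
have mc := mk _ (@continuous_cos R); have ms := mk _ (@continuous_sin R).
have kc xi : L1 (fun y => kern e n y * cos (y * xi)).
  by apply: (L1_bounded (M := 1)) => // y; exact: cos_max.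
have ks xi : L1 (fun y => kern e n y * sin (y * xi)).
  by apply: (L1_bounded (M := 1)) => // y; exact: sin_max.
have ec xi : intR (fun y => kern e n y * cos ((x - y) * xi)) =
    sin (x * xi) * (2 * (Si (n%:R * xi) - Si (e * xi))).
  rewrite -(intR_kern_sin xi e0 en).
  rewrite -[RHS]add0r -(mulr0 (cos (x * xi))) -(intR_kern_cos n xi e0).
  rewrite -intRZ// -intRZ// -intRD; [|exact: L1Z|exact: L1Z].
  by apply: eq_intR => y; rewrite mulrBl cosB; ring.
have es xi : intR (fun y => kern e n y * sin ((x - y) * xi)) =
    - (cos (x * xi) * (2 * (Si (n%:R * xi) - Si (e * xi)))).
  rewrite -(intR_kern_sin xi e0 en).
  rewrite -[RHS]add0r -(mulr0 (sin (x * xi))) -(intR_kern_cos n xi e0).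
  rewrite -intRZ// -intRZ// -intRB; [|exact: L1Z|exact: L1Z].
  by apply: eq_intR => y; rewrite mulrBl sinB; ring.
have bd (q h : R -> R) : L1 q -> continuous h -> (forall y, `|h y| <= 1) ->
    L1 (fun y => kern e n y * intR (fun xi => q xi * h ((x - y) * xi))).
  move=> iq ch h1.
  have lin c : continuous (fun xi => c * xi : R).
    by move=> xi; exact: der_continuous (derMl c xi).
  have mh c : measurable_fun setT (fun xi => h (c * xi)).
    apply: continuous_measurable_fun => xi.
    exact: (@continuous_comp _ _ _ (fun xi => c * xi) h _ (lin c xi) (ch _)).
  apply: (L1_bounded (M := intR (fun xi => `|q xi|))) => //.
    apply: continuous_measurable_fun; apply: (@continuous_intR _ _ (fun xi => `|q xi|)).
    - by move=> y; apply: measurable_funM => //; exact: L1_meas.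
    - exact: L1_abs.
    - by move=> y xi; rewrite normrM ler_piMr.
    - move=> xi y; apply: cvgM; first exact: cvg_cst.
      apply: (@continuous_comp _ _ _ (fun y => (x - y) * xi) h) => //.
        apply: cvgM; last exact: cvg_cst.
        by apply: cvgB; [exact: cvg_cst|exact: cvg_id].
      exact: ch.
  move=> y; apply: abs_intR_le.
  - by apply: measurable_funM => //; exact: L1_meas.
  - exact: L1_abs.
  - by move=> xi; rewrite normrM ler_piMr.
transitivity (intR (fun y => kern e n y * intR (fun xi => qa xi * cos ((x - y) * xi))) -
  intR (fun y => kern e n y * intR (fun xi => qb xi * sin ((x - y) * xi)))).
  rewrite -intRB.
  - by apply: eq_intR => y; rewrite ift_split// mulrBr.
  - by apply: bd => //; [exact: continuous_cos|move=> y; exact: cos_max].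
  - by apply: bd => //; [exact: continuous_sin|move=> y; exact: sin_max].
rewrite (fubini_bounded (k := fun p => cos ((x - p.1) * p.2)) (M := 1) ik ia mc);
  last by move=> p; exact: cos_max.
rewrite (fubini_bounded (k := fun p => sin ((x - p.1) * p.2)) (M := 1) ik ib ms);
  last by move=> p; exact: sin_max.
under [X in X - _ = _]eq_intR do rewrite /= ec mulrCA mulrC.
under [X in _ - X = _]eq_intR do rewrite /= es mulrN mulrCA mulrC -mulNr.
have ias : L1 (fun xi => qa xi * (2 * (Si (n%:R * xi) - Si (e * xi)))).
  by apply: (L1_bounded ia (kern_symbol_meas e n)); exact: kern_symbol_le.
have ibs : L1 (fun xi => qb xi * (2 * (Si (n%:R * xi) - Si (e * xi)))).
  by apply: (L1_bounded ib (kern_symbol_meas e n)); exact: kern_symbol_le.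
rewrite -intRB.
- by apply: eq_intR => xi; ring.
- exact: L1_sin.
- by apply: L1_cos; exact: L1N.
Qed.

Lemma outside_cvg e qa qb x : 0 < e -> L1 qa -> L1 qb -> L2 (ift qa qb) ->
  (fun n => intR (fun y => kern e n y * ift qa qb (x - y))) @ \oo -->
  \int[mu]_(y in outside e) (ift qa qb (x - y) / y).
Proof.
move=> e0 ia ib hi.
have i : L1 (fun y => ift qa qb (x - y) * (\1_(outside e) y * y^-1)).
  by apply: L2_mul; [exact: L2_reflect|exact: L2_outside_inv].
rewrite intR_indic.
rewrite (_ : intR _ = intR (fun y => ift qa qb (x - y) * (\1_(outside e) y * y^-1))).
  apply: cvg_ext (intR_window i) => n.
  by rewrite intR_indic; apply: eq_intR => y; rewrite /kern; ring.
by apply: eq_intR => y; ring.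
Qed.

Lemma measurable_sg : measurable_fun setT (fun xi : R => Num.sg xi).
Proof.
rewrite (_ : (fun xi : R => Num.sg xi) = fun xi => xi * `|xi|^-1).
  apply: measurable_funM => //; apply: (measurableT_comp measurable_invr).
  exact: (@normr_measurable R setT).
apply/funext => xi; have [->|xi0] := eqVneq xi 0; first by rewrite sgr0 mul0r.
by rewrite [X in X * _]numEsg mulfK ?normr_eq0.
Qed.

Lemma ift_symbol_cvg (S_ : nat -> R -> R) (S : R -> R) (M : R) qa qb x :
  L1 qa -> L1 qb -> (forall n, measurable_fun setT (S_ n)) ->
  (forall n xi, `|S_ n xi| <= M) -> (forall xi, S_ ^~ xi @ \oo --> S xi) ->
  (fun n => ift (fun xi => qb xi * S_ n xi) (fun xi => - (qa xi * S_ n xi)) x) @ \oo -->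
  ift (fun xi => qb xi * S xi) (fun xi => - (qa xi * S xi)) x.
Proof.
move=> ia ib mS SM SS.
apply: (@dct _ _ _ (fun xi => `|qb xi| * M + `|qa xi| * M) _ _ _ _).2.
- move=> n; apply: L1_meas; apply: L1_ift.
    by apply: (L1_bounded (M := M)).
  by apply: L1N; apply: (L1_bounded (M := M)).
- apply: L1D.
    by have := L1Z M (L1_abs ib); congr L1; apply/funext => xi; rewrite mulrC.
  by have := L1Z M (L1_abs ia); congr L1; apply/funext => xi; rewrite mulrC.
- move=> xi; apply: cvgB; apply: cvgM; try exact: cvg_cst.
    by apply: cvgM; [exact: cvg_cst|exact: SS].
  by apply: cvgN; apply: cvgM; [exact: cvg_cst|exact: SS].
- move=> n xi.
  apply: (le_trans (ift_integrand_le (fun xi => qb xi * S_ n xi)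
    (fun xi => - (qa xi * S_ n xi)) x xi)).
  by rewrite normrN !normrM lerD// ler_wpM2l.
Qed.

(* L is the Dirichlet integral pi / 2; only its being real matters here. *)
Lemma hilbert_symbol : exists L : R, forall qa qb x, L1 qa -> L1 qb ->
  L2 (ift qa qb) ->
  (fun e => \int[mu]_(y in outside e) (ift qa qb (x - y) / y)) @ 0^'+ -->
  ift (fun xi => qb xi * (2 * (L * Num.sg xi)))
      (fun xi => - (qa xi * (2 * (L * Num.sg xi)))) x.
Proof.
have [L hL] := @Si_cvg R; exists L => qa qb x ia ib hi.
have lim_n xi : (fun n : nat => Si (n%:R * xi)) @ \oo --> L * Num.sg xi.
  have [xi0|xi0|->] := ltgtP xi 0.
  - rewrite ltr0_sg// mulrN1.
    apply: (@cvg_ext _ _ _ (fun n : nat => - Si (n%:R * (- xi)))).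
      by move=> n; rewrite mulrN SiN opprK.
    by apply: cvgN; apply: hL; lra.
  - by rewrite gtr0_sg// mulr1; exact: hL.
  - by rewrite sgr0 mulr0; under eq_fun do rewrite mulr0 Si0; exact: cvg_cst.
have sg_le xi : `|2 * (L * Num.sg xi)| <= 2 * `|L|.
  rewrite !normrM (@ger0_norm _ 2)// ler_wpM2l// ler_piMr// normr_sg.
  by case: (_ == _).
have msg : measurable_fun setT (fun xi => 2 * (L * Num.sg xi)).
  by do 2 apply: measurable_funM => //; exact: measurable_sg.
(* The multiplier left once the outer cut is gone. As [e] tends to 0 its second term disappears,
   since [Si] is continuous and vanishes at 0. *)
pose S e xi := 2 * (L * Num.sg xi - Si (e * xi)).
have eE e : 0 < e -> \int[mu]_(y in outside e) (ift qa qb (x - y) / y) =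
    ift (fun xi => qb xi * S e xi) (fun xi => - (qa xi * S e xi)) x.
  move=> e0; have l1 := @outside_cvg e qa qb x e0 ia ib hi.
  have l2 := @ift_symbol_cvg (fun n xi => 2 * (Si (n%:R * xi) - Si (e * xi)))
    (S e) 16 qa qb x ia ib (kern_symbol_meas e) (kern_symbol_le e) _.
  apply: (cvg_unique _ l1) => //.
  apply: cvg_trans (l2 _).
    apply: near_eq_cvg; near=> n; rewrite kern_pairing//.
    by near: n; exact: nbhs_infty_ger.
  move=> xi; apply: cvgM; first exact: cvg_cst.
  by apply: cvgB; [exact: lim_n|exact: cvg_cst].
(* Passing to sequences makes dominated convergence available; the bound $2|L|+8$ adds the sign term
   and twice the bound 4 on [Si]. *)
apply/cvg_at_rightP => u [u0 ul].
apply: (@cvg_ext _ _ _ (fun n => ift (fun xi => qb xi * S (u n) xi)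
   (fun xi => - (qa xi * S (u n) xi)) x)); first by move=> n; rewrite eE.
apply: (@ift_symbol_cvg _ _ (2 * `|L| + 8)) => //.
- by move=> n; apply: measurable_funM => //; apply: measurable_funB;
    [apply: measurable_funM => //; exact: measurable_sg|exact: Si_meas].
- move=> n xi; rewrite /S mulrBr; apply: (le_trans (ler_normB _ _)).
  apply: lerD => //; rewrite normrM (@ger0_norm _ 2)//.
  by have := Si_bounded (u n * xi); lra.
- move=> xi; rewrite -[X in 2 * X]subr0; apply: cvgM; first exact: cvg_cst.
  apply: cvgB; first exact: cvg_cst.
  rewrite -(@Si0 R).
  apply: (@cvg_comp _ _ _ (fun n => u n * xi) Si _ (nbhs (0 * xi))).
    by apply: cvgM; [exact: ul|exact: cvg_cst].
  by rewrite mul0r; exact: der_continuous (Si_derive _).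
Unshelve. all: by end_near. Qed.

End hilbert_transform.

(** * Unique continuation for the principal value *)

Section unique_continuation.
Context {R : realType}.
Notation mu := (@lebesgue_measure R).

Section moments.
Variables (v i : R -> R) (M : R).
Hypotheses (iv : L1 v) (mi : measurable_fun setT i) (iM : forall z, `|i z| <= M).

Lemma L1_pow (w : R -> R) n : L1 w -> L1 (fun z => w z * i z ^+ n).
Proof.
move=> iw; apply: (L1_bounded (M := M ^+ n)) => //; first exact: measurable_funX.
move=> z; rewrite normrX lerXn2r ?nnegrE//.
by apply: le_trans (iM z).
Qed.

(* The function h |-> intR (v / (1 - h i)) generates the moments of v
   against the powers of i. *)
Lemma moments_eq0 (s : R) : 0 < s -> s * M <= 2^-1 ->
  (forall h : R, `|h| < s -> intR (fun z => v z * (1 - h * i z)^-1) = 0) ->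
  forall k, intR (fun z => v z * i z ^+ k) = 0.
Proof.
move=> s0 sM gen.
have half h z : `|h| < s -> 2^-1 <= 1 - h * i z.
  move=> hs; suff : `|h * i z| <= 2^-1 by rewrite ler_norml => /andP[? ?]; lra.
  rewrite normrM; apply: le_trans sM; apply: ler_pM => //; exact: ltW.
have inv_le h z : `|h| < s -> `|(1 - h * i z)^-1| <= 2.
  move=> /(half _ z) hz; rewrite normfV ger0_norm; last lra.
  by rewrite -[2]invrK lef_pV2 ?posrE//; lra.
have minv h : measurable_fun setT (fun z => (1 - h * i z)^-1).
  apply: (measurableT_comp (@measurable_invr R)).
  by apply: measurable_funB => //; apply: measurable_funM.
have L1k h k : `|h| < s -> L1 (fun z => v z * i z ^+ k * (1 - h * i z)^-1).
  move=> hs; apply: (L1_bounded (M := 2)) => //; first exact: L1_pow.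
  by move=> z; exact: inv_le.
(* One term is split off the geometric series, which trades a factor [h] for one more power of [i].
   The condition [s * M <= 2^-1] keeps the denominators above 1/2. *)
have ident h z : `|h| < s -> (1 - h * i z)^-1 = 1 + h * (i z * (1 - h * i z)^-1).
  by move=> /(half _ z) hz; field; rewrite gt_eqF//; lra.
have step h k : `|h| < s -> intR (fun z => v z * i z ^+ k * (1 - h * i z)^-1) =
    intR (fun z => v z * i z ^+ k) +
    h * intR (fun z => v z * i z ^+ k.+1 * (1 - h * i z)^-1).
  move=> hs; rewrite -intRZ; last exact: L1k.
  rewrite -intRD; [|exact: L1_pow|by apply: L1Z; exact: L1k].
  by apply: eq_intR => z; rewrite {1}ident// exprSr; ring.
have P k : (forall h : R, `|h| < s ->
    intR (fun z => v z * i z ^+ k * (1 - h * i z)^-1) = 0).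
  elim: k => [|k IH] h hs.
    rewrite -[RHS](gen h hs); apply: eq_intR => z; by rewrite expr0 mulr1.
  have m0 : intR (fun z => v z * i z ^+ k) = 0.
    have := IH 0; rewrite normr0 => /(_ s0) <-.
    by apply: eq_intR => z; rewrite mul0r subr0 invr1 mulr1.
  have nz h' : `|h'| < s -> h' != 0 ->
      intR (fun z => v z * i z ^+ k.+1 * (1 - h' * i z)^-1) = 0.
    move=> hs' h0; have := step h' k hs'; rewrite IH// m0 add0r => /esym/eqP.
    by rewrite mulf_eq0 (negbTE h0) /= => /eqP.
  have [h0|] := eqVneq h 0; last exact: nz.
  rewrite h0.
  set m := intR _; set C := intR (fun z => `|v z * i z ^+ k.+2| * 2).
  have iC : L1 (fun z => `|v z * i z ^+ k.+2| * 2).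
    have := L1Z 2 (L1_abs (L1_pow k.+2 iv)).
    by congr L1; apply/funext => z; rewrite mulrC.
  have mE : m = intR (fun z => v z * i z ^+ k.+1).
    by apply: eq_intR => z; rewrite mul0r subr0 invr1 mulr1.
  (* At $h=0$ the factor [h] cannot be divided out. There the integral is the moment [m], and the
     next expansion at a small [t], where the left side is already known to vanish, gives $|m|\le
     tC$; letting [t] shrink gives $m=0$. *)
  have mle t : 0 < t -> t < s -> `|m| <= t * C.
    move=> t0 ts; have ts' : `|t| < s by rewrite gtr0_norm.
    have := step t k.+1 ts'; rewrite nz ?gt_eqF// -mE => /esym/eqP.
    rewrite addr_eq0 => /eqP ->; rewrite normrN normrM (gtr0_norm t0).
    rewrite ler_wpM2l ?(ltW t0)//; apply: abs_intR_le => //.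
      by apply: L1_meas; exact: L1k.
    by move=> z; rewrite normrM ler_wpM2l// inv_le.
  have C0 : 0 <= C by apply: intR_ge0 => z; rewrite mulr_ge0.
  apply/eqP; rewrite -normr_le0 leNgt; apply/negP => m0'.
  pose t := Num.min (s / 2) (`|m| / 2 / (C + 1)).
  have t0 : 0 < t by rewrite lt_min !divr_gt0//; lra.
  have ts : t < s by rewrite gt_min; apply/orP; left; lra.
  have := mle t t0 ts; have : t <= `|m| / 2 / (C + 1) by rewrite ge_min lexx orbT.
  rewrite ler_pdivlMr; last by lra.
  by nra.
move=> k; rewrite -[RHS](P k 0) ?normr0//.
by apply: eq_intR => z; rewrite mul0r subr0 invr1 mulr1.
Qed.

Lemma poly_moments_eq0 : (forall k, intR (fun z => v z * i z ^+ k) = 0) ->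
  forall p : {poly R}, intR (fun z => v z * p.[i z]) = 0.
Proof.
move=> mom p.
suff H n : L1 (fun z => \sum_(k < n) p`_k * (v z * i z ^+ k)) /\
    intR (fun z => \sum_(k < n) p`_k * (v z * i z ^+ k)) = 0.
  rewrite -[RHS](H (size p)).2; apply: eq_intR => z.
  by rewrite horner_coef mulr_sumr; apply: eq_bigr => k _; rewrite mulrCA.
elim: n => [|n [IH1 IH2]].
  under eq_intR do rewrite big_ord0.
  rewrite intR0; split => //.
  rewrite (_ : (fun z => _) = fun=> 0); first exact: L1_0.
  by apply/funext => z; rewrite big_ord0.
have iz := L1Z p`_n (L1_pow n iv).
rewrite (_ : (fun z => _) = fun z => \sum_(k < n) p`_k * (v z * i z ^+ k) +
   p`_n * (v z * i z ^+ n)); last by apply/funext => z; rewrite big_ord_recr.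
split; first exact: L1D.
by rewrite intRD// IH2 intRZ ?mom ?mulr0 ?addr0//; exact: L1_pow.
Qed.

End moments.

Lemma intR_indic_oo (a b : R) : a < b -> intR (\1_(`]a, b[%classic) : R -> R) = b - a.
Proof.
move=> ab; rewrite /intR /Rintegral integral_indic ?setIT//= lebesgue_measure_itv /=.
by rewrite lte_fin ab -EFinB.
Qed.

(* The polynomials (1 - c (t - t1)^2)^n concentrate at t1. *)
Lemma moments_determine (v i : R -> R) (M z1 t1 : R) :
  L1 v -> measurable_fun setT i -> (forall z, `|i z| <= M) -> 0 < M ->
  (forall k, intR (fun z => v z * i z ^+ k) = 0) ->
  i z1 = t1 -> {for z1, continuous i} ->
  (exists2 eta : R, 0 < eta & forall z : R, `|i z - t1| < eta -> `|v z - v z1| <= `|v z1| / 2) ->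
  v z1 = 0.
Proof.
move=> iv mi iM M0 mom it1 ci [eta eta0 near_v].
apply/eqP/negPn/negP => v1.
have v10 : 0 < `|v z1| by rewrite normr_gt0.
pose eta' : R := Num.min eta M.
have eta'0 : 0 < eta' by rewrite lt_min eta0.
have eta'M : eta' <= M by rewrite ge_min lexx orbT.
(* On the range of [i] the distance to [t1] is at most $2M$, so $1-c(t-t1)^2$ stays between 0 and
   1. *)
pose c := (2 * M) ^- 2.
have c0 : 0 < c by rewrite invr_gt0 exprn_gt0// mulr_gt0.
have cM t : `|t| <= M -> 0 <= c * (t - t1) ^+ 2 <= 1.
  move=> tM; rewrite mulr_ge0 ?sqr_ge0 ?(ltW c0)//= /c mulrC ler_pdivrMr ?exprn_gt0 ?mulr_gt0//.
  rewrite mul1r -[leLHS]real_normK ?num_real// lerXn2r ?nnegrE ?mulr_ge0 ?(ltW M0)//.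
  apply: (le_trans (ler_normB _ _)); have := iM z1; rewrite it1; lra.
(* [q] bounds the base of the powers from above where [i z] is at least [eta'] away from [t1], [q']
   from below where it is within [eta' / 2]. As $\eta'\le M$, $c\,\eta'^2\le1/4$ and [q] is
   nonnegative. *)
pose q := 1 - c * eta' ^+ 2; pose q' := 1 - c * (eta' / 2) ^+ 2.
have eta'2 : 0 < eta' ^+ 2 by rewrite exprn_gt0.
have q0 : 0 <= q.
  have : c * eta' ^+ 2 <= c * M ^+ 2 by rewrite ler_wpM2l ?(ltW c0)// lerXn2r ?nnegrE ?(ltW eta'0) ?(ltW M0).
  have -> : c * M ^+ 2 = 4^-1 by rewrite /c; field; rewrite gt_eqF.
  by rewrite /q; lra.
have qq' : q < q'.
  by rewrite /q /q' exprMn exprVn; have : 0 < c * eta' ^+ 2 by [exact: mulr_gt0]; nra.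
have q'0 : 0 < q' by apply: le_lt_trans qq'.
have [d d0 hd] : exists2 d : R, 0 < d & forall z : R, `|z1 - z| < d -> `|i z - t1| < eta' / 2.
  move/cvgrPdist_lt : ci => /(_ _ (divr_gt0 eta'0 (ltr0Sn _ 1))) /nbhs_ballP[d /= d0 h].
  by exists d => // z zd; rewrite distrC -it1; exact: h.
pose B : set R := `](z1 - d), (z1 + d)[%classic.
have iB : L1 (\1_B : R -> R) by exact: integrable_indic_itv.
have eB : intR (\1_B : R -> R) = 2 * d.
  by rewrite /B intR_indic_oo; [ring|lra].
pose s := Num.sg (v z1).
pose m := `|v z1| / 2.
have m0 : 0 < m by rewrite divr_gt0.
pose C := intR (fun z => `|v z|).
(* The vanishing pairing with the polynomial [p] is split. Close to [t1], [v] has the sign [s] and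
   size at least [m], so the interval [B] alone contributes at least the left side; the far part is
   at most the right side in size. Since $q<q'$, this fails for large [n]. *)
have key (n : nat) : m * q' ^+ n * (2 * d) <= q ^+ n * C.
  pose p : {poly R} := s *: (1 - c *: ('X - t1%:P) ^+ 2) ^+ n.
  have pE t : p.[t] = s * (1 - c * (t - t1) ^+ 2) ^+ n.
    by rewrite /p !(hornerE, horner_exp).
  have := poly_moments_eq0 iv mi iM mom p.
  under eq_intR do rewrite pE.
  move=> p0.
  have Pm : measurable_fun setT (fun z => s * (1 - c * (i z - t1) ^+ 2) ^+ n).
    apply: measurable_funM => //; apply: measurable_funX; apply: measurable_funB => //.
    by apply: measurable_funM => //; apply: measurable_funX; exact: measurable_funB.
  have ivP : L1 (fun z => v z * (s * (1 - c * (i z - t1) ^+ 2) ^+ n)).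
    apply: (L1_bounded (M := 1)) => // z.
    have /andP[a1 a2] := cM _ (iM z).
    rewrite normrM normr_sg v1 mul1r normrX exprn_ile1//.
    by rewrite ger0_norm; lra.
  rewrite -subr_le0 -[leRHS]p0 -eB -(intRZ _ iB) -(intRZ _ (L1_abs iv)).
  rewrite -intRB; [|exact: L1Z|by apply: L1Z; exact: L1_abs].
  apply: le_intR => //.
    by apply: L1B; [exact: L1Z|by apply: L1Z; exact: L1_abs].
  move=> z; have /andP[a1 a2] := cM _ (iM z).
  have P0 : 0 <= (1 - c * (i z - t1) ^+ 2) ^+ n by rewrite exprn_ge0//; lra.
  have [far|near_] := leP eta' `|i z - t1|.
    rewrite (_ : \1_B z = 0) ?mulr0 ?sub0r; last first.
      rewrite indicE memNset// /B /= in_itv /= => zd.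
      have : `|z1 - z| < d by rewrite ltr_norml; move: zd => /andP[? ?]; apply/andP; split; lra.
      by move/hd; lra.
    have Pq : (1 - c * (i z - t1) ^+ 2) ^+ n <= q ^+ n.
      rewrite lerXn2r ?nnegrE//; first by lra.
      rewrite /q lerD2l lerN2 ler_wpM2l ?(ltW c0)//.
      by rewrite -[leRHS]real_normK ?num_real// lerXn2r ?nnegrE// ltW.
    have : `|v z * (s * (1 - c * (i z - t1) ^+ 2) ^+ n)| <= q ^+ n * `|v z|.
      rewrite normrM mulrC; apply: ler_pM => //.
      by rewrite normrM normr_sg v1 mul1r ger0_norm.
    by rewrite ler_norml => /andP[].
  have vz : m <= v z * s.
    have := near_v z (lt_le_trans near_ _); rewrite ge_min lexx => /(_ isT).
    rewrite /m /s; have [v_neg|v_pos|v0] := ltgtP (v z1) 0; last by rewrite v0 eqxx in v1.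
      by rewrite (ltr0_norm v_neg) (ltr0_sg v_neg) ler_norml => /andP[? ?]; lra.
    by rewrite (gtr0_norm v_pos) (gtr0_sg v_pos) ler_norml => /andP[? ?]; lra.
  have qv : 0 <= q ^+ n * `|v z| by rewrite mulr_ge0// exprn_ge0.
  apply: (@le_trans _ _ (m * q' ^+ n * \1_B z)); first by lra.
  rewrite mulrA.
  have [zB|zB] := boolP (z \in B); last first.
    rewrite indicE (negbTE zB) mulr0 mulr_ge0//; lra.
  rewrite indicE zB mulr1; apply: ler_pM => //.
  - exact: ltW.
  - by rewrite exprn_ge0// ltW.
  rewrite lerXn2r ?nnegrE//; [exact: ltW|lra|].
  rewrite /q' lerD2l lerN2 ler_wpM2l ?(ltW c0)//.
  have := hd z; move: zB; rewrite inE /B /= in_itv /= => /andP[z1d z2d] /(_ _) h.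
  rewrite -[leLHS]real_normK ?num_real// lerXn2r ?nnegrE//; first by lra.
  by apply/ltW/h; rewrite ltr_norml; apply/andP; split; lra.
have C0 : 0 <= C by exact: intR_ge0.
have lim : (fun n : nat => (q / q') ^+ n * C) @ \oo --> (0 * C).
  apply: cvgM; last exact: cvg_cst.
  by apply: cvg_expr; rewrite ger0_norm ?divr_ge0 ?(ltW q'0)// ltr_pdivrMr ?mul1r.
rewrite mul0r in lim.
have md : 0 < m * (2 * d) by rewrite !mulr_gt0.
move/cvgr0Pnorm_lt : lim => /(_ _ md)[n _ /(_ n (leqnn n))].
rewrite ger0_norm; last by rewrite mulr_ge0// exprn_ge0// divr_ge0// ltW.
have := key n; rewrite expr_div_n mulrAC => k1 k2.
have qn : 0 < q' ^+ n by rewrite exprn_gt0.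
have : q ^+ n * C < m * (2 * d) * q' ^+ n.
  by rewrite -ltr_pdivrMr// mulrAC.
lra.
Qed.


Section principal_value.
Variables (W : R -> R) (x0 d r : R).
Hypotheses (r0 : 0 < r) (rd : r < d) (cW : continuous W) (hW : L2 W).
Hypothesis W0 : forall y, `|y - x0| < d -> W y = 0.
Hypothesis pv0 : forall x, `|x - x0| < d ->
  (fun e : R => \int[mu]_(y in outside e) (W (x - y) / y)) @ 0^'+ --> (0 : R).

(** The inverse is cut off at radius $r<d$ to be bounded by $1/r$; the cut acts only where the
    translate of [W] vanishes. *)
Let i z : R := \1_(outside r) z * z^-1.
Let v z : R := W (z + x0) * i z.

Let iE z : r < `|z| -> i z = z^-1.
Proof. by move=> rz; rewrite /i indicE mem_set// mul1r. Qed.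

Let i0 z : `|z| <= r -> i z = 0.
Proof.
move=> zr; rewrite /i indicE memNset ?mul0r// /outside /=.
by apply/negP; rewrite -leNgt.
Qed.

Let iv : L1 v.
Proof. by apply: L2_mul; [exact: L2_shift|exact: L2_outside_inv]. Qed.

(** With $y=h-z$ one has $1/y=-z^{-1}/(1-h/z)$, so this integral is minus the principal value at
    $x_0+h$. Where [W] is nonzero, $|z|>r$ and $|y|>r/2$, hence a truncation at $e<r/2$ removes
    nothing and the limit in [e] is that of a constant. *)
Let gen (h : R) : `|h| < r / 2 -> intR (fun z => v z * (1 - h * i z)^-1) = 0.
Proof.
move=> hr; have r0' := r0; have rd' := rd.
have r2 : 0 < r / 2 by rewrite divr_gt0.
have half z : 2^-1 <= 1 - h * i z.
  suff : `|h * i z| <= 2^-1 by rewrite ler_norml => /andP[? ?]; lra.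
  rewrite normrM (_ : 2^-1 = r / 2 * r^-1); last by field; rewrite gt_eqF.
  by apply: ler_pM => //; [exact: ltW|exact: outside_inv_le].
have iG : L1 (fun z => v z * (1 - h * i z)^-1).
  apply: (L1_bounded (M := 2)) => //.
    apply: (measurableT_comp (@measurable_invr R)); apply: measurable_funB => //.
    by apply: measurable_funM => //; exact: measurable_outside_inv.
  move=> z; have hz := half z; rewrite normfV ger0_norm; last lra.
  by rewrite -[2]invrK lef_pV2 ?posrE//; lra.
have hx : `|x0 + h - x0| < d.
  by rewrite (_ : x0 + h - x0 = h); [lra|ring].
have E e : 0 < e -> e < r / 2 ->
    - intR (fun z => v z * (1 - h * i z)^-1) =
    \int[mu]_(y in outside e) (W (x0 + h - y) / y).
  move=> e0 er; rewrite intR_indic -(intR_reflect h iG) -intRN; last exact: L1_reflect iG.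
  apply: eq_intR => y; rewrite /v.
  rewrite (_ : h - y + x0 = x0 + h - y); last by ring.
  have [zr|zr] := leP `|h - y| r.
    rewrite (i0 zr) (_ : W _ = 0); first by ring.
    by apply: W0; rewrite (_ : _ - _ - x0 = h - y); [lra|ring].
  have yr : r / 2 < `|y|.
    have := ler_normB h y; lra.
  rewrite (iE zr) indicE mem_set; last by rewrite /outside /=; lra.
  have y0 : y != 0 by rewrite -normr_gt0; lra.
  have z0 : h - y != 0 by rewrite -normr_gt0; lra.
  rewrite (_ : 1 - h * (h - y)^-1 = - y * (h - y)^-1); last by field.
  by rewrite mulr1; field; rewrite z0 y0.
have lim := pv0 hx.
suff : - intR (fun z => v z * (1 - h * i z)^-1) = 0 by move/eqP; rewrite oppr_eq0 => /eqP.
apply: (cvg_unique _ _ lim) => //.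
apply: cvg_near_cst; near=> e; apply/esym/E.
  by near: e; exact: nbhs_right_gt.
by near: e; exact: nbhs_right_lt.
Unshelve. all: by end_near. Qed.

Lemma pv_unique_continuation_aux y : W y = 0.
Proof.
have r0' := r0; have rd' := rd.
pose z1 := y - x0; have [zr|zr] := leP `|z1| r.
  by apply: W0; exact: le_lt_trans rd.
suff : v z1 = 0.
  move/eqP; rewrite /v (iE zr) mulf_eq0 invr_eq0 /z1 subrK => /orP[/eqP //|/eqP z10].
  by move: zr; rewrite /z1 z10 normr0; lra.
have [//|vz1] := eqVneq (v z1) 0.
have z1n0 : z1 != 0 by rewrite -normr_gt0; lra.
have ci : {for z1, continuous i}.
  apply: cvgM; last by apply: cvgV => //; exact: cvg_id.
  rewrite indicE mem_set//; apply: cvg_near_cst.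
  near=> z; rewrite indicE mem_set// /outside /=.
  near: z; apply: (cvgr_gt `|z1|) => //; exact: norm_continuous.
have cv : {for z1, continuous v}.
  apply: cvgM; last exact: ci.
  apply: (@continuous_comp _ _ _ (fun z => z + x0) W); last exact: cW.
  by apply: cvgD; [exact: cvg_id|exact: cvg_cst].
have mi : measurable_fun setT i by exact: measurable_outside_inv.
have iM z : `|i z| <= r^-1 by exact: outside_inv_le.
have rV0 : 0 < r^-1 by rewrite invr_gt0.
have r2 : 0 < r / 2 by rewrite divr_gt0.
have rr : r / 2 * r^-1 <= 2^-1.
  by rewrite (_ : r / 2 * r^-1 = 2^-1)//; field; rewrite gt_eqF.
have mom := moments_eq0 iv mi iM r2 rr gen.
apply: (moments_determine iv mi iM rV0 mom (iE zr) ci).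
have [d1 d10 hd1] : exists2 d1 : R, 0 < d1 &
    forall z, `|z1 - z| < d1 -> `|v z - v z1| <= `|v z1| / 2.
  have h2 : 0 < `|v z1| / 2 by rewrite divr_gt0 ?normr_gt0.
  move/cvgrPdist_le : cv => /(_ _ h2) /nbhs_ballP[d1 /= d10 h].
  by exists d1 => // z zd; rewrite distrC; exact: h.
(* [moments_determine] measures closeness through [i z], and $z=(i z)^{-1}$ off the cut, so
   continuity of inversion at $1/z_1$ converts it. The bound by $|z_1|$ excludes $|z|\le r$: there
   [i z] and its inverse are 0, at distance exactly $|z_1|$ from [z1]. *)
pose d2 : R := Num.min d1 `|z1|.
have d20 : 0 < d2 by rewrite lt_min d10 normr_gt0.
have cV : {for z1^-1, continuous (fun t : R => t^-1)}.
  by apply: cvgV; [rewrite invr_eq0|exact: cvg_id].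
move/cvgrPdist_lt : cV => /(_ _ d20) /nbhs_ballP[eta /= eta0 h].
exists eta => // z zeta.
have := h (i z); rewrite /ball /= distrC => /(_ zeta); rewrite invrK => hz.
have [zr'|zr'] := leP `|z| r.
  by move: hz; rewrite (i0 zr') invr0 subr0 lt_min ltxx andbF.
by apply: hd1; move: hz; rewrite (iE zr') invrK lt_min => /andP[].
Unshelve. all: by end_near. Qed.

End principal_value.

Lemma pv_unique_continuation (W : R -> R) (x0 d : R) : 0 < d -> continuous W ->
  L2 W -> (forall y, `|y - x0| < d -> W y = 0) ->
  (forall x, `|x - x0| < d ->
    (fun e : R => \int[mu]_(y in outside e) (W (x - y) / y)) @ 0^'+ --> (0 : R)) ->
  forall y, W y = 0.
Proof.
move=> d0; apply: (@pv_unique_continuation_aux W x0 d (d / 2)); lra.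
Qed.

End unique_continuation.

(** * Sobolev norms on the Fourier side *)

Section sobolev_bridge.
Context {R : realType}.
Notation mu := (@lebesgue_measure R).
Implicit Types (f a b : R -> R) (g : R -> R[i]) (r k xi : R).

Lemma Lnorm2_pow (D : R -> R) :
  ('N[mu]_2%:E[EFin \o D] `^ 2 = \int[mu]_x ((D x) ^+ 2)%:E)%E.
Proof.
rewrite powR_Lnorm//; apply: eq_integral => x _ /=.
by rewrite powR_mulrn// real_normK ?num_real.
Qed.

Lemma Lnorm2E (D : R -> R) : L2 D ->
  'N[mu]_2%:E[EFin \o D]%E = (Num.sqrt (intR (fun x => D x ^+ 2)))%:E.
Proof.
move=> [mD D2]; have := Lnorm2_pow D; rewrite EFin_intR//.
have := Lnorm_ge0 mu 2%:E (EFin \o D).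
case: ('N[mu]_2%:E[EFin \o D])%E => [n| |] //=.
rewrite lee_fin => n0 [e]; congr EFin.
  by rewrite -e powR_mulrn// sqrtr_sqr ger0_norm.
by rewrite pnatr_eq0.
Qed.

Lemma Lnorm2_lty (D : R -> R) : measurable_fun setT D ->
  ('N[mu]_2%:E[EFin \o D] < +oo)%E -> L2 D.
Proof.
move=> mD h; apply: Lfun_L2; rewrite inE; apply/andP; split; rewrite inE //=.
Qed.

Lemma L2_Lfun f : L2 f -> f \in Lfun mu 2%:E.
Proof.
move=> hf; rewrite inE; apply/andP; split; rewrite inE /=; first by case: hf.
by rewrite /finite_norm Lnorm2E// ltry.
Qed.

Lemma fourier_trunc_normc f n g xi :
  ComplexField.Normc.normc (fourier_trunc f n xi - g xi) =
  Num.sqrt ((cos_trunc f n xi - complex.Re (g xi)) ^+ 2 +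
            (- sin_trunc f n xi - complex.Im (g xi)) ^+ 2).
Proof. by rewrite /fourier_trunc; case: (g xi) => x y. Qed.

Lemma measurable_sqrt f : measurable_fun setT f ->
  measurable_fun setT (fun x : R => Num.sqrt (f x)).
Proof.
move=> mf; have ms : measurable_fun setT (@Num.sqrt R).
  by apply: continuous_measurable_fun; exact: sqrt_continuous.
exact: (measurableT_comp ms mf).
Qed.

Lemma L2_sqrt a b : L2 a -> L2 b -> L2 (fun xi => Num.sqrt (a xi ^+ 2 + b xi ^+ 2)).
Proof.
move=> [ma a2] [mb b2]; split.
  apply: measurable_sqrt.
  by apply: measurable_funD; exact: measurable_funX.
have := L1D a2 b2; congr L1; apply/funext => xi.
by rewrite sqr_sqrtr// addr_ge0 ?sqr_ge0.
Qed.

(** The modulus of the complex error is the square root of the sum of the squared real errors, so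
    its norm tends to 0 exactly when theirs do. *)
Lemma FT_is_fourier f g : is_fourier f g <->
  FT f (fun xi => complex.Re (g xi)) (fun xi => complex.Im (g xi)).
Proof.
set a := fun xi => _; set b := fun xi => complex.Im _.
split.
- move=> [/Lfun_L2 hf /Lfun_L2 ha /Lfun_L2 hb lim].
  have mc n : measurable_fun setT (cos_trunc f n).
    by apply: continuous_measurable_fun; exact: cos_trunc_cont.
  have ms n : measurable_fun setT (sin_trunc f n).
    by apply: continuous_measurable_fun; exact: sin_trunc_cont.
  pose A n xi := cos_trunc f n xi - a xi.
  pose B n xi := - sin_trunc f n xi - b xi.
  pose D n xi := Num.sqrt (A n xi ^+ 2 + B n xi ^+ 2).
  have mA n : measurable_fun setT (A n) by apply: measurable_funB => //; case: ha.
  have mB n : measurable_fun setT (B n).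
    by apply: measurable_funB; [exact: measurableT_comp|case: hb].
  have mD n : measurable_fun setT (D n).
    apply: measurable_sqrt.
    by apply: measurable_funD; exact: measurable_funX.
  have DD n : (fun xi => ComplexField.Normc.normc (fourier_trunc f n xi - g xi)) = D n.
    by apply/funext => xi; exact: fourier_trunc_normc.
  have {}lim : (fun n => 'N[mu]_2%:E[EFin \o D n])%E @ \oo --> 0%E.
    by apply: cvg_trans lim; apply: near_eq_cvg; near=> n; rewrite DD.
  have D2 n xi : D n xi ^+ 2 = A n xi ^+ 2 + B n xi ^+ 2.
    by rewrite sqr_sqrtr// addr_ge0 ?sqr_ge0.
  (* Convergence to 0 in the extended reals makes the norms finite only from some rank on; this is
     why [FT] asks for square integrable errors eventually. *)
  have /fine_cvgP[fin liml] := lim.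
  have hD : \forall n \near \oo, L2 (D n).
    near=> n; apply: Lnorm2_lty => //; rewrite ltey_eq; apply/orP; left.
    by near: n.
  have AD n : L2 (D n) -> L2 (A n).
    move=> [_ i]; split => //; apply: L1_le i _; first exact: measurable_funX.
    by move=> xi; rewrite D2 ger0_norm ?sqr_ge0// lerDl sqr_ge0.
  have BD n : L2 (D n) -> L2 (B n).
    move=> [_ i]; split => //; apply: L1_le i _; first exact: measurable_funX.
    by move=> xi; rewrite D2 ger0_norm ?sqr_ge0// lerDr sqr_ge0.
  have limD : (fun n => intR (fun xi => D n xi ^+ 2)) @ \oo --> (0 : R).
    have : (fun n => fine ('N[mu]_2%:E[EFin \o D n])%E ^+ 2) @ \oo --> (0 ^+ 2 : R).
      rewrite expr2; under eq_fun do rewrite expr2.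
      by apply: cvgM; exact: liml.
    rewrite expr0n /=; apply: cvg_trans; apply: near_eq_cvg; near=> n.
    rewrite /= Lnorm2E /=; last by near: n.
    by rewrite sqr_sqrtr// intR_sqr_ge0.
  have sq C : (forall n, L2 (D n) -> L2 (C n)) ->
      (forall n xi, C n xi ^+ 2 <= D n xi ^+ 2) ->
      (fun n => intR (fun xi => C n xi ^+ 2)) @ \oo --> (0 : R).
    move=> CD Cle; apply: (@squeeze_cvgr _ _ _ _ (fun=> 0) _ _ _ _ _ limD).
      near=> n; rewrite intR_sqr_ge0/=; apply: le_intR => //.
      + by have [] : L2 (C n) by apply: CD; near: n.
      + by have [] : L2 (D n) by near: n.
    exact: cvg_cst.
  split => //.
  + by near=> n; split; [apply: AD|apply: BD]; near: n.
  + split; first by apply: (sq A AD) => n xi; rewrite D2 lerDl sqr_ge0.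
    by apply: (sq B BD) => n xi; rewrite D2 lerDr sqr_ge0.
- move=> [hf [ha hb] _ hn [ca cb]]; split; [exact: L2_Lfun|exact: L2_Lfun|exact: L2_Lfun|].
  have l : (fun n => Num.sqrt (intR (fun xi => (cos_trunc f n xi - a xi) ^+ 2) +
    intR (fun xi => (- sin_trunc f n xi - b xi) ^+ 2))) @ \oo --> Num.sqrt (0 + 0 : R).
    by apply: (cvg_comp _ _ (cvgD ca cb)); exact: sqrt_continuous.
  rewrite addr0 sqrtr0 in l.
  have N2E : \forall n \near \oo, 'N[mu]_2%:E[EFin \o (fun xi =>
      ComplexField.Normc.normc (fourier_trunc f n xi - g xi)%R)]%E =
      (Num.sqrt (intR (fun xi => (cos_trunc f n xi - a xi) ^+ 2) +
        intR (fun xi => (- sin_trunc f n xi - b xi) ^+ 2)))%:E.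
    near=> n.
    have [ha' hb'] : L2 (fun xi => cos_trunc f n xi - a xi) /\
        L2 (fun xi => - sin_trunc f n xi - b xi) by near: n.
    transitivity ('N[mu]_2%:E[EFin \o (fun xi =>
      Num.sqrt ((cos_trunc f n xi - a xi) ^+ 2 + (- sin_trunc f n xi - b xi) ^+ 2)%R)])%E.
      by congr Lnorm; apply/funext => xi /=; rewrite fourier_trunc_normc.
    rewrite Lnorm2E; last exact: L2_sqrt.
    congr (Num.sqrt _)%:E; rewrite -intRD; [|by case: ha'|by case: hb'].
    by apply: eq_intR => xi; rewrite sqr_sqrtr// addr_ge0 ?sqr_ge0.
  apply/fine_cvgP; split; first by near=> n; rewrite (near N2E n).
  by apply: cvg_trans l; apply: near_eq_cvg; near=> n; rewrite /= (near N2E n).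
Unshelve. all: by end_near. Qed.

End sobolev_bridge.

(** * Linearity and uniqueness of the transform *)

Section fourier_algebra.
Context {R : realType}.
Notation mu := (@lebesgue_measure R).
Implicit Types (f g a b : R -> R) (k xi : R).

Lemma L2_sum_sqr_le (f g : R -> R) : L2 f -> L2 g ->
  intR (fun x => (f x + g x) ^+ 2) <=
  2 * (intR (fun x => f x ^+ 2) + intR (fun x => g x ^+ 2)).
Proof.
move=> hf hg; have [[_ f2] [_ g2]] := (hf, hg).
have [_ fg2] := L2D hf hg.
rewrite -intRD// -intRZ; last exact: L1D.
apply: le_intR => //; first by apply: L1Z; exact: L1D.
by move=> x; have := sqr_ge0 (f x - g x); lra.
Qed.



Lemma L2_lin_cvg0 (I : Type) (F : set_system I) {FF : Filter F} (p q : I -> R -> R) k :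
  (\forall i \near F, L2 (p i)) -> (\forall i \near F, L2 (q i)) ->
  (fun i => intR (fun x => p i x ^+ 2)) @ F --> (0 : R) ->
  (fun i => intR (fun x => q i x ^+ 2)) @ F --> (0 : R) ->
  (fun i => intR (fun x => (p i x + k * q i x) ^+ 2)) @ F --> (0 : R).
Proof.
move=> hp hq lp lq.
have lim : (fun i => 2 * (intR (fun x => p i x ^+ 2) +
    k ^+ 2 * intR (fun x => q i x ^+ 2))) @ F --> (2 * (0 + k ^+ 2 * 0) : R).
  apply: cvgM; first exact: cvg_cst.
  by apply: cvgD => //; apply: cvgM => //; exact: cvg_cst.
rewrite mulr0 addr0 mulr0 in lim.
apply: (cvg0_le _ lim).
apply: filterS2 hp hq => i hpi hqi; rewrite intR_sqr_ge0 /=.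
apply: (le_trans (L2_sum_sqr_le hpi (L2Z k hqi))).
rewrite -intRZ; last by case: hqi.
by rewrite ler_wpM2l// lerD2l; under eq_intR do rewrite exprMn.
Qed.

Lemma L1_window_cos f n xi : L2 f ->
  L1 (fun x => f x * \1_(window n) x * cos (x * xi)).
Proof.
move=> hf; have := L1_cos xi (L2_window n hf).
by congr L1; apply/funext => x; rewrite (mulrC xi).
Qed.

Lemma L1_window_sin f n xi : L2 f ->
  L1 (fun x => f x * \1_(window n) x * sin (x * xi)).
Proof.
move=> hf; have := L1_sin xi (L2_window n hf).
by congr L1; apply/funext => x; rewrite (mulrC xi).
Qed.

Lemma FT_lin f g a b a' b' k : FT f a b -> FT g a' b' ->
  FT (fun x => f x + k * g x) (fun xi => a xi + k * a' xi) (fun xi => b xi + k * b' xi).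
Proof.
move=> [hf [ha hb] [mc ms] hn [lc ls]] [hg [ha' hb'] [mc' ms'] hn' [lc' ls']].
have cE n xi : cos_trunc (fun x => f x + k * g x) n xi =
    cos_trunc f n xi + k * cos_trunc g n xi.
  rewrite !cos_truncE -intRZ; last exact: L1_window_cos.
  rewrite -intRD; [|exact: L1_window_cos|by apply: L1Z; exact: L1_window_cos].
  by apply: eq_intR => x; ring.
have sE n xi : sin_trunc (fun x => f x + k * g x) n xi =
    sin_trunc f n xi + k * sin_trunc g n xi.
  rewrite !sin_truncE -intRZ; last exact: L1_window_sin.
  rewrite -intRD; [|exact: L1_window_sin|by apply: L1Z; exact: L1_window_sin].
  by apply: eq_intR => x; ring.
have hfg : L2 (fun x => f x + k * g x) by apply: L2D => //; exact: L2Z.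
have key (u u' v : nat -> R -> R) c c' :
    (forall n xi, v n xi - (c xi + k * c' xi) = (u n xi - c xi) + k * (u' n xi - c' xi)) ->
    (\forall n \near \oo, L2 (fun xi => u n xi - c xi)) ->
    (\forall n \near \oo, L2 (fun xi => u' n xi - c' xi)) ->
    (fun n => intR (fun xi => (u n xi - c xi) ^+ 2)) @ \oo --> (0 : R) ->
    (fun n => intR (fun xi => (u' n xi - c' xi) ^+ 2)) @ \oo --> (0 : R) ->
    (\forall n \near \oo, L2 (fun xi => v n xi - (c xi + k * c' xi))) /\
    (fun n => intR (fun xi => (v n xi - (c xi + k * c' xi)) ^+ 2)) @ \oo --> (0 : R).
  move=> e hu hu' lu lu'; split.
    near=> n; under eq_fun do rewrite e.
    by apply: L2D; [near: n|apply: L2Z; near: n].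
  apply: cvg_ext (L2_lin_cvg0 (FF := eventually_filter) k hu hu' lu lu') => n.
  by apply: eq_intR => x; rewrite e.
have [n1 l1] := key (cos_trunc f) (cos_trunc g) (cos_trunc (fun x => f x + k * g x)) a a'
  ltac:(by move=> n xi; rewrite cE; ring)
  (filterS (fun n => @proj1 _ _) hn) (filterS (fun n => @proj1 _ _) hn') lc lc'.
have [n2 l2] := key (fun n xi => - sin_trunc f n xi) (fun n xi => - sin_trunc g n xi)
  (fun n xi => - sin_trunc (fun x => f x + k * g x) n xi) b b'
  ltac:(by move=> n xi; rewrite /= sE; ring)
  (filterS (fun n => @proj2 _ _) hn) (filterS (fun n => @proj2 _ _) hn') ls ls'.
split => //.
- by split; apply: L2D => //; exact: L2Z.
- split=> n; apply: continuous_measurable_fun.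
    exact: cos_trunc_cont.
  exact: sin_trunc_cont.
- by near=> n; split; near: n.
Unshelve. all: by end_near. Qed.

Lemma FTB f g a b a' b' : FT f a b -> FT g a' b' ->
  FT (fun x => f x - g x) (fun xi => a xi - a' xi) (fun xi => b xi - b' xi).
Proof.
move=> hf hg; have := FT_lin (-1) hf hg.
by congr FT; apply/funext => x; rewrite mulN1r.
Qed.

Lemma FT_0 : FT (fun=> 0 : R) (fun=> 0) (fun=> 0).
Proof.
have c0 n xi : cos_trunc (fun=> 0 : R) n xi = 0.
  by rewrite cos_truncE -[RHS]intR0; apply: eq_intR => x; rewrite !mul0r.
have s0 n xi : sin_trunc (fun=> 0 : R) n xi = 0.
  by rewrite sin_truncE -[RHS]intR0; apply: eq_intR => x; rewrite !mul0r.
have zero2 := @L2_0 R.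
split => //.
- split=> n; apply: continuous_measurable_fun.
    exact: cos_trunc_cont.
  exact: sin_trunc_cont.
- near=> n; split.
    by under eq_fun do rewrite c0 subr0.
  by under eq_fun do rewrite s0 oppr0 addr0.
- split.
    apply: cvg_ext (cvg_cst 0) => n.
    by rewrite -[LHS]intR0; apply: eq_intR => x; rewrite c0 subr0 expr0n.
  apply: cvg_ext (cvg_cst 0) => n.
  by rewrite -[LHS]intR0; apply: eq_intR => x; rewrite s0 oppr0 addr0 expr0n.
Unshelve. all: by end_near. Qed.

Lemma FTZ f a b k : FT f a b ->
  FT (fun x => k * f x) (fun xi => k * a xi) (fun xi => k * b xi).
Proof.
move=> hf; have := FT_lin k FT_0 hf.
by congr FT; apply/funext => x; rewrite add0r.
Qed.

Lemma intR_sqr_eq0 f : L2 f -> intR (fun x => f x ^+ 2) = 0 ->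
  {ae mu, forall x, f x = 0}.
Proof.
move=> [mf f2] f0; apply: ae_imply (intR_eq0 f2 _ f0) => [x|x]; last exact: sqr_ge0.
by move/eqP; rewrite expf_eq0 /= => /eqP.
Qed.

(** The differences form a transform of [f - f], whose truncated transforms all vanish; the squared
    norms of [a - a'] and [b - b'] are thus constant sequences tending to 0. *)
Lemma FT_unique f a b a' b' : FT f a b -> FT f a' b' ->
  {ae mu, forall xi, a xi = a' xi /\ b xi = b' xi}.
Proof.
move=> h h'; have [_ [ha hb] _ hn [lc ls]] := FTB h h'.
have c0 n xi : cos_trunc (fun x => f x - f x) n xi = 0.
  by rewrite cos_truncE -[RHS]intR0; apply: eq_intR => x; rewrite subrr !mul0r.
have s0 n xi : sin_trunc (fun x => f x - f x) n xi = 0.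
  by rewrite sin_truncE -[RHS]intR0; apply: eq_intR => x; rewrite subrr !mul0r.
apply: ae_and.
  apply: ae_imply (intR_sqr_eq0 ha _) => [x /eqP|]; first by rewrite subr_eq0 => /eqP.
  apply: cvg_unique lc => //; apply: cvg_ext (cvg_cst _) => n.
  by apply: eq_intR => x; rewrite c0 sub0r sqrrN.
apply: ae_imply (intR_sqr_eq0 hb _) => [x /eqP|]; first by rewrite subr_eq0 => /eqP.
apply: cvg_unique ls => //; apply: cvg_ext (cvg_cst _) => n.
by apply: eq_intR => x; rewrite s0 oppr0 sub0r sqrrN.
Qed.

End fourier_algebra.

(** * Sobolev weights and embeddings on the Fourier side *)

Section sobolev_weights.
Context {R : realType}.
Notation mu := (@lebesgue_measure R).
Implicit Types (f g a b : R -> R) (p q r k xi : R).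

Definition weight r xi : R := (1 + xi ^+ 2) `^ (r / 2).

Lemma bracket_ge1 xi : 1 <= 1 + xi ^+ 2 :> R.
Proof. by rewrite lerDl sqr_ge0. Qed.

Lemma weight_gt0 r xi : 0 < weight r xi.
Proof. by apply: powR_gt0; apply: lt_le_trans (bracket_ge1 xi). Qed.

Lemma weight_ge0 r xi : 0 <= weight r xi.
Proof. exact/ltW/weight_gt0. Qed.

Lemma weightD r q xi : weight (r + q) xi = weight r xi * weight q xi.
Proof.
rewrite /weight mulrDl powRD//; apply/implyP => _.
by rewrite gt_eqF// (lt_le_trans _ (bracket_ge1 xi)).
Qed.

Lemma weight0 xi : weight 0 xi = 1.
Proof. by rewrite /weight mul0r powRr0. Qed.

Lemma weight2 xi : weight 2 xi = 1 + xi ^+ 2.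
Proof. by rewrite /weight divff ?pnatr_eq0// powRr1// (le_trans _ (bracket_ge1 xi)). Qed.

Lemma weight_ge1 r xi : 0 <= r -> 1 <= weight r xi.
Proof.
move=> r0; rewrite -[leLHS](powRr0 (1 + xi ^+ 2)).
by apply: ler_powR; [exact: bracket_ge1|rewrite divr_ge0].
Qed.

Lemma weight_meas r : measurable_fun setT (weight r).
Proof.
apply: (measurableT_comp (@measurable_powR R (r / 2))).
by apply: measurable_funD => //; exact: measurable_funX.
Qed.

Lemma powR1D_derive p (c x : R) : 0 < 1 + c * x -> 
  is_derive x 1 (fun x : R => (1 + c * x) `^ p) (p * (1 + c * x) `^ (p - 1) * c).
Proof.
move=> h; apply: (@der_comp _ (fun y => y `^ p) (fun x => 1 + c * x)).
  exact: is_derive1_powR.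
by apply: der_eq (derD (derC _ _) (derMl c x)) _; rewrite add0r.
Qed.

Lemma L1_powR_abs p : 1 < p -> L1 (fun x : R => (1 + `|x|) `^ (- p)).
Proof.
move=> p1; have p0 : 1 - p != 0 by rewrite subr_eq0 lt_eqF.
have mh : measurable_fun setT (fun x : R => (1 + `|x|) `^ (- p)).
  apply: (measurableT_comp (@measurable_powR R (- p))).
  by apply: measurable_funD => //; exact: normr_measurable.
apply: (@L1_exhaust _ _ (2 / (p - 1))) => // n.
pose Fc (c x : R) : R := (c * (1 - p))^-1 * (1 + c * x) `^ (1 - p).
pose fc (c x : R) : R := (1 + c * x) `^ (- p).
have dF (c x : R) : c != 0 -> 0 < 1 + c * x -> is_derive x 1 (Fc c) (fc c x).
  move=> c0 h; apply: der_eq (derZ _ (powR1D_derive (1 - p) h)) _.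
  rewrite (_ : 1 - p - 1 = - p); last by lra.
  by rewrite /fc mulrAC (mulrC (1 - p)) mulrA mulVf ?mul1r// mulf_neq0.
have cf (c x : R) : 0 < 1 + c * x -> {for x, continuous (fc c)}.
  by move=> h; exact: der_continuous (powR1D_derive (- p) h).
have -> : (\int[mu]_(x in window n) ((1 + `|x|) `^ (- p))%:E =
    (Fc 1 n%:R - Fc 1 0 + (Fc (-1) 0 - Fc (-1) (- n%:R)))%:E)%E.
  apply: (@ftc_window _ (Fc 1) (Fc (-1)) (fc 1) (fc (-1))) => // x x0.
  - by rewrite /fc ger0_norm// mul1r.
  - by rewrite /fc ler0_norm// mulN1r.
  - by apply: dF; [rewrite oner_eq0|lra].
  - by apply: cf; lra.
  - by apply: dF; [rewrite oppr_eq0 oner_eq0|rewrite mulN1r; lra].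
  - by apply: cf; rewrite mulN1r; lra.
rewrite lee_fin /Fc !mulr0 addr0 powR1 mulrNN !mul1r !mulN1r mulr1.
set A := (1 + n%:R) `^ (1 - p).
have A0 : 0 <= A := powR_ge0 _ _.
rewrite [leLHS](_ : _ = (2 - 2 * A) / (p - 1)); last first.
  by field; rewrite p0 subr_eq0 gt_eqF.
by rewrite ler_wpM2r// ?invr_ge0; lra.
Qed.

(** From $(1+|\xi|)^2\le2(1+\xi^2)$, the square of the weight is at most $2^q(1+|\xi|)^{-2q}$, and
    $2q>1$. *)
Lemma L2_weight q : 1 / 2 < q -> L2 (weight (- q)).
Proof.
move=> hq; split; first exact: weight_meas.
apply: (@L1_le _ _ (fun xi => 2 `^ q * (1 + `|xi|) `^ (- (2 * q)))).
- by apply: measurable_funX; exact: weight_meas.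
- by apply: L1Z; apply: L1_powR_abs; lra.
move=> xi; rewrite ger0_norm ?sqr_ge0// expr2 -weightD /weight.
rewrite (_ : (- q - q) / 2 = - q); last by field.
have b0 : 0 < 1 + xi ^+ 2 by rewrite (lt_le_trans _ (bracket_ge1 xi)).
have c0 : 0 < 1 + `|xi| by rewrite ltr_pwDl.
rewrite !powRN -[leLHS]mul1r ler_pdivlMr ?powR_gt0// mulrAC.
rewrite mul1r ler_pdivrMr ?powR_gt0// powRrM powR_mulrn ?(ltW c0)//.
rewrite -(powRM _ _ (ltW b0))//.
apply: ge0_ler_powR; rewrite ?nnegrE ?sqr_ge0//; first by lra.
  by rewrite mulr_ge0// ltW.
have e : `|xi| ^+ 2 = xi ^+ 2 by rewrite real_normK ?num_real.
by rewrite -e; have := sqr_ge0 (1 - `|xi|); lra.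
Qed.

(** Sobolev embedding as Cauchy-Schwarz: the factor [weight (- q)] is split off, and [C] is its
    squared $L^2$ norm, the same for all [r] and [a]. *)
Lemma weight_L1 q : 1 / 2 < q -> exists2 C : R, 0 <= C & forall r a,
  L2 (fun xi => weight (r + q) xi * a xi) ->
  L1 (fun xi => weight r xi * a xi) /\
  intR (fun xi => `|weight r xi * a xi|) ^+ 2 <=
    C * intR (fun xi => (weight (r + q) xi * a xi) ^+ 2).
Proof.
move=> hq; have hw := L2_weight hq.
exists (intR (fun xi => weight (- q) xi ^+ 2)); first exact: intR_sqr_ge0.
move=> r a ha.
have e xi : weight (- q) xi * (weight (r + q) xi * a xi) = weight r xi * a xi.
  by rewrite mulrA -weightD; congr (weight _ _ * _); ring.
split; first by have := L2_mul hw ha; congr L1; apply/funext => xi; rewrite e.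
have := cauchy_schwarz hw (L2_abs ha).
have -> : intR (fun xi => `|weight (r + q) xi * a xi| ^+ 2) =
    intR (fun xi => (weight (r + q) xi * a xi) ^+ 2).
  by apply: eq_intR => xi; rewrite real_normK ?num_real.
apply: le_trans; apply: eq_lerW.
by congr (_ ^+ 2); apply: eq_intR => xi; rewrite -e normrM ger0_norm// weight_ge0.
Qed.

Lemma L2_weight_le r q a : r <= q -> L2 (fun xi => weight q xi * a xi) ->
  L2 (fun xi => weight r xi * a xi) /\
  intR (fun xi => (weight r xi * a xi) ^+ 2) <=
  intR (fun xi => (weight q xi * a xi) ^+ 2).
Proof.
move=> rq [mq q2].
have le xi : (weight r xi * a xi) ^+ 2 <= (weight q xi * a xi) ^+ 2.
  rewrite !exprMn ler_wpM2r ?sqr_ge0// ler_sqr ?nnegrE ?weight_ge0//.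
  rewrite (_ : q = r + (q - r)); last by ring.
  rewrite weightD ler_peMr ?weight_ge0//.
  by apply: weight_ge1; rewrite subr_ge0.
have mr : measurable_fun setT (fun xi => weight r xi * a xi).
  have e xi : weight (r - q) xi * (weight q xi * a xi) = weight r xi * a xi.
    by rewrite mulrA -weightD; congr (weight _ _ * _); ring.
  rewrite (_ : (fun xi => _) = fun xi => weight (r - q) xi * (weight q xi * a xi)).
    by apply: measurable_funM => //; exact: weight_meas.
  by apply/funext => xi.
have hr : L1 (fun xi => (weight r xi * a xi) ^+ 2).
  apply: L1_le q2 _; first exact: measurable_funX.
  by move=> xi; rewrite ger0_norm ?sqr_ge0.
by split => //; exact: le_intR.
Qed.

(** The embedding with exponent $s-2>1/2$ leaves the weight $1+\xi^2$, which dominates both 1 and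
    $\xi^2$. *)
Lemma weight_reg s a : 5 / 2 < s -> L2 (fun xi => weight s xi * a xi) -> reg a.
Proof.
move=> hs ha.
have hq : 1 / 2 < s - 2 by lra.
have [C C0 hC] := weight_L1 hq.
have e2 : 2 + (s - 2) = s by ring.
have [h1 _] : L1 (fun xi => weight 2 xi * a xi) /\ _ := hC 2 a ltac:(by rewrite e2).
have [h2 _] := @L2_weight_le 2 s a ltac:(by lra) ha.
have [h0 _] := @L2_weight_le 0 s a ltac:(by lra) ha.
have e0 : (fun xi => weight 0 xi * a xi) = a.
  by apply/funext => xi; rewrite weight0 mul1r.
rewrite e0 in h0; have [ma a2] := h0.
have mxa : measurable_fun setT (fun xi => xi ^+ 2 * a xi).
  by apply: measurable_funM => //; exact: measurable_funX.
have le1 xi : `|a xi| <= `|weight 2 xi * a xi|.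
  by rewrite normrM ger0_norm ?weight_ge0// ler_peMl// weight_ge1.
have lex xi : `|xi ^+ 2 * a xi| <= `|weight 2 xi * a xi|.
  rewrite (normrM (xi ^+ 2)) (normrM (weight 2 xi)) (ger0_norm (sqr_ge0 xi)).
  rewrite (ger0_norm (weight_ge0 2 xi)).
  by rewrite ler_wpM2r// weight2 lerDr.
split => //.
- exact: L1_le (L1_abs h1) le1.
- exact: L1_le (L1_abs h1) lex.
split => //; apply: L1_le (h2.2) _; first exact: measurable_funX.
move=> xi; rewrite ger0_norm ?sqr_ge0//.
by rewrite -[leLHS]real_normK ?num_real// -[leRHS]real_normK ?num_real// ler_sqr ?nnegrE.
Qed.

Lemma L2_weightB r (a a' : R -> R) : L2 (fun xi => weight r xi * a xi) ->
  L2 (fun xi => weight r xi * a' xi) -> L2 (fun xi => weight r xi * (a xi - a' xi)).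
Proof.
by move=> h h'; have := L2B h h'; congr L2; apply/funext => xi; rewrite mulrBr.
Qed.

Lemma L2_weight_increment r k (a a' v : R -> R) : L2 (fun xi => weight r xi * a xi) ->
  L2 (fun xi => weight r xi * a' xi) -> L2 (fun xi => weight r xi * v xi) ->
  L2 (fun xi => weight r xi * (k * (a xi - a' xi) - v xi)).
Proof.
move=> h h'; apply: L2_weightB; have := L2Z k (L2_weightB h h').
by congr L2; apply/funext => xi; rewrite mulrCA.
Qed.

End sobolev_weights.

(** * Sobolev norms computed from arbitrary representatives of the transform *)

Section sobolev_norms.
Context {R : realType}.
Notation mu := (@lebesgue_measure R).
Implicit Types (f g a b : R -> R) (p q r k xi : R).

Definition hat_re f xi : R := complex.Re (fourier f xi).
Definition hat_im f xi : R := complex.Im (fourier f xi).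
Definition wnorm2 r a b : R :=
  intR (fun xi => (weight r xi * a xi) ^+ 2) + intR (fun xi => (weight r xi * b xi) ^+ 2).

(** The transform is a parameter instead of the choice made by [fourier]: a difference of chosen
    transforms is only almost everywhere the chosen transform of the difference. [sobolev_repr] adds
    the continuity required by pointwise inversion. *)
Definition sobolev_pair r f a b : Prop :=
  [/\ FT f a b, L2 (fun xi => weight r xi * a xi) & L2 (fun xi => weight r xi * b xi)].
Definition sobolev_repr r f a b : Prop :=
  [/\ continuous f, FT f a b, L2 (fun xi => weight r xi * a xi) &
      L2 (fun xi => weight r xi * b xi)].

Lemma L1_ae f g : measurable_fun setT f -> L1 g ->
  {ae mu, forall x, f x = g x} -> L1 f.
Proof.
move=> mf hg fg; have mg := L1_meas hg.
apply/integrableP; split; first exact/measurable_EFinP.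
have /integrableP[_] := hg; congr (_ < _)%E; apply: ae_eq_integral => //.
- by apply: measurableT_comp => //; exact/measurable_EFinP.
- by apply: measurableT_comp => //; exact/measurable_EFinP.
- by apply: ae_imply fg => x /= -> _.
Qed.

Lemma fourier_spec f a b : FT f a b -> FT f (hat_re f) (hat_im f).
Proof.
move=> h; apply/FT_is_fourier; rewrite /fourier; apply: xgetPex.
by exists (fun xi => (a xi +i* b xi)%C); apply/FT_is_fourier.
Qed.

Definition sobolev_integrand r f xi : R :=
  weight r xi * Num.sqrt (hat_re f xi ^+ 2 + hat_im f xi ^+ 2).

Lemma sobolev_norm_integrand r f :
  sobolev_norm r f = ('N[mu]_2%:E[EFin \o sobolev_integrand r f])%E.
Proof.
rewrite /sobolev_norm; congr Lnorm; apply/funext => xi /=.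
by rewrite /sobolev_integrand /hat_re /hat_im; case: (fourier f xi).
Qed.

Lemma sobolev_integrand_sqr r f xi : sobolev_integrand r f xi ^+ 2 =
  (weight r xi * hat_re f xi) ^+ 2 + (weight r xi * hat_im f xi) ^+ 2.
Proof. by rewrite exprMn sqr_sqrtr ?addr_ge0 ?sqr_ge0// !exprMn mulrDr. Qed.

Lemma sobolev_integrand_meas r f a b : FT f a b ->
  measurable_fun setT (sobolev_integrand r f).
Proof.
move=> /fourier_spec[_ [[ma _] [mb _]] _ _ _].
apply: measurable_funM; first exact: weight_meas.
by apply: measurable_sqrt; apply: measurable_funD; exact: measurable_funX.
Qed.

(** The chosen transform and the pair [(a, b)] agree almost everywhere by [FT_unique], so the
    integrals coincide. *)
Lemma sobolev_normE r f a b : FT f a b ->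
  L2 (fun xi => weight r xi * a xi) -> L2 (fun xi => weight r xi * b xi) ->
  sobolev_norm r f = (Num.sqrt (wnorm2 r a b))%:E.
Proof.
move=> hf [ma a2] [mb b2]; have mD := sobolev_integrand_meas r hf.
have ab2 := L1D a2 b2.
have eae : {ae mu, forall xi, sobolev_integrand r f xi ^+ 2 =
    (weight r xi * a xi) ^+ 2 + (weight r xi * b xi) ^+ 2}.
  by apply: ae_imply (FT_unique (fourier_spec hf) hf) => xi [ea eb];
    rewrite sobolev_integrand_sqr ea eb.
have hD : L2 (sobolev_integrand r f).
  by split => //; apply: L1_ae ab2 eae; exact: measurable_funX.
rewrite sobolev_norm_integrand Lnorm2E//; congr (Num.sqrt _)%:E.
rewrite /wnorm2 -intRD//; apply: intR_ae eae; first exact: measurable_funX.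
exact: L1_meas ab2.
Qed.

Lemma in_sobolev_FT r f : in_sobolev r f -> sobolev_pair r f (hat_re f) (hat_im f).
Proof.
move=> [/FT_is_fourier hf]; rewrite sobolev_norm_integrand => fin.
have [_ D2] := Lnorm2_lty (sobolev_integrand_meas r hf) fin.
have [_ [[ma _] [mb _]] _ _ _] := hf.
have mwa : measurable_fun setT (fun xi => weight r xi * hat_re f xi).
  by apply: measurable_funM => //; exact: weight_meas.
have mwb : measurable_fun setT (fun xi => weight r xi * hat_im f xi).
  by apply: measurable_funM => //; exact: weight_meas.
split => //; split => //; (apply: L1_le D2 _; first exact: measurable_funX) => xi;
  by rewrite sobolev_integrand_sqr ger0_norm ?sqr_ge0// ?lerDl ?lerDr sqr_ge0.
Qed.

Lemma wnorm2_ge0 r a b : 0 <= wnorm2 r a b.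
Proof. by rewrite addr_ge0// intR_sqr_ge0. Qed.

Lemma sobolev_norm_cvg0 (I : Type) (F : set_system I) {FF : Filter F} r
    (f_ a_ b_ : I -> R -> R) :
  (\forall i \near F, sobolev_pair r (f_ i) (a_ i) (b_ i)) ->
  (fun i => sobolev_norm r (f_ i)) @ F --> 0%E ->
  (fun i => wnorm2 r (a_ i) (b_ i)) @ F --> (0 : R).
Proof.
move=> hn /fine_cvgP[_ l].
have : (fun i => fine (sobolev_norm r (f_ i)) * fine (sobolev_norm r (f_ i))) @ F -->
    (0 * 0 : R) by apply: cvgM; exact: l.
rewrite mulr0; apply: cvg_trans; apply: near_eq_cvg.
apply: filterS hn => i [h ha hb]; rewrite (sobolev_normE h ha hb) /=.
by rewrite -expr2 sqr_sqrtr// wnorm2_ge0.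
Qed.

End sobolev_norms.

(** * Gronwall's inequality, the derivative of a squared norm, decay at infinity *)

Section calculus.
Context {R : realType}.
Notation mu := (@lebesgue_measure R).
Implicit Types (f g E : R -> R) (t x y K M : R).

Lemma is_derive_cvg f t (l : R) :
  (fun h : R => h^-1 * (f (t + h) - f t)) @ 0^' --> l -> is_derive t 1 f l.
Proof.
move=> hl; have hl' : (fun h : R => h^-1 *: ((f \o shift t) (h *: 1) - f t)) @ 0^' --> l.
  by apply: cvg_ext hl => h; rewrite /= /GRing.scale /= mulr1 (addrC t).
apply: DeriveDef; last exact: cvg_lim hl'.
by apply/cvg_ex; exists l.
Qed.

(** The two-sided bound on the derivative makes $E(t)e^{-Kt}$ nonincreasing, which settles the times
    after [t0], and $E(t)e^{Kt}$ nondecreasing, which settles those before. *)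
Lemma gronwall_eq0 (E dE : R -> R) (a b K t0 : R) :
  (forall t, a < t < b -> is_derive t 1 E (dE t)) ->
  (forall t, a < t < b -> `|dE t| <= K * E t) ->
  (forall t, 0 <= E t) -> a < t0 < b -> E t0 = 0 ->
  forall t, a < t < b -> E t = 0.
Proof.
move=> hE hK E0 /andP[a0 b0] Et0 t /andP[at_ tb].
have prod c x : a < x < b -> is_derive x 1 (fun y => E y * expR (c * y))
    ((dE x + c * E x) * expR (c * x)).
  by move=> hx; apply: der_eq (derM (hE _ hx) (der_expM c x)) _; ring.
have e0 c x : 0 < expR (c * x) := expR_gt0 _.
apply/eqP; rewrite eq_le E0 andbT.
have [t0t|/ltW tt0] := leP t0 t.
- have h : -1 * (E t0 * expR (- K * t0)) <= -1 * (E t * expR (- K * t)).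
    apply: (@mvt_le _ (fun y => -1 * (E y * expR (- K * y)))
      (fun x => -1 * ((dE x + - K * E x) * expR (- K * x))) _ _ t0t) => x /andP[x1 x2].
      have hx : a < x < b by rewrite (lt_le_trans a0 x1) (le_lt_trans x2 tb).
      by apply: derZ; exact: prod.
    have hx : a < x < b by rewrite (lt_le_trans a0 x1) (le_lt_trans x2 tb).
    rewrite mulrA mulr_ge0 ?(ltW (e0 _ _))//.
    by have := hK x hx; rewrite ler_norml => /andP[]; lra.
  move: h; rewrite Et0 mul0r mulr0 mulN1r oppr_ge0 => h.
  by rewrite -(ler_pM2r (e0 (- K) t)) mul0r.
- have h : E t * expR (K * t) <= E t0 * expR (K * t0).
    apply: (@mvt_le _ (fun y => E y * expR (K * y))
      (fun x => (dE x + K * E x) * expR (K * x)) _ _ tt0) => x /andP[x1 x2].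
      by apply: prod; rewrite (lt_le_trans at_ x1) (le_lt_trans x2 b0).
    have hx : a < x < b by rewrite (lt_le_trans at_ x1) (le_lt_trans x2 b0).
    rewrite mulr_ge0 ?(ltW (e0 _ _))//.
    by have := hK x hx; rewrite ler_norml => /andP[]; lra.
  by move: h; rewrite Et0 mul0r => h; rewrite -(ler_pM2r (e0 K t)) mul0r.
Qed.

(** Writing $A(t+h)=A(t)+h(V+D)$ with $D\to0$ in $L^2$, the difference quotient of the squared norm
    is $2\langle D,A\rangle+2\langle V,A\rangle+h\|D+V\|^2$. *)
Lemma is_derive_norm2 (A : R -> R -> R) (V : R -> R) t : L2 (A t) -> L2 V ->
  (\forall h \near (0 : R)^', L2 (A (t + h))) ->
  (fun h : R => intR (fun xi => (h^-1 * (A (t + h) xi - A t xi) - V xi) ^+ 2)) @ 0^' -->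
    (0 : R) ->
  is_derive t 1 (fun t => intR (fun xi => A t xi ^+ 2))
    (2 * intR (fun xi => V xi * A t xi)).
Proof.
move=> hA hV hn l; apply: is_derive_cvg.
pose D (h : R) xi := h^-1 * (A (t + h) xi - A t xi) - V xi.
have hD : \forall h \near (0 : R)^', L2 (D h).
  by near=> h; apply: L2B => //; apply: L2Z; apply: L2B => //; near: h.
have FF : Filter (0 : R)^' by exact: dnbhs_filter.
have lA := L2_ip_cvg0 (FF := FF) hA hD l.
have lV := L2_ip_cvg0 (FF := FF) hV hD l.
have h0 : (id : R -> R) @ 0^' --> (0 : R).
  by apply: cvg_within_filter; exact: cvg_id.
have lim : (fun h : R => 2 * intR (fun xi => D h xi * A t xi) +
    2 * intR (fun xi => V xi * A t xi) +
    h * (intR (fun xi => D h xi ^+ 2) + 2 * intR (fun xi => D h xi * V xi) +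
         intR (fun xi => V xi ^+ 2))) @ 0^' -->
    2 * 0 + 2 * intR (fun xi => V xi * A t xi) +
    0 * (0 + 2 * 0 + intR (fun xi => V xi ^+ 2)).
  have c2 : (fun=> 2) @ (0:R)^' --> (2 : R) by exact: cvg_cst.
  apply: cvgD; first by apply: cvgD; [exact: cvgM|exact: cvg_cst].
  apply: cvgM => //; apply: cvgD; last exact: cvg_cst.
  by apply: cvgD => //; exact: cvgM.
rewrite mul0r mulr0 add0r addr0 in lim.
apply: cvg_trans lim; apply: near_eq_cvg; near=> h.
have hDh : L2 (D h) by near: h.
have hh : h != 0 by near: h; exact: nbhs_dnbhs_neq.
have hAh : L2 (A (t + h)) by near: h.
have i1 := L2_mul hDh hA; have i2 := L2_mul hV hA; have i3 := L2_mul hDh hV.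
have [_ i4] := hDh; have [_ i5] := hV; have [_ i6] := hAh; have [_ i7] := hA.
rewrite -(intRB i6 i7) -(intRZ _ (L1B i6 i7)) -(intRZ 2 i1) -(intRZ 2 i2) -(intRZ 2 i3).
rewrite -(intRD (L1Z 2 i1) (L1Z 2 i2)) -(intRD i4 (L1Z 2 i3)) -(intRD (L1D i4 (L1Z 2 i3)) i5).
have i8 := L1D (L1D i4 (L1Z 2 i3)) i5.
rewrite -(intRZ h i8) -(intRD (L1D (L1Z 2 i1) (L1Z 2 i2)) (L1Z h i8)).
by apply: eq_intR => xi; rewrite /D; field.
Unshelve. all: by end_near. Qed.

(** If $|f|\ge\epsilon$ at $en$, the Lipschitz bound keeps $|f|\ge\epsilon/2$ on an interval of
    fixed length $2d$ around it, while the mass of $f^2$ near $en$ tends to 0. The sign [e] covers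
    both ends of the line. *)
Lemma L2_lip_cvg0 f M (e : R) : L2 f -> `|e| = 1 ->
  (forall x y, `|f x - f y| <= M * `|x - y|) ->
  (fun n : nat => f (e * n%:R)) @ \oo --> (0 : R).
Proof.
move=> [mf f2] e1 lip.
pose B (n : nat) : set R := [set z | `|z - e * n%:R| <= 2^-1].
have mB n : measurable (B n).
  rewrite (_ : B n = `[e * n%:R - 2^-1, e * n%:R + 2^-1]%classic); first exact: measurable_itv.
  by apply/seteqP; split=> z; rewrite /B /= in_itv /= ler_distl.
have en n : `|e * n%:R| = n%:R by rewrite normrM e1 mul1r ger0_norm.
have le1 n z : `|f z ^+ 2 * \1_(B n) z| <= f z ^+ 2.
  rewrite normrM ger0_norm ?sqr_ge0// ler_piMr ?sqr_ge0//; exact: indic_le1.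
have ptw z : (fun n => f z ^+ 2 * \1_(B n) z) @ \oo --> (0 : R).
  have : (fun=> 0 : R) @ \oo --> (0 : R) by exact: cvg_cst.
  apply: cvg_trans; apply: near_eq_cvg; near=> n.
  have hn : `|z| + 1 < n%:R by near: n; exact: nbhs_infty_gtr.
  rewrite indicE memNset ?mulr0// /B /= => /le_trans/(_ (lexx _)) h.
  have : n%:R <= `|z| + 2^-1 :> R.
    rewrite -[leLHS](en n) -[e * n%:R](subKr z) (le_trans (ler_normB _ _))// lerD2l.
    exact: h.
  by lra.
have [_ lim] := @dct _ (fun n z => f z ^+ 2 * \1_(B n) z) (fun=> 0) (fun z => f z ^+ 2)
  (fun n => L1_meas (L1_indic (mB n) f2)) f2 ptw le1.
rewrite intR0 in lim.
apply/cvgr0Pnorm_lt => eps eps0.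
(* The first bound puts the interval inside [B n], the second limits the variation of [f] on it to
   [eps / 2]. *)
pose d := Num.min 2^-1 (eps / (2 * (`|M| + 1))).
have M0 : 0 < `|M| + 1 by rewrite ltr_pwDr.
have d0 : 0 < d by rewrite lt_min invr_gt0 ltr0n /= divr_gt0// mulr_gt0.
have d2 : d <= 2^-1 by rewrite ge_min lexx.
have dM' : (`|M| + 1) * d <= eps / 2.
  have : d <= eps / (2 * (`|M| + 1)) by rewrite ge_min lexx orbT.
  rewrite -(ler_pM2l M0) => /le_trans; apply; apply: eq_lerW.
  by field; rewrite gt_eqF.
pose c := (eps / 2) ^+ 2 * (2 * d).
have c0 : 0 < c by rewrite !mulr_gt0 ?exprn_gt0 ?divr_gt0.
near=> n; rewrite ltNge; apply/negP => hge.
have : `|intR (fun z => f z ^+ 2 * \1_(B n) z)| < c.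
  by near: n; apply: (cvgr0Pnorm_lt _).1 lim _ c0.
rewrite ltNge => /negP; apply; apply: le_trans (ler_norm _).
pose C : set R := `]e * n%:R - d, e * n%:R + d[%classic.
have L1C : L1 (\1_C : R -> R).
  apply: L1_le (L1_window_indic n.+1) _.
    by apply: measurable_indicR; exact: measurable_itv.
  move=> z; rewrite !indicE; case: (boolP (z \in C)) => [|_]; last first.
    by rewrite /= normr0 ler0n.
  rewrite inE /C /= in_itv /= -ltr_distl => hz.
  rewrite mem_set ?normr1// /window /= in_itv /= -ler_norml.
  rewrite -(subrK (e * n%:R) z) (le_trans (ler_normD _ _))// en -[n.+1]addn1 natrD.
  by rewrite addrC lerD2l; lra.
have -> : c = intR (fun z => (eps / 2) ^+ 2 * \1_C z).
  rewrite intRZ// intR_indic_oo; last by lra.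
  by rewrite /c; congr (_ * _); ring.
apply: le_intR; [exact: L1Z|exact: L1_indic|move=> z].
rewrite !indicE; case: (boolP (z \in C)) => [|_]; last first.
  by rewrite /= mulr0 mulr_ge0 ?sqr_ge0.
rewrite inE /C /= in_itv /= -ltr_distl => hz.
rewrite mem_set ?mulr1; last by rewrite /B /= (le_trans (ltW hz)).
rewrite -[leRHS]real_normK ?num_real// ler_sqr ?nnegrE ?divr_ge0 ?(ltW eps0)//.
have l1 := lip (e * n%:R) z.
have l2 : M * `|e * n%:R - z| <= (`|M| + 1) * d.
  apply: (@le_trans _ _ ((`|M| + 1) * `|e * n%:R - z|)).
    by rewrite ler_wpM2r// (le_trans (ler_norm M))// lerDl.
  by rewrite ler_wpM2l ?(ltW M0)// distrC ltW.
have l3 := ler_normD (f (e * n%:R) - f z) (f z).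
by rewrite subrK in l3; lra.
Unshelve. all: by end_near. Qed.

End calculus.

(** * Energy estimate *)

Section energy.
Context {R : realType}.
Notation mu := (@lebesgue_measure R).
Implicit Types (x y xi K : R).

Lemma L2N (f : R -> R) : L2 f -> L2 (fun x => - f x).
Proof. by move=> hf; have := L2Z (-1) hf; congr L2; apply/funext => x; rewrite mulN1r. Qed.

Lemma regB (a a' : R -> R) : reg a -> reg a' -> reg (fun xi => a xi - a' xi).
Proof.
move=> [h1 h2 h3 h4] [h1' h2' h3' h4']; split; [exact: L1B|exact: L2B| |].
- by have := L1B h3 h3'; congr L1; apply/funext => xi; rewrite mulrBr.
- by have := L2B h4 h4'; congr L2; apply/funext => xi; rewrite mulrBr.
Qed.

Variables (u1 u2 a1 b1 a2 b2 va vb S : R -> R) (K c M : R).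
Hypotheses (h1 : FT u1 a1 b1) (h2 : FT u2 a2 b2).
Hypotheses (c1 : continuous u1) (c2 : continuous u2).
Hypotheses (ra1 : reg a1) (rb1 : reg b1) (ra2 : reg a2) (rb2 : reg b2).
Hypotheses (va1 : L1 va) (va2 : L2 va) (vb1 : L1 vb) (vb2 : L2 vb).
Hypotheses (mS : measurable_fun setT S) (SM : forall xi, `|S xi| <= M).
Hypotheses (K1 : forall x, `|derive1 u1 x| <= K) (K2 : forall x, `|derive1 u2 x| <= K).

Let wa xi := a1 xi - a2 xi.
Let wb xi := b1 xi - b2 xi.
Let qa xi := - (xi ^+ 2 * wb xi) * S xi.
Let qb xi := - (- (xi ^+ 2 * wa xi) * S xi).
Let W x := u1 x - u2 x.

(** The difference of the two equations at one time. [va], [vb] stand for the transform of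
    $\partial_t(u_1-u_2)$; $q_a+iq_b$ is $-iS$ times $-\xi^2(w_a+iw_b)$, so that [c * ift qa qb]
    stands for $\mathcal H\partial_x^2$ of the difference. *)
Hypothesis eqn : forall x, (2 * pi)^-1 * ift va vb x - c * ift qa qb x +
  (u1 x * derive1 u1 x - u2 x * derive1 u2 x) = 0.

Let hW : FT W wa wb. Proof. exact: FTB. Qed.
Let cW : continuous W. Proof. by move=> x; apply: cvgB; [exact: c1|exact: c2]. Qed.
Let rwa : reg wa. Proof. exact: regB. Qed.
Let rwb : reg wb. Proof. exact: regB. Qed.
Let L2W : L2 W. Proof. by have [] := hW. Qed.

Let d1 := reg_is_derive1 h1 c1 ra1 rb1.
Let d2 := reg_is_derive1 h2 c2 ra2 rb2.
(** Skew-adjointness is pointwise in frequency: [qa * wa + qb * wb] vanishes identically because the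
    multiplier is $-i$ times a real [S]. The [ift] factors are only known to be bounded, hence a
    limit over windows. *)
Lemma energy_pairing : (fun n => \int[mu]_(x in window n)
    (W x * (u1 x * derive1 u1 x - u2 x * derive1 u2 x))) @ \oo -->
  - ((2 * pi)^-1 * intR (fun xi => va xi * wa xi + vb xi * wb xi)).
Proof.
have [_ _ a1' a2'] := rwa; have [_ _ b1' b2'] := rwb.
have [[_ L2wa _ _] [_ L2wb _ _]] := (rwa, rwb).
have qa1 : L1 qa by exact: L1_bounded (L1N b1') mS SM.
have qb1 : L1 qb.
  by exact: L1N (L1_bounded (L1N a1') mS SM).
have qa2 : L2 qa by exact: L2_bounded (L2N b2') mS SM.
have qb2 : L2 qb by apply: L2N; exact: L2_bounded (L2N a2') mS SM.
have l1 := FT_pairing hW va1 va2 vb1 vb2.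
have l2 := FT_pairing hW qa1 qa2 qb1 qb2.
have q0 : intR (fun xi => qa xi * wa xi + qb xi * wb xi) = 0.
  by rewrite -[RHS]intR0; apply: eq_intR => xi; rewrite /qa /qb; ring.
rewrite q0 in l2.
have -> : - ((2 * pi)^-1 * intR (fun xi => va xi * wa xi + vb xi * wb xi)) =
    c * 0 - (2 * pi)^-1 * intR (fun xi => va xi * wa xi + vb xi * wb xi).
  by rewrite mulr0 sub0r.
have cc (k : R) : (fun=> k) @ \oo --> (k : R) by exact: cvg_cst.
apply: cvg_ext (cvgB (cvgM (cc c) l2) (cvgM (cc (2 * pi)^-1) l1)) => n.
have iw (pa pb : R -> R) : L1 pa -> L1 pb ->
    L1 (fun x => W x * ift pa pb x * \1_(window n) x).
  move=> hpa hpb.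
  have := L1_bounded (L2_window n L2W) (ift_meas hpa hpb) (fun x => ift_le x hpa hpb).
  by congr L1; apply/funext => x; rewrite mulrAC.
have i1 := iw _ _ qa1 qb1; have i2 := iw _ _ va1 vb1.
transitivity (c * \int[mu]_(x in window n) (W x * ift qa qb x) -
  (2 * pi)^-1 * \int[mu]_(x in window n) (W x * ift va vb x)) => //.
rewrite !intR_indic -(intRZ c i1) -(intRZ (2 * pi)^-1 i2) -(intRB (L1Z c i1) (L1Z _ i2)).
apply: eq_intR => x; have := eqn x; set D := u1 x * _ - _ => e.
rewrite (_ : D = c * ift qa qb x - (2 * pi)^-1 * ift va vb x); first by ring.
by move: e; lra.
Qed.

(** With $W=u_1-u_2$, $W(u_1u_1'-u_2u_2')=(\frac12u_1W^2)'+(u_2'-\frac12u_1')W^2$. No derivative of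
    [W] remains in the second term, whose coefficient is at most $\frac32K$. *)
Lemma energy_by_parts n : 0 <= K -> 
  `|\int[mu]_(x in window n) (W x * (u1 x * derive1 u1 x - u2 x * derive1 u2 x))| <=
  `|2^-1 * (u1 n%:R * W n%:R ^+ 2 - u1 (- n%:R) * W (- n%:R) ^+ 2)| +
  3 / 2 * K * intR (fun x => W x ^+ 2).
Proof.
move=> K0.
have cd1 := reg_derive1_cont h1 c1 ra1 rb1; have cd2 := reg_derive1_cont h2 c2 ra2 rb2.
pose D1 := derive1 u1; pose D2 := derive1 u2.
pose g x := 2^-1 * (u1 x * (W x * W x)).
pose dg x := 2^-1 * (D1 x * (W x * W x) +
  u1 x * ((D1 x - D2 x) * W x + W x * (D1 x - D2 x))).
have hdg (x : R) : is_derive x 1 g (dg x).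
  have dWx : is_derive x 1 W (D1 x - D2 x) by exact: derB.
  exact: (derZ 2^-1 (derM (d1 x) (derM dWx dWx))).
have cdg : continuous dg.
  have cD : continuous (fun x => D1 x - D2 x).
    by move=> x; apply: cvgB; [exact: cd1|exact: cd2].
  move=> x; apply: cvgM; first exact: cvg_cst.
  apply: cvgD; first by apply: cvgM; [exact: cd1|apply: cvgM; exact: cW].
  apply: cvgM; first exact: c1.
  by apply: cvgD; apply: cvgM; first [exact: cD|exact: cW].
have nn : - n%:R <= n%:R :> R by rewrite (@le_trans _ _ 0) ?oppr_le0.
have ftc_g := Rftc nn (fun x _ => hdg x) (fun x _ => cdg x).
have [mW W2] := L2W.
pose r x := (D2 x - 2^-1 * D1 x) * W x ^+ 2.
have rle x : `|r x| <= 3 / 2 * K * W x ^+ 2.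
  rewrite normrM (ger0_norm (sqr_ge0 _)) ler_wpM2r ?sqr_ge0//.
  rewrite (le_trans (ler_normB _ _))// normrM ger0_norm ?invr_ge0//.
  by have := K1 x; have := K2 x; rewrite /D1 /D2; lra.
have mr : measurable_fun setT r.
  apply: continuous_measurable_fun => x; apply: cvgM; last first.
    by apply: cvgM; exact: cW.
  by apply: cvgB; [exact: cd2|apply: cvgM; [exact: cvg_cst|exact: cd1]].
have L1r : L1 r by apply: L1_le (L1Z (3 / 2 * K) W2) rle.
have irn : L1 (fun x => r x * \1_(window n) x).
  by apply: L1_indic => //; exact: measurable_window.
have idg : L1 (fun x => dg x * \1_(window n) x).
  have [B hB] : exists B, forall x, window n x -> `|dg x| <= B.
    have := @EVT_max R (fun x => `|dg x|) _ _ nn.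
    case=> [|z _ hz].
      apply: continuous_subspaceT => x; apply: continuous_comp; first exact: cdg.
      exact: norm_continuous.
    by exists `|dg z| => x hx; apply: hz.
  apply: L1_le (L1Z B (L1_window_indic n)) _.
    apply: measurable_funM; last exact: measurable_indicR (measurable_window n).
    exact: continuous_measurable_fun.
  move=> x; rewrite normrM indicE; case: (boolP (x \in _)) => [|_].
    by rewrite inE => hx; rewrite normr1 !mulr1 hB.
  by rewrite normr0 !mulr0.
have -> : \int[mu]_(x in window n) (W x * (u1 x * derive1 u1 x - u2 x * derive1 u2 x)) =
    (g n%:R - g (- n%:R)) + \int[mu]_(x in window n) r x.
  rewrite -ftc_g !intR_indic -intRD//; apply: eq_intR => x.
  by rewrite /dg /r /W /D1 /D2; field.
rewrite (le_trans (ler_normD _ _))// lerD//.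
  by rewrite /g -mulrBr !expr2.
rewrite intR_indic -intRZ//; apply: abs_intR_le; [exact: L1_meas|exact: L1Z|].
move=> x; rewrite (le_trans _ (rle x))// normrM ler_piMr//; exact: indic_le1.
Qed.

(** The two preceding lemmas in the limit of large windows. The boundary terms vanish because [u1]
    and [W] are square integrable and Lipschitz. *)
Lemma energy_estimate : 0 <= K ->
  `|intR (fun xi => va xi * wa xi + vb xi * wb xi)| <=
  3 / 2 * K * (intR (fun xi => wa xi ^+ 2) + intR (fun xi => wb xi ^+ 2)).
Proof.
move=> K0.
have [[wa1 L2wa _ _] [wb1 L2wb _ _]] := (rwa, rwb).
have pi2 : 0 < (2 * pi)^-1 :> R by rewrite invr_gt0 mulr_gt0// pi_gt0.
have WE x : W x = (2 * pi)^-1 * ift wa wb x := reg_ift hW cW rwa rwb x.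
(* Plancherel for [W], by pairing [W] with its own transform: by inversion [ift wa wb] is $2\pi W$,
   hence in $L^2$. The factor $(2\pi)^{-1}$ is then common to both sides of the estimate. *)
have W2 : intR (fun x => W x ^+ 2) =
    (2 * pi)^-1 * (intR (fun xi => wa xi ^+ 2) + intR (fun xi => wb xi ^+ 2)).
  have iE x : ift wa wb x = 2 * pi * W x.
    by rewrite WE mulrA divff ?mul1r// twopi_neq0.
  have hi : L2 (ift wa wb).
    by have := L2Z (2 * pi) L2W; congr L2; apply/funext => x; rewrite iE.
  rewrite -intRD; [|by case: L2wa|by case: L2wb].
  have := FT_pairing_L2 hW wa1 L2wa wb1 L2wb hi => e.
  transitivity ((2 * pi)^-1 * intR (fun x => W x * ift wa wb x)).
    rewrite -intRZ; last exact: L2_mul.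
    by apply: eq_intR => x; rewrite mulrCA -WE expr2.
  by rewrite e; congr (_ * _); apply: eq_intR => xi; rewrite !expr2.
have lip (u : R -> R) (k : R) : (forall x : R, is_derive x 1 u (derive1 u x)) ->
    (forall x, `|derive1 u x| <= k) -> forall x y, `|u x - u y| <= k * `|x - y|.
  by move=> hu hk; exact: mvt_abs hu hk.
have dW (x : R) : is_derive x 1 W (derive1 u1 x - derive1 u2 x) by exact: derB.
have dWE x : derive1 W x = derive1 u1 x - derive1 u2 x := der_derive1 (dW x).
have lW := lip W (K + K) ltac:(by move=> x; rewrite dWE) ltac:(by
  move=> x; rewrite dWE (le_trans (ler_normB _ _))// lerD).
have lu := lip u1 K d1 K1.
have L2u : L2 u1 by case: h1.
have n1 : `|1 : R| = 1 := normr1 _.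
have nN1 : `|-1 : R| = 1 by rewrite normrN1.
have up := L2_lip_cvg0 L2u n1 lu; have um := L2_lip_cvg0 L2u nN1 lu.
have wp := L2_lip_cvg0 L2W n1 lW; have wm := L2_lip_cvg0 L2W nN1 lW.
pose Bn (n : nat) : R := `|2^-1 * (u1 n%:R * W n%:R ^+ 2 - u1 (- n%:R) * W (- n%:R) ^+ 2)| +
  3 / 2 * K * intR (fun x => W x ^+ 2).
have lb : Bn @ \oo -->
    (`|2^-1 * (0 * (0 * 0) - 0 * (0 * 0))| + 3 / 2 * K * intR (fun x => W x ^+ 2) : R).
  apply: cvgD; last exact: cvg_cst.
  apply: cvg_norm; apply: cvgM; first exact: cvg_cst.
  apply: cvg_ext (cvgB (cvgM up (cvgM wp wp)) (cvgM um (cvgM wm wm))) => n /=.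
  transitivity (u1 (1 * n%:R) * (W (1 * n%:R) * W (1 * n%:R)) -
    u1 (-1 * n%:R) * (W (-1 * n%:R) * W (-1 * n%:R))) => //.
  by rewrite mul1r mulN1r !expr2.
rewrite (_ : 2^-1 * (0 * (0 * 0) - 0 * (0 * 0)) = 0 :> R) ?normr0 ?add0r ?W2 in lb; last by ring.
pose Pn (n : nat) : R := `|\int[mu]_(x in window n)
  (W x * (u1 x * derive1 u1 x - u2 x * derive1 u2 x))|.
have lp : Pn @ \oo -->
    (`|- ((2 * pi)^-1 * intR (fun xi => va xi * wa xi + vb xi * wb xi))| : R).
  by apply: cvg_norm; exact: energy_pairing.
have : `|- ((2 * pi)^-1 * intR (fun xi => va xi * wa xi + vb xi * wb xi))| <=
    3 / 2 * K * ((2 * pi)^-1 *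
      (intR (fun xi => wa xi ^+ 2) + intR (fun xi => wb xi ^+ 2))).
  by apply: (ler_cvg_to lp lb); apply: nearW => n; exact: energy_by_parts.
rewrite normrN normrM (ger0_norm (ltW pi2)) => le.
by rewrite -(ler_pM2l pi2) (le_trans le)//; apply: eq_lerW; ring.
Qed.

End energy.

(** * Unique continuation for solutions *)

Section fixed_time.
Context {R : realType}.
Notation mu := (@lebesgue_measure R).
Implicit Types (f a b : R -> R) (x y xi : R).

Lemma hilbert_derive2 : exists S : R -> R, exists M : R,
  [/\ measurable_fun setT S, forall xi, `|S xi| <= M &
   forall f a b x, FT f a b -> continuous f -> reg a -> reg b ->
   (fun e => \int[mu]_(y in outside e) (derive1n 2 f (x - y) / y)) @ 0^'+ -->
   (2 * pi)^-1 * ift (fun xi => - (xi ^+ 2 * b xi) * S xi)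
                     (fun xi => - (- (xi ^+ 2 * a xi) * S xi)) x].
Proof.
have [L hL] := @hilbert_symbol R.
have mS : measurable_fun setT (fun xi : R => 2 * (L * Num.sg xi)).
  by do 2 apply: measurable_funM => //; exact: measurable_sg.
have SM xi : `|2 * (L * Num.sg xi)| <= 2 * `|L|.
  rewrite !normrM (@ger0_norm _ 2)// ler_wpM2l// ler_piMr// normr_sg.
  by case: (_ == _).
exists (fun xi => 2 * (L * Num.sg xi)), (2 * `|L|); split => // f a b x hf cf ra rb.
have [_ _ a1 _] := ra; have [_ _ b1 _] := rb.
have k1 := L1Z (2 * pi)^-1 (L1N a1); have k2 := L1Z (2 * pi)^-1 (L1N b1).
have e y : (2 * pi)^-1 * ift (fun xi => - (xi ^+ 2 * a xi)) (fun xi => - (xi ^+ 2 * b xi)) y =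
   ift (fun xi => (2 * pi)^-1 * - (xi ^+ 2 * a xi)) (fun xi => (2 * pi)^-1 * - (xi ^+ 2 * b xi)) y.
  by rewrite (ift_scale _ _ (L1N a1) (L1N b1)).
have h2 := L2_derive2 hf cf ra rb.
have := hL _ _ x k1 k2 _; rewrite (reg_derive2E hf cf ra rb) => lim.
have {}lim := lim ltac:(by move: h2; congr L2; apply/funext => y; exact: e).
rewrite -ift_scale; first last.
- exact: L1N (L1_bounded (L1N a1) mS SM).
- exact: L1_bounded (L1N b1) mS SM.
have -> : ift (fun xi => (2 * pi)^-1 * (- (xi ^+ 2 * b xi) * (2 * (L * Num.sg xi))))
     (fun xi => (2 * pi)^-1 * - (- (xi ^+ 2 * a xi) * (2 * (L * Num.sg xi)))) x =
   ift (fun xi => (2 * pi)^-1 * - (xi ^+ 2 * b xi) * (2 * (L * Num.sg xi)))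
     (fun xi => - ((2 * pi)^-1 * - (xi ^+ 2 * a xi) * (2 * (L * Num.sg xi)))) x.
  by apply: eq_intR => xi; ring.
apply: cvg_ext lim => e'; apply: eq_Rintegral => y _.
by rewrite e.
Qed.

Lemma hilbert_cvg f x (l : R) :
  (fun e => \int[mu]_(y in outside e) (f (x - y) / y)) @ 0^'+ --> l ->
  hilbert f x = pi^-1 * l.
Proof. by move=> h; rewrite /hilbert; congr (_ * _); exact: cvg_lim h. Qed.

(** [hilbert] is written with [lim], which carries information only where the limit exists; hence
    the two convergence hypotheses. Square integrability lets the truncated integrals be
    subtracted. *)
Lemma hilbert_eq_pv (g1 g2 : R -> R) x (l1 l2 : R) : L2 g1 -> L2 g2 ->
  (fun e => \int[mu]_(y in outside e) (g1 (x - y) / y)) @ 0^'+ --> l1 ->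
  (fun e => \int[mu]_(y in outside e) (g2 (x - y) / y)) @ 0^'+ --> l2 ->
  hilbert g1 x = hilbert g2 x ->
  (fun e => \int[mu]_(y in outside e) ((g1 (x - y) - g2 (x - y)) / y)) @ 0^'+ --> (0 : R).
Proof.
move=> hg1 hg2 p1 p2; rewrite (hilbert_cvg p1) (hilbert_cvg p2).
have pi0 : pi^-1 != 0 :> R by rewrite invr_neq0// gt_eqF// pi_gt0.
move=> /(mulfI pi0) l12; rewrite l12 in p1.
have : (fun e => \int[mu]_(y in outside e) (g1 (x - y) / y) -
   \int[mu]_(y in outside e) (g2 (x - y) / y)) @ 0^'+ --> (l2 - l2 : R).
  exact: cvgB.
rewrite subrr; apply: cvg_trans; apply: near_eq_cvg; near=> e.
have e0 : 0 < e by near: e; exact: nbhs_right_gt.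
have io f : L2 f -> L1 (fun y => f (x - y) / y * \1_(outside e) y).
  move=> hf; have := L2_mul (L2_reflect x hf) (L2_outside_inv e0).
  by congr L1; apply/funext => y /=; rewrite mulrA mulrAC.
rewrite /= !intR_indic -intRB; [|exact: io|exact: io].
by apply: eq_intR => y; rewrite -!mulrBl.
Unshelve. all: by end_near. Qed.

Lemma eq_on_derive (f g df dg : R -> R) (x0 d : R) :
  (forall x : R, is_derive x 1 f (df x)) -> (forall x : R, is_derive x 1 g (dg x)) ->
  (forall x, `|x - x0| < d -> f x = g x) ->
  forall x, `|x - x0| < d -> df x = dg x.
Proof.
move=> hf hg fg x hx.
have nfg : \forall y \near x, f y = g y.
  have : \forall y \near x, `|y - x| < d - `|x - x0|.
    have e0 : 0 < d - `|x - x0| by rewrite subr_gt0.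
    apply: filterS (nbhsx_ballx x _ e0) => y /=.
    by rewrite -ball_normE /= distrC.
  apply: filterS => y hy; apply: fg.
  by rewrite -(subrK x y) -addrA (le_lt_trans (ler_normD _ _))// -ltrBrDr.
rewrite -(der_derive1 (hf x)) -(der_derive1 (hg x)) !derive1E.
exact: near_eq_derive.
Qed.

Variables (f1 f2 a1 b1 a2 b2 : R -> R) (x0 d : R).
Hypotheses (h1 : FT f1 a1 b1) (h2 : FT f2 a2 b2).
Hypotheses (c1 : continuous f1) (c2 : continuous f2).
Hypotheses (ra1 : reg a1) (rb1 : reg b1) (ra2 : reg a2) (rb2 : reg b2).
Hypothesis d0 : 0 < d.

(** The principal value argument gives equal second derivatives everywhere. The differences of the
    first derivatives and of the functions are then constant in turn, and each constant is 0 at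
    [x0]. *)
Lemma hilbert_unique_continuation :
  (forall x, `|x - x0| < d -> f1 x = f2 x) ->
  (forall x, `|x - x0| < d ->
     hilbert (derive1n 2 f1) x = hilbert (derive1n 2 f2) x) ->
  forall x, f1 x = f2 x.
Proof.
move=> feq heq.
have [S [M [_ _ pv]]] := hilbert_derive2.
have d1 := reg_is_derive1 h1 c1 ra1 rb1; have d2 := reg_is_derive1 h2 c2 ra2 rb2.
have dd1 := reg_is_derive2 h1 c1 ra1 rb1; have dd2 := reg_is_derive2 h2 c2 ra2 rb2.
have l1 := L2_derive1n2 h1 c1 ra1 rb1; have l2 := L2_derive1n2 h2 c2 ra2 rb2.
have e1 := eq_on_derive d1 d2 feq.
have e2 := eq_on_derive dd1 dd2 e1.
pose W x := derive1n 2 f1 x - derive1n 2 f2 x.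
have W0 : forall x, W x = 0.
  apply: (@pv_unique_continuation _ W x0 d d0).
  - move=> x; apply: cvgB.
      exact: reg_derive2_cont h1 c1 ra1 rb1 x.
    exact: reg_derive2_cont h2 c2 ra2 rb2 x.
  - exact: L2B.
  - by move=> x hx; rewrite /W e2// subrr.
  move=> x hx.
  have p1 := pv _ _ _ x h1 c1 ra1 rb1; have p2 := pv _ _ _ x h2 c2 ra2 rb2.
  exact: (hilbert_eq_pv l1 l2 p1 p2 (heq x hx)).
have const (g dg : R -> R) : (forall x : R, is_derive x 1 g (dg x)) ->
    (forall x, dg x = 0) -> forall x, g x = g x0.
  move=> hg dg0 x; apply/eqP; rewrite -subr_eq0 -normr_le0.
  by have := mvt_abs hg (M := 0) _ x x0; rewrite mul0r; apply => y; rewrite dg0 normr0.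
have x00 : `|x0 - x0| < d by rewrite subrr normr0.
have D0 x : derive1 f1 x - derive1 f2 x = 0.
  rewrite (const (fun x => derive1 f1 x - derive1 f2 x) W) //.
  by rewrite e1// subrr.
move=> x; apply/eqP; rewrite -subr_eq0; apply/eqP.
rewrite (const (fun x => f1 x - f2 x) (fun x => derive1 f1 x - derive1 f2 x)) //.
by rewrite feq// subrr.
Qed.

End fixed_time.

(** * Uniform bounds from Sobolev norms and pointwise derivatives in time *)

Section sobolev_embedding.
Context {R : realType}.
Notation mu := (@lebesgue_measure R).
Implicit Types (f a b : R -> R) (x y xi q r s t : R).

Lemma iftB (a b a' b' : R -> R) x : L1 a -> L1 b -> L1 a' -> L1 b' ->
  ift (fun xi => a xi - a' xi) (fun xi => b xi - b' xi) x = ift a b x - ift a' b' x.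
Proof.
move=> ha hb ha' hb'; rewrite -intRB; [|exact: L1_ift|exact: L1_ift].
by apply: eq_intR => xi; ring.
Qed.

Lemma wnorm2_L1 q : 1 / 2 < q -> exists2 C : R, 0 <= C & forall r a b,
  L2 (fun xi => weight (r + q) xi * a xi) -> L2 (fun xi => weight (r + q) xi * b xi) ->
  [/\ L1 (fun xi => weight r xi * a xi), L1 (fun xi => weight r xi * b xi) &
   intR (fun xi => `|weight r xi * a xi| + `|weight r xi * b xi|) <=
   C * Num.sqrt (wnorm2 (r + q) a b)].
Proof.
move=> /weight_L1[C C0 hC]; exists (2 * Num.sqrt C); first by rewrite mulr_ge0// sqrtr_ge0.
move=> r a b ha hb; have [a1 ale] := hC r a ha; have [b1 ble] := hC r b hb.
split => //; rewrite intRD; [|exact: L1_abs|exact: L1_abs].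
have key (I J : R) : 0 <= I -> I ^+ 2 <= C * J -> J <= wnorm2 (r + q) a b ->
    I <= Num.sqrt C * Num.sqrt (wnorm2 (r + q) a b).
  move=> I0 IJ Jw; rewrite -sqrtrM// -(ger0_norm I0) -sqrtr_sqr ler_wsqrtr//.
  by rewrite (le_trans IJ)// ler_wpM2l.
have i0 (g : R -> R) : 0 <= intR (fun xi => `|g xi|) by apply: intR_ge0.
have := key _ _ (i0 _) ale _; have := key _ _ (i0 _) ble _.
rewrite /wnorm2 lerDr lerDl !intR_sqr_ge0 => /(_ isT) h1 /(_ isT) h2.
by rewrite -mulrA mulr2n mulrDl mul1r lerD.
Qed.

Lemma ift_wnorm2 q : 1 / 2 < q -> exists2 C : R, 0 <= C & forall a b,
  L2 (fun xi => weight q xi * a xi) -> L2 (fun xi => weight q xi * b xi) ->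
  [/\ L1 a, L1 b & forall x, `|ift a b x| <= C * Num.sqrt (wnorm2 q a b)].
Proof.
move=> /wnorm2_L1[C C0 hC]; exists C => // a b; have := hC 0 a b; rewrite add0r.
have w0 (g : R -> R) : (fun xi => weight 0 xi * g xi) = g.
  by apply/funext => xi; rewrite weight0 mul1r.
move=> h ha hb; have [a1 b1 le] := h ha hb; rewrite !w0 in a1 b1; split => // x.
rewrite (le_trans (ift_le x a1 b1))// (le_trans _ le)//; apply/eq_lerW.
by apply: eq_intR => xi; rewrite !weight0 !mul1r.
Qed.

(** Since $|\xi|\le1+\xi^2$, the Fourier integral of the derivative is controlled by the weight of
    order 2. [C] is the same for all [f], which yields slopes bounded uniformly in time. *)
Lemma derive1_wnorm2 s : 5 / 2 < s -> exists2 C : R, 0 <= C & forall f a b,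
  FT f a b -> continuous f ->
  L2 (fun xi => weight s xi * a xi) -> L2 (fun xi => weight s xi * b xi) ->
  forall x, `|derive1 f x| <= C * Num.sqrt (wnorm2 s a b).
Proof.
move=> hs; have [C C0 hC] := @wnorm2_L1 (s - 2) ltac:(by lra).
have p0 := @inv_twopi_ge0 R.
exists ((2 * pi)^-1 * C); first exact: mulr_ge0.
move=> f a b hf cf ha hb x.
have [ra rb] := (weight_reg hs ha, weight_reg hs hb).
rewrite (reg_derive1E hf cf ra rb) normrM (ger0_norm p0) -mulrA ler_wpM2l//.
have := hC 2 a b; rewrite (_ : 2 + (s - 2) = s); last by ring.
move=> /(_ ha hb)[a1 b1 le].
have [xa1 xb1] := (reg_L1X ra, reg_L1X rb).
rewrite (le_trans (ift_le x (L1N xb1) xa1))// (le_trans _ le)//; apply: le_intR.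
- by apply: L1D; apply: L1_abs => //; exact: L1N.
- by apply: L1D; exact: L1_abs.
have lex (g : R -> R) xi : `|xi * g xi| <= `|weight 2 xi * g xi|.
  by rewrite !normrM ler_wpM2r// weight2 (le_trans (abs_le1Dsqr xi))// ler_norm.
by move=> xi; rewrite normrN addrC lerD.
Qed.

Lemma intR_sqr_cvg (I : Type) (F : set_system I) {FF : Filter F}
  (f_ : I -> R -> R) (g : R -> R) : L2 g -> (\forall i \near F, L2 (f_ i)) ->
  (fun i => intR (fun x => (f_ i x - g x) ^+ 2)) @ F --> (0 : R) ->
  (fun i => intR (fun x => f_ i x ^+ 2)) @ F --> intR (fun x => g x ^+ 2).
Proof.
move=> hg hn l.
have hn' : \forall i \near F, L2 (fun x => f_ i x - g x).
  by apply: filterS hn => i hi; exact: L2B.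
have l2 := L2_ip_cvg0 (FF := FF) hg hn' l.
have : (fun i => intR (fun x => (f_ i x - g x) ^+ 2) +
    2 * intR (fun x => (f_ i x - g x) * g x) + intR (fun x => g x ^+ 2)) @ F -->
    (0 + 2 * 0 + intR (fun x => g x ^+ 2) : R).
  apply: cvgD; last exact: cvg_cst.
  by apply: cvgD => //; apply: cvgM => //; exact: cvg_cst.
rewrite mulr0 addr0 add0r; apply: cvg_trans; apply: near_eq_cvg.
apply: filterS hn' => i hi.
have [_ i1] := hi; have i2 := L2_mul hi hg; have [_ i3] := hg.
rewrite -(intRZ 2 i2) -(intRD i1 (L1Z 2 i2)) -(intRD (L1D i1 (L1Z 2 i2)) i3).
by apply: eq_intR => x; ring.
Qed.

(** For $q>1/2$ the $H^q$ norm of the error of the difference quotient bounds its inverse Fourier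
    integral at every point. Inversion identifies that integral with the pointwise error, through
    the continuous representatives. *)
Lemma pointwise_derivative q (u a b : R -> R -> R) (va vb : R -> R) t :
  1 / 2 < q ->
  (\forall h \near (0 : R), sobolev_repr q (u (t + h)) (a (t + h)) (b (t + h))) ->
  L2 (fun xi => weight q xi * va xi) -> L2 (fun xi => weight q xi * vb xi) ->
  (fun h : R => wnorm2 q (fun xi => h^-1 * (a (t + h) xi - a t xi) - va xi)
                   (fun xi => h^-1 * (b (t + h) xi - b t xi) - vb xi)) @ 0^' --> (0 : R) ->
  forall x : R, is_derive t 1 (u ^~ x) ((2 * pi)^-1 * ift va vb x).
Proof.
move=> hq hn hva hvb l x; have [C C0 hC] := ift_wnorm2 hq.
have [ct ft at_ bt] : sobolev_repr q (u t) (a t) (b t).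
  by have := nbhs_singleton hn; rewrite addr0.
have [va1 vb1 _] := hC _ _ hva hvb.
have [at1 bt1 _] := hC _ _ at_ bt.
pose N (h : R) := wnorm2 q (fun xi => h^-1 * (a (t + h) xi - a t xi) - va xi)
                   (fun xi => h^-1 * (b (t + h) xi - b t xi) - vb xi).
apply: is_derive_cvg; apply/subr_cvg0.
have lim : (fun h => (2 * pi)^-1 * (C * Num.sqrt (N h))) @ (0 : R)^' -->
    ((2 * pi)^-1 * (C * Num.sqrt 0) : R).
  apply: cvgM; first exact: cvg_cst.
  apply: cvgM; first exact: cvg_cst.
  by apply: (cvg_comp _ _ l); exact: sqrt_continuous.
rewrite sqrtr0 !mulr0 in lim.
apply/norm_cvg0P; apply: (cvg0_le _ lim).
near=> h; rewrite normr_ge0 /=.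
have [ch fh ah bh] : sobolev_repr q (u (t + h)) (a (t + h)) (b (t + h)).
  by near: h; exact: nbhs_dnbhs.
have [ah1 bh1 _] := hC _ _ ah bh.
have [_ _ le] := hC _ _ (L2_weight_increment h^-1 ah at_ hva)
  (L2_weight_increment h^-1 bh bt hvb).
have p0 := @inv_twopi_ge0 R.
have inv (f c d : R -> R) : FT f c d -> continuous f -> L1 c -> L1 d ->
    f x = (2 * pi)^-1 * ift c d x.
  move=> hf cf hc hd; rewrite -(fourier_inversion hf cf hc hd) mulrA mulVf ?mul1r//.
  exact: twopi_neq0.
rewrite (inv _ _ _ fh ch ah1 bh1) (inv _ _ _ ft ct at1 bt1).
rewrite (_ : _ - _ = (2 * pi)^-1 * ift (fun xi => h^-1 * (a (t + h) xi - a t xi) - va xi)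
                   (fun xi => h^-1 * (b (t + h) xi - b t xi) - vb xi) x).
  by rewrite normrM (ger0_norm p0) ler_wpM2l.
have z1 := L1B ah1 at1; have z2 := L1B bh1 bt1.
rewrite iftB//; [|exact: L1Z|exact: L1Z].
by rewrite ift_scale// iftB//; ring.
Unshelve. all: by end_near. Qed.

End sobolev_embedding.

Lemma itv_ooW {R : numDomainType} (a b t : R) : a < t < b -> a <= t <= b.
Proof. by case/andP => /ltW -> /ltW ->. Qed.

(** * Solutions described by their transforms; uniqueness *)

Section spectral_solutions.
Context {R : realType}.
Notation mu := (@lebesgue_measure R).
Implicit Types (x y xi q r s t T : R).

(** A solution together with explicit transforms of $u$ and, as [va], [vb], of $\partial_tu$. All
    norms are real-valued integrals here, and the zero solution is covered with zero as its
    transform. *)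
Definition spectral_solution T s (u a b va vb : R -> R -> R) : Prop :=
  [/\ forall t, 0 <= t <= T -> sobolev_repr s (u t) (a t) (b t),
      forall t, 0 <= t <= T ->
        (fun t' => wnorm2 s (fun xi => a t' xi - a t xi) (fun xi => b t' xi - b t xi))
          @ within `[0, T] (nbhs t) --> (0 : R),
      forall t, 0 < t < T -> L2 (fun xi => weight (s - 2) xi * va t xi) /\
        L2 (fun xi => weight (s - 2) xi * vb t xi),
      forall t, 0 < t < T ->
        (fun h : R => wnorm2 (s - 2) (fun xi => h^-1 * (a (t + h) xi - a t xi) - va t xi)
          (fun xi => h^-1 * (b (t + h) xi - b t xi) - vb t xi)) @ 0^' --> (0 : R) &
      forall t x, 0 < t < T -> derive1 (fun t' => u t' x) t -
        hilbert (derive1n 2 (u t)) x + u t x * derive1 (u t) x = 0].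

Lemma near_itv_shift (a b t : R) : a < t < b -> \forall h \near (0 : R), a < t + h < b.
Proof.
move=> /andP[at_ tb].
have h1 : 0 < t - a by rewrite subr_gt0.
have h2 : 0 < b - t by rewrite subr_gt0.
have n0 (e : R) : 0 < e -> \forall h \near (0 : R), `|h| < e.
  move=> e0; apply: filterS (nbhsx_ballx (0 : R) _ e0) => h.
  by rewrite -ball_normE /= sub0r normrN.
apply: filterS2 (n0 _ h1) (n0 _ h2) => h.
by rewrite !ltr_norml; lra.
Qed.

(** The representative chosen by [fourier] does not depend on the Sobolev index, so the same pair
    serves the $H^s$ and the $H^{s-2}$ conditions. *)
Lemma BO_spectral T s (u : R -> R -> R) : BO_solution T s u ->
  exists a b va vb : R -> R -> R, spectral_solution T s u a b va vb.
Proof.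
move=> [cu [us uc] [[ul _] [v [vs _] vd]] eqn].
have us' t : 0 <= t <= T -> sobolev_pair s (u t) (hat_re (u t)) (hat_im (u t)).
  by move=> ht; apply: in_sobolev_FT; apply: us; rewrite /= in_itv.
have ul' t : 0 < t < T -> sobolev_pair (s - 2) (u t) (hat_re (u t)) (hat_im (u t)).
  by move=> ht; apply: in_sobolev_FT; apply: ul; rewrite /= in_itv.
have vs' t : 0 < t < T -> sobolev_pair (s - 2) (v t) (hat_re (v t)) (hat_im (v t)).
  by move=> ht; apply: in_sobolev_FT; apply: vs; rewrite /= in_itv.
exists (fun t => hat_re (u t)), (fun t => hat_im (u t)),
  (fun t => hat_re (v t)), (fun t => hat_im (v t)); split.
- move=> t ht; have [h1 h2 h3] := us' t ht; split => //.
  by apply: cu; rewrite in_itv.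
- move=> t ht; have [f0 a0 b0] := us' t ht.
  have : \forall t' \near within `[0, T] (nbhs t), 0 <= t' <= T.
    by apply: filterS (withinT _ _) => t' /=; rewrite in_itv.
  move=> hn; apply: (sobolev_norm_cvg0 _ (f_ := fun t' x => u t' x - u t x)).
    apply: filterS hn => t' ht'; have [f1 a1 b1] := us' t' ht'.
    by split; [exact: FTB|exact: L2_weightB|exact: L2_weightB].
  by apply: uc; rewrite /= in_itv.
- by move=> t ht; have [] := vs' t ht.
- move=> t ht; have [f0 a0 b0] := ul' t ht; have [g0 c0 d0] := vs' t ht.
  have hn : \forall h \near (0 : R)^', 0 < t + h < T.
    by apply: nbhs_dnbhs; exact: near_itv_shift.
  apply: (sobolev_norm_cvg0 _ (f_ := fun h x => h^-1 * (u (t + h) x - u t x) - v t x)).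
    apply: filterS hn => h hh; have [f1 a1 b1] := ul' _ hh.
    split; [|exact: L2_weight_increment|exact: L2_weight_increment].
    by apply: FTB => //; apply: FTZ; exact: FTB.
  by apply: vd; rewrite /= in_itv.
- by move=> t x ht; apply: eqn; rewrite in_itv.
Qed.

Lemma derive1_cst0 : derive1 (fun=> 0 : R) = (fun=> 0 : R).
Proof. by apply/funext => x; exact: der_derive1 (derC 0 x). Qed.

Lemma spectral_solution0 T s : spectral_solution T s
  (fun _ _ => 0) (fun _ _ => 0) (fun _ _ => 0) (fun _ _ => 0) (fun _ _ => 0).
Proof.
have L2w r : L2 (fun xi : R => weight r xi * 0).
  by have := @L2_0 R; congr L2; apply/funext => xi; rewrite mulr0.
have w0 r (a b : R -> R) : (forall xi, a xi = 0) -> (forall xi, b xi = 0) -> wnorm2 r a b = 0.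
  move=> ha hb; rewrite /wnorm2 -[RHS]addr0; congr (_ + _);
    by rewrite -[RHS]intR0; apply: eq_intR => xi; rewrite ?ha ?hb mulr0 expr0n.
split=> [t _|t _|t _|t _|t x _].
- by split=> //; [move=> x; exact: cvg_cst|exact: FT_0].
- by apply: cvg_ext (cvg_cst 0) => t'; rewrite w0// => xi; rewrite subrr.
- by split.
- by apply: cvg_ext (cvg_cst 0) => t'; rewrite w0// => xi; rewrite subrr mulr0 subrr.
- have e0 : derive1n 2 (fun=> 0 : R) = (fun=> 0 : R).
    by rewrite /derive1n /= !derive1_cst0.
  rewrite derive1_cst0 e0 mul0r addr0 sub0r (@hilbert_cvg _ _ _ 0) ?mulr0 ?oppr0//.
  apply: cvg_ext (cvg_cst 0) => e.
  by rewrite intR_indic -[LHS]intR0; apply: eq_intR => y; rewrite !mul0r.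
Qed.

Lemma wnorm2_cvg0 (I : Type) (F : set_system I) {FF : Filter F} r (p q : I -> R -> R) :
  0 <= r -> (\forall i \near F, L2 (fun xi => weight r xi * p i xi) /\
     L2 (fun xi => weight r xi * q i xi)) ->
  (fun i => wnorm2 r (p i) (q i)) @ F --> (0 : R) ->
  (fun i => intR (fun xi => p i xi ^+ 2)) @ F --> (0 : R) /\
  (fun i => intR (fun xi => q i xi ^+ 2)) @ F --> (0 : R).
Proof.
move=> r0 hn l.
have le (g : R -> R) : L2 (fun xi => weight r xi * g xi) ->
    intR (fun xi => g xi ^+ 2) <= intR (fun xi => (weight r xi * g xi) ^+ 2).
  move=> /(L2_weight_le r0)[_]; apply: le_trans; apply/eq_lerW.
  by apply: eq_intR => xi; rewrite weight0 mul1r.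
split; apply: (cvg0_le _ l);
  apply: filterS hn => i [hp hq]; rewrite intR_sqr_ge0 /=.
  by rewrite (le_trans (le _ hp))// lerDl intR_sqr_ge0.
by rewrite (le_trans (le _ hq))// lerDr intR_sqr_ge0.
Qed.

Section uniqueness.
Variables (T s : R) (u1 a1 b1 va1 vb1 u2 a2 b2 va2 vb2 : R -> R -> R).
Hypothesis hs : 5 / 2 < s.
Hypothesis S1 : spectral_solution T s u1 a1 b1 va1 vb1.
Hypothesis S2 : spectral_solution T s u2 a2 b2 va2 vb2.

Let hs2 : 1 / 2 < s - 2. Proof. by have := hs; lra. Qed.

Lemma spectral_reg (u a b va vb : R -> R -> R) t : spectral_solution T s u a b va vb ->
  0 <= t <= T -> reg (a t) /\ reg (b t).
Proof. by move=> [h _ _ _ _] /h[_ _ ha hb]; split; exact: weight_reg hs _. Qed.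

Lemma spectral_derive (u a b va vb : R -> R -> R) t x : spectral_solution T s u a b va vb ->
  0 < t < T -> is_derive t 1 (fun t' => u t' x) ((2 * pi)^-1 * ift (va t) (vb t) x).
Proof.
move=> [h _ hv hd _] ht; have [hva hvb] := hv t ht.
apply: (@pointwise_derivative _ (s - 2) u a b (va t) (vb t) t hs2 _ hva hvb (hd t ht)).
apply: filterS (near_itv_shift ht) => k /andP[/ltW k0 /ltW kT].
have [] := h (t + k) ltac:(by rewrite k0) => cu fu ha hb.
by split => //; [have [] := @L2_weight_le _ (s - 2) s _ _ ha => //; lra|
                 have [] := @L2_weight_le _ (s - 2) s _ _ hb => //; lra].
Qed.

(** The $H^s$ norm is continuous on the compact interval and attains its maximum; the embedding
    converts this maximum into the slope bound behind Gronwall's constant. *)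
Lemma spectral_slope (u a b va vb : R -> R -> R) : 0 < T ->
  spectral_solution T s u a b va vb ->
  exists2 K : R, 0 <= K & forall t x, 0 <= t <= T -> `|derive1 (u t) x| <= K.
Proof.
move=> T0 [h hc _ _ _]; have [C C0 hC] := derive1_wnorm2 hs.
have cN : {within `[0, T], continuous (fun t => wnorm2 s (a t) (b t))}.
  apply/subspace_continuousP => t /=; rewrite in_itv /= => ht.
  have [_ _ ha hb] := h t ht.
  have hn : \forall t' \near within `[0, T] (nbhs t), 0 <= t' <= T.
    by apply: filterS (withinT _ _) => t' /=; rewrite in_itv.
  have l := hc t ht.
  have part (c : R -> R -> R) : (forall t, 0 <= t <= T -> L2 (fun xi => weight s xi * c t xi)) ->
     (forall t', intR (fun xi => (weight s xi * (c t' xi - c t xi)) ^+ 2) <=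
        wnorm2 s (fun xi => a t' xi - a t xi) (fun xi => b t' xi - b t xi)) ->
     (fun t' => intR (fun xi => (weight s xi * c t' xi) ^+ 2))
       @ within `[0, T] (nbhs t) --> intR (fun xi => (weight s xi * c t xi) ^+ 2).
    move=> hcw le; apply: intR_sqr_cvg; first exact: hcw.
      by apply: filterS hn => t' ht'; exact: hcw.
    apply: (cvg0_le _ l).
    apply: filterE => t'; rewrite intR_sqr_ge0 /= (le_trans _ (le t'))//.
    by apply/eq_lerW/eq_intR => xi; rewrite mulrBr.
  apply: cvgD; apply: part => t'.
  - by move=> /h[].
  - by rewrite lerDl intR_sqr_ge0.
  - by move=> /h[].
  - by rewrite lerDr intR_sqr_ge0.
have [t0 _ ht0] := EVT_max (ltW T0) cN.
exists (C * Num.sqrt (wnorm2 s (a t0) (b t0))); first by rewrite mulr_ge0// sqrtr_ge0.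
move=> t x ht; have [ct ft ha hb] := h t ht.
rewrite (le_trans (hC _ _ _ ft ct ha hb x))// ler_wpM2l// ler_wsqrtr//.
by apply: ht0; rewrite in_itv.
Qed.

(** By Plancherel, $2\pi$ times the squared $L^2$ norm of the difference. On the Fourier side the
    $H^{s-2}$ derivative gives its time derivative at once, as the weights are at least 1. *)
Definition energy t : R := intR (fun xi => (a1 t xi - a2 t xi) ^+ 2) +
  intR (fun xi => (b1 t xi - b2 t xi) ^+ 2).


Let L2_Hs (g : R -> R) : L2 (fun xi => weight s xi * g xi) -> L2 g.
Proof.
move=> hg; have [] := @L2_weight_le _ 0 s g ltac:(by have := hs; lra) hg.
by move=> + _; congr L2; apply/funext => xi; rewrite weight0 mul1r.
Qed.

Let L2_Hs2 (g : R -> R) : L2 (fun xi => weight (s - 2) xi * g xi) -> L2 g.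
Proof.
move=> hg; have [] := @L2_weight_le _ 0 (s - 2) g ltac:(by have := hs; lra) hg.
by move=> + _; congr L2; apply/funext => xi; rewrite weight0 mul1r.
Qed.

Lemma energy_ge0 t : 0 <= energy t.
Proof. by rewrite addr_ge0// intR_sqr_ge0. Qed.

(** Transforms equal almost everywhere have equal inverse Fourier integrals, and inversion holds at
    every [x] for the continuous representatives. *)
Lemma energy_eq0 t : 0 <= t <= T -> energy t = 0 -> forall x, u1 t x = u2 t x.
Proof.
move=> ht /eqP; rewrite paddr_eq0 ?intR_sqr_ge0// => /andP[/eqP ea /eqP eb] x.
have [h1 _ _ _ _] := S1; have [h2 _ _ _ _] := S2.
have [c1 f1 wa1 wb1] := h1 t ht; have [c2 f2 wa2 wb2] := h2 t ht.
have [ra1 rb1] := spectral_reg S1 ht; have [ra2 rb2] := spectral_reg S2 ht.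
have [A1 A2 _ _] := regB ra1 ra2; have [B1 B2 _ _] := regB rb1 rb2.
have cW : continuous (fun x => u1 t x - u2 t x).
  by move=> y; apply: cvgB; [exact: c1|exact: c2].
have e := fourier_inversion (FTB f1 f2) cW A1 B1 x.
have i0 : 2 * pi * (u1 t x - u2 t x) = 0.
  rewrite e -(@intR0 R); apply: intR_ae => //; first exact: L1_meas (L1_ift x A1 B1).
  apply: ae_imply (ae_and (intR_sqr_eq0 A2 ea) (intR_sqr_eq0 B2 eb)) => xi [-> ->].
  by rewrite !mul0r subrr.
move/eqP: i0; rewrite mulf_eq0 (negPf (@twopi_neq0 R)) /= subr_eq0 => /eqP.
exact.
Qed.

Lemma energy_eq t : (forall x, u1 t x = u2 t x) -> 0 <= t <= T -> energy t = 0.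
Proof.
move=> u12 ht; have [h1 _ _ _ _] := S1; have [h2 _ _ _ _] := S2.
have [_ f1 _ _] := h1 t ht; have [_ f2 _ _] := h2 t ht.
have e : u1 t = u2 t by apply/funext.
rewrite e in f1; have [_ [[A1 _] [B1 _]] _ _ _] := FTB f1 f2.
rewrite /energy -[RHS]addr0; congr (_ + _); rewrite -[RHS](@intR0 R);
  apply: intR_ae => //; try exact: measurable_funX.
  by apply: ae_imply (FT_unique f1 f2) => xi [-> _]; rewrite subrr expr0n.
by apply: ae_imply (FT_unique f1 f2) => xi [_ ->]; rewrite subrr expr0n.
Qed.

Lemma energy_derive t : 0 < t < T -> is_derive t 1 energy
  (2 * intR (fun xi => (va1 t xi - va2 t xi) * (a1 t xi - a2 t xi) +
                       (vb1 t xi - vb2 t xi) * (b1 t xi - b2 t xi))).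
Proof.
move=> ht; have [h1 _ v1 d1 _] := S1; have [h2 _ v2 d2 _] := S2.
have htT := itv_ooW ht.
have hn : \forall h \near (0 : R)^', 0 <= t + h <= T.
  apply: nbhs_dnbhs; apply: filterS (near_itv_shift ht) => h /andP[h0 hT].
  by rewrite !ltW.
have [va1t vb1t] := v1 t ht; have [va2t vb2t] := v2 t ht.
have [_ _ ? ?] := h1 t htT; have [_ _ ? ?] := h2 t htT.
have low (g : R -> R) : L2 (fun xi => weight s xi * g xi) ->
    L2 (fun xi => weight (s - 2) xi * g xi).
  by move=> hg; have [] := @L2_weight_le _ (s - 2) s g ltac:(lra) hg.
have wz (c w : R -> R -> R) :
    (forall t, 0 <= t <= T -> L2 (fun xi => weight s xi * c t xi)) ->
    L2 (fun xi => weight (s - 2) xi * w t xi) -> forall h, 0 <= t + h <= T ->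
    L2 (fun xi => weight (s - 2) xi * (h^-1 * (c (t + h) xi - c t xi) - w t xi)).
  move=> hc hw h hh; apply: L2_weight_increment => //; apply: low; exact: hc.
have key (c1 c2 w1 w2 : R -> R -> R) :
    (forall t, 0 <= t <= T -> L2 (fun xi => weight s xi * c1 t xi)) ->
    (forall t, 0 <= t <= T -> L2 (fun xi => weight s xi * c2 t xi)) ->
    L2 (fun xi => weight (s - 2) xi * w1 t xi) ->
    L2 (fun xi => weight (s - 2) xi * w2 t xi) ->
    (fun h : R => intR (fun xi => (h^-1 * (c1 (t + h) xi - c1 t xi) - w1 t xi) ^+ 2))
      @ 0^' --> (0 : R) ->
    (fun h : R => intR (fun xi => (h^-1 * (c2 (t + h) xi - c2 t xi) - w2 t xi) ^+ 2))
      @ 0^' --> (0 : R) ->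
    is_derive t 1 (fun t => intR (fun xi => (c1 t xi - c2 t xi) ^+ 2))
      (2 * intR (fun xi => (w1 t xi - w2 t xi) * (c1 t xi - c2 t xi))).
  move=> k1 k2 hw1 hw2 l1 l2.
  apply: (@is_derive_norm2 _ (fun t xi => c1 t xi - c2 t xi) (fun xi => w1 t xi - w2 t xi)).
  - by apply: L2B; apply: L2_Hs; [exact: k1|exact: k2].
  - by apply: L2B; exact: L2_Hs2.
  - by apply: filterS hn => h hh; apply: L2B; apply: L2_Hs; [exact: k1|exact: k2].
  apply: cvg_ext (L2_lin_cvg0 (-1) _ _ l1 l2) => [h||].
  - by apply: eq_intR => xi; congr (_ ^+ 2); ring.
  - by apply: filterS hn => h hh; apply: L2_Hs2; exact: wz.
  - by apply: filterS hn => h hh; apply: L2_Hs2; exact: wz.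
have pa1 r (h : 0 <= r <= T) : L2 (fun xi => weight s xi * a1 r xi) by have [] := h1 r h.
have pb1 r (h : 0 <= r <= T) : L2 (fun xi => weight s xi * b1 r xi) by have [] := h1 r h.
have pa2 r (h : 0 <= r <= T) : L2 (fun xi => weight s xi * a2 r xi) by have [] := h2 r h.
have pb2 r (h : 0 <= r <= T) : L2 (fun xi => weight s xi * b2 r xi) by have [] := h2 r h.
have s20 : 0 <= s - 2 by have := hs; lra.
have [la1 lb1] := wnorm2_cvg0 s20 (filterS (fun h hh => conj (wz _ _ pa1 va1t h hh)
  (wz _ _ pb1 vb1t h hh)) hn) (d1 t ht).
have [la2 lb2] := wnorm2_cvg0 s20 (filterS (fun h hh => conj (wz _ _ pa2 va2t h hh)
  (wz _ _ pb2 vb2t h hh)) hn) (d2 t ht).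
have da := key a1 a2 va1 va2 pa1 pa2 va1t va2t la1 la2.
have db := key b1 b2 vb1 vb2 pb1 pb2 vb1t vb2t lb1 lb2.
apply: der_eq (derD da db) _; rewrite -mulrDr intRD//.
- by apply: L2_mul; apply: L2B; [exact: L2_Hs2|exact: L2_Hs2|exact: L2_Hs|exact: L2_Hs].
- by apply: L2_mul; apply: L2B; [exact: L2_Hs2|exact: L2_Hs2|exact: L2_Hs|exact: L2_Hs].
Qed.

Lemma energy_derive_le : 0 < T -> exists K : R, forall t, 0 < t < T ->
  `|2 * intR (fun xi => (va1 t xi - va2 t xi) * (a1 t xi - a2 t xi) +
                        (vb1 t xi - vb2 t xi) * (b1 t xi - b2 t xi))| <= K * energy t.
Proof.
move=> T0; have [K1 K10 hK1] := spectral_slope T0 S1; have [K2 K20 hK2] := spectral_slope T0 S2.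
have [S [M [mS SM hS]]] := @hilbert_derive2 R.
exists (3 * (K1 + K2)) => t ht.
have htT := itv_ooW ht.
have [h1 _ v1 _ e1] := S1; have [h2 _ v2 _ e2] := S2.
have [c1 f1 _ _] := h1 t htT; have [c2 f2 _ _] := h2 t htT.
have [va1t vb1t] := v1 t ht; have [va2t vb2t] := v2 t ht.
have [ra1 rb1] := spectral_reg S1 htT; have [ra2 rb2] := spectral_reg S2 htT.
have [C C0 hC] := ift_wnorm2 hs2.
have [A1 B1 _] := hC _ _ va1t vb1t; have [A2 B2 _] := hC _ _ va2t vb2t.
have [P1 Q1 P2 Q2] := And4 (L2_Hs2 va1t) (L2_Hs2 vb1t) (L2_Hs2 va2t) (L2_Hs2 vb2t).
(* [K1 + K2] is a common bound for the two slopes. The constant in front of the multiplier combines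
   the $\pi^{-1}$ of [hilbert] with the $(2\pi)^{-1}$ of inversion. *)
have := @energy_estimate _ (u1 t) (u2 t) (a1 t) (b1 t) (a2 t) (b2 t)
  (fun xi => va1 t xi - va2 t xi) (fun xi => vb1 t xi - vb2 t xi) S (K1 + K2)
  (pi^-1 * (2 * pi)^-1) M f1 f2 c1 c2 ra1 rb1 ra2 rb2 (L1B A1 A2) (L2B P1 P2)
  (L1B B1 B2) (L2B Q1 Q2) mS SM.
have k1 x : `|derive1 (u1 t) x| <= K1 + K2 by rewrite (le_trans (hK1 t x htT))// lerDl.
have k2 x : `|derive1 (u2 t) x| <= K1 + K2 by rewrite (le_trans (hK2 t x htT))// lerDr.
move=> /(_ k1 k2) est.
rewrite normrM ger0_norm// (_ : 3 * (K1 + K2) * energy t = 2 * (3 / 2 * (K1 + K2) * energy t)).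
  rewrite ler_wpM2l//; apply: est; last exact: addr_ge0.
  move=> x; have {e1} E1 := e1 t x ht; have {e2} E2 := e2 t x ht.
  have D1 := der_derive1 (spectral_derive x S1 ht).
  have D2 := der_derive1 (spectral_derive x S2 ht).
  have H1 := hilbert_cvg (hS _ _ _ x f1 c1 ra1 rb1).
  have H2 := hilbert_cvg (hS _ _ _ x f2 c2 ra2 rb2).
  have [_ _ xa1 _] := ra1; have [_ _ xb1 _] := rb1.
  have [_ _ xa2 _] := ra2; have [_ _ xb2 _] := rb2.
  have I1 := L1_bounded (L1N xb1) mS SM; have I2 := L1_bounded (L1N xb2) mS SM.
  have J1 := L1N (L1_bounded (L1N xa1) mS SM); have J2 := L1N (L1_bounded (L1N xa2) mS SM).
  rewrite D1 H1 in E1; rewrite D2 H2 in E2.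
  rewrite (iftB x A1 B1 A2 B2).
  have -> : ift (fun xi => - (xi ^+ 2 * (b1 t xi - b2 t xi)) * S xi)
      (fun xi => - (- (xi ^+ 2 * (a1 t xi - a2 t xi)) * S xi)) x =
    ift (fun xi => - (xi ^+ 2 * b1 t xi) * S xi)
      (fun xi => - (- (xi ^+ 2 * a1 t xi) * S xi)) x -
    ift (fun xi => - (xi ^+ 2 * b2 t xi) * S xi)
      (fun xi => - (- (xi ^+ 2 * a2 t xi) * S xi)) x.
    by rewrite -(iftB x I1 J1 I2 J2); apply: eq_intR => xi; ring.
  set X1 := ift _ _ _ in E1 *; set Y1 := ift _ _ _ in E1 *.
  set X2 := ift _ _ _ in E2 *; set Y2 := ift _ _ _ in E2 *.
  have := congr2 (fun p q => p - q) E1 E2; rewrite subrr => <-; ring.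
by field.
Qed.

Lemma unique_continuation_in_time t0 t : 0 < t0 < T ->
  (forall x, u1 t0 x = u2 t0 x) -> 0 <= t <= T -> forall x, u1 t x = u2 t x.
Proof.
move=> ht0 u12 htT; have T0 : 0 < T by case/andP: ht0; exact: lt_trans.
have ht0' := itv_ooW ht0.
have [K hK] := energy_derive_le T0.
have E0 := gronwall_eq0 (fun t ht => energy_derive ht) hK energy_ge0 ht0
  (energy_eq u12 ht0').
apply: energy_eq0 => //.
(* Gronwall covers the open interval only. These convex combinations of [t] and the midpoint are
   interior times tending to [t], even when [t] is an endpoint, and continuity in $H^s$ carries the
   vanishing energy to [t]. *)
pose r (n : nat) : R := t + (T / 2 - t) * n.+1%:R^-1.
have r0 n : 0 < r n < T.
  have n0 : 0 < n.+1%:R^-1 :> R by rewrite invr_gt0.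
  have n1 : n.+1%:R^-1 <= 1 :> R by rewrite invf_le1 ?ler1n.
  case/andP: htT => t0' tT; rewrite /r; set k := n.+1%:R^-1 in n0 n1 *.
  have p1 : 0 <= t * (1 - k) by rewrite mulr_ge0// subr_ge0.
  have p2 : 0 < T * k by rewrite mulr_gt0.
  have p3 : 0 <= (T - t) * (1 - k) by rewrite mulr_ge0// subr_ge0.
  rewrite (_ : t + _ = t * (1 - k) + T * k / 2); last by field.
  apply/andP; split; first by lra.
  rewrite -subr_gt0 (_ : _ - _ = (T - t) * (1 - k) + T * k / 2); last by field.
  by lra.
have rt : r @ \oo --> t.
  rewrite -[X in _ --> X]addr0 -(mulr0 (T / 2 - t)).
  apply: cvgD; first exact: cvg_cst.
  by apply: cvgM; [exact: cvg_cst|exact: cvg_harmonic].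
have rw : r @ \oo --> within `[0, T] (nbhs t).
  move=> P hP; have : \forall n \near \oo, `[0, T]%classic (r n) -> P (r n) := rt _ hP.
  apply: filterS => n; apply.
  by rewrite /= in_itv /= itv_ooW.
have [h1 l1 _ _ _] := S1; have [h2 l2 _ _ _] := S2.
have rT n := itv_ooW (r0 n).
have s0 : 0 <= s by have := hs; lra.
have part (u a b va vb : R -> R -> R) : spectral_solution T s u a b va vb ->
    (fun n => intR (fun xi => (a (r n) xi - a t xi) ^+ 2)) @ \oo --> (0 : R) /\
    (fun n => intR (fun xi => (b (r n) xi - b t xi) ^+ 2)) @ \oo --> (0 : R).
  move=> [h l _ _ _]; have [_ _ at_ bt] := h t htT.
  apply: (wnorm2_cvg0 s0 _ (cvg_comp _ _ rw (l t htT))).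
  apply: filterE => n; have [_ _ an bn] := h (r n) (rT n).
  by split; exact: L2_weightB.
have [la1 lb1] := part _ _ _ _ _ S1; have [la2 lb2] := part _ _ _ _ _ S2.
have key (c1 c2 : R -> R -> R) :
    (forall t, 0 <= t <= T -> L2 (fun xi => weight s xi * c1 t xi)) ->
    (forall t, 0 <= t <= T -> L2 (fun xi => weight s xi * c2 t xi)) ->
    (fun n => intR (fun xi => (c1 (r n) xi - c1 t xi) ^+ 2)) @ \oo --> (0 : R) ->
    (fun n => intR (fun xi => (c2 (r n) xi - c2 t xi) ^+ 2)) @ \oo --> (0 : R) ->
    (fun n => intR (fun xi => (c1 (r n) xi - c2 (r n) xi) ^+ 2)) @ \oo -->
      intR (fun xi => (c1 t xi - c2 t xi) ^+ 2).
  move=> k1 k2 c1l c2l.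
  have g1 n : L2 (c1 (r n)) by apply: L2_Hs; exact: k1.
  have g2 n : L2 (c2 (r n)) by apply: L2_Hs; exact: k2.
  have g1t : L2 (c1 t) by apply: L2_Hs; exact: k1.
  have g2t : L2 (c2 t) by apply: L2_Hs; exact: k2.
  apply: intR_sqr_cvg; [exact: L2B|by apply: filterE => n; exact: L2B|].
  apply: cvg_ext (L2_lin_cvg0 (-1) _ _ c1l c2l) => [n||].
  - by apply: eq_intR => xi; congr (_ ^+ 2); ring.
  - by apply: filterE => n; exact: L2B.
  - by apply: filterE => n; exact: L2B.
have lim : (fun n => energy (r n)) @ \oo --> energy t.
  by apply: cvgD; apply: key => // t' ht'; [have [] := h1 t' ht'|have [] := h2 t' ht'|
    have [] := h1 t' ht'|have [] := h2 t' ht'].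
apply: (cvg_unique _ lim) => //.
by apply: cvg_ext (cvg_cst 0) => n; rewrite E0.
Qed.

(** All terms of the equation except the Hilbert transform are local in $(x,t)$ and agree on the
    rectangle, so solving for it gives the equality that [hilbert_unique_continuation] takes as
    input. *)
Lemma local_unique_continuation (t0 x0 d : R) : 0 < t0 < T -> 0 < d ->
  (forall t x, `|t - t0| < d -> `|x - x0| < d -> u1 t x = u2 t x) ->
  forall x, u1 t0 x = u2 t0 x.
Proof.
move=> ht d0 u12.
have htT := itv_ooW ht.
have [h1 _ _ _ e1] := S1; have [h2 _ _ _ e2] := S2.
have [c1 f1 _ _] := h1 t0 htT; have [c2 f2 _ _] := h2 t0 htT.
have [ra1 rb1] := spectral_reg S1 htT; have [ra2 rb2] := spectral_reg S2 htT.
have t00 : `|t0 - t0| < d by rewrite subrr normr0.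
apply: (hilbert_unique_continuation (x0 := x0) f1 f2 c1 c2 ra1 rb1 ra2 rb2 d0) => [x|x] hx.
  exact: u12.
have ex := eq_on_derive (reg_is_derive1 f1 c1 ra1 rb1) (reg_is_derive1 f2 c2 ra2 rb2)
  (fun x => u12 t0 x t00) hx.
have dt : derive1 (fun t' => u1 t' x) t0 = derive1 (fun t' => u2 t' x) t0.
  rewrite !derive1E; apply: near_eq_derive.
  apply: filterS (nbhsx_ballx t0 _ d0) => t.
  by rewrite -ball_normE /= distrC => h; exact: u12.
have solve (p p' h h' q q' : R) : p = p' -> q = q' -> p - h + q = 0 ->
    p' - h' + q' = 0 -> h = h' by lra.
apply: solve dt _ (e1 t0 x ht) (e2 t0 x ht).
by congr (_ * _); [exact: u12|exact: ex].
Qed.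

End uniqueness.
End spectral_solutions.

(** The given point may lie on the boundary of the strip; moving its time slightly towards $T/2$
    makes it interior while it stays in the same ball. *)
Lemma relatively_open_rectangle (R : realType) (T : R) (Omega : set (R * R)) : 0 < T ->
  Omega `<=` strip T -> @open (subspace (strip T)) Omega -> Omega !=set0 ->
  exists t0 x0 d : R, [/\ 0 < t0 < T, 0 < d &
    forall t x, `|t - t0| < d -> `|x - x0| < d -> Omega (x, t)].
Proof.
move=> T0 sub /open_subspaceP[V oV VO] [[x0 t1] O1].
have [/= _ t1T] := sub _ O1; rewrite in_itv /= in t1T; case/andP: t1T => t10 t1T.
have V1 : V (x0, t1).
  have : (Omega `&` strip T) (x0, t1) by split => //; exact: sub.
  by rewrite -VO => -[].
have /nbhs_ballP[e /= e0 eV] : nbhs (x0, t1) V by apply: open_nbhs_nbhs.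
(* As $|T/2-t_1|\le T/2$, the bound $k\le e/T$ limits the displacement to $e/2$; $0<k\le1$ places
   [t0] strictly between 0 and [T]. *)
pose k : R := Num.min 1 (e / T).
have k0 : 0 < k by rewrite lt_min ltr01 divr_gt0.
have k1 : k <= 1 by rewrite ge_min lexx.
have kT : T * k <= e.
  have : k <= e / T by rewrite ge_min lexx orbT.
  by rewrite ler_pdivlMr// mulrC.
pose t0 := t1 + (T / 2 - t1) * k.
have p1 : 0 <= t1 * (1 - k) by rewrite mulr_ge0// subr_ge0.
have p2 : 0 < T * k by rewrite mulr_gt0.
have p3 : 0 <= (T - t1) * (1 - k) by rewrite mulr_ge0// subr_ge0.
have p4 : 0 <= t1 * k by rewrite mulr_ge0// ltW.
have p5 : 0 <= (T - t1) * k by rewrite mulr_ge0 ?subr_ge0// ltW.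
have ht0 : 0 < t0 < T.
  have -> : t0 = t1 * (1 - k) + T * k / 2 by rewrite /t0; field.
  apply/andP; split; first by lra.
  rewrite -subr_gt0 (_ : _ - _ = (T - t1) * (1 - k) + T * k / 2); last by field.
  by lra.
have t01 : `|t0 - t1| <= e / 2.
  have -> : t0 - t1 = (T * k) / 2 - t1 * k by rewrite /t0; field.
  by rewrite ler_norml; apply/andP; split; move: p5; rewrite mulrBl; lra.
have /andP[t00 t0T] := ht0.
(* The first entry is the part of the radius left after the displacement, the other two keep the
   rectangle inside the strip. *)
exists t0, x0, (Num.min (e / 2) (Num.min t0 (T - t0))); split => //.
  by rewrite !lt_min divr_gt0//= t00 subr_gt0.
move=> t x; rewrite !lt_min => /and3P[h1 h2 h3] /and3P[h4 _ _].
have : (V `&` strip T) (x, t).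
  split; first apply: eV.
    split; rewrite -ball_normE /= distrC; first by lra.
    have := ler_normD (t - t0) (t0 - t1); rewrite addrA subrK => h.
    by rewrite (le_lt_trans h)//; lra.
  split => //=; rewrite in_itv /=; move: h2 h3; rewrite !ltr_norml.
  by move=> /andP[? ?] /andP[? ?]; apply/andP; split; lra.
by rewrite VO => -[].
Qed.

Theorem theorem1p1 (R : realType) (T s : R) (hT : 0 < T) (hs : 5 / 2 < s)
    (u1 u2 : R -> R -> R)
    (hu1 : BO_solution T s u1) (hu2 : BO_solution T s u2)
    (Omega : set (R * R)) (hsub : Omega `<=` strip T)
    (hopen : @open (subspace (strip T)) Omega) (hne : Omega !=set0) :
  ((forall x t, Omega (x, t) -> u1 t x = u2 t x) ->
     forall x t, strip T (x, t) -> u1 t x = u2 t x) /\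
  ((forall x t, Omega (x, t) -> u1 t x = 0) ->
     forall x t, strip T (x, t) -> u1 t x = 0).
Proof.
have [t0 [x0 [d [ht0 d0 rect]]]] := relatively_open_rectangle hT hsub hopen hne.
have [a1 [b1 [va1 [vb1 S1]]]] := BO_spectral hu1.
(* Quantified over spectral solutions so that both claims are instances: with [u2], and with the
   zero solution of [spectral_solution0]. *)
have main u a b va vb : spectral_solution T s u a b va vb ->
    (forall x t, Omega (x, t) -> u1 t x = u t x) ->
    forall x t, strip T (x, t) -> u1 t x = u t x.
  move=> S2 u12 x t [_ /=]; rewrite in_itv /= => ht.
  apply: (unique_continuation_in_time hs S1 S2 ht0 _ ht).
  apply: (local_unique_continuation (x0 := x0) hs S1 S2 ht0 d0) => t' x' ht' hx'.
  by apply: u12; exact: rect.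
split; last exact: main (spectral_solution0 T s).
by have [a2 [b2 [va2 [vb2 S2]]]] := BO_spectral hu2; exact: main S2.
Qed.
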